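(* Let $a,b>0$. For every $m\ge 0$, the lowest positive eigenvalue $\lambda_1(a,b)$ of the Dirac operator $H$ with mass $m$, subject to infinite-mass boundary conditions, on a rectangle of sides $a$ and $b$ satisfies $$ \lambda_1(a,b)^2 - m^2 \;\le\; \min\left\{\left(\frac{\nu_1(ma)}{a}\right)^2+\left(\frac{\pi}{b}\right)^2,\ \left(\frac{\pi}{a}\right)^2+\left(\frac{\nu_1(mb)}{b}\right)^2\right\}, $$ where, for $\mu>0$, $\nu_1(\mu)$ denotes the unique root $\nu$ of the equation $$ \frac{\tan(\nu)}{\nu}=-\frac{1}{\mu} $$ lying in the interval $[\frac{\pi}{2},\pi)$, and $\nu_1(0)=\frac{\pi}{2}$.
   Context: Let $\Omega=(-\frac a2,\frac a2)\times(-\frac b2,\frac b2)\subset\mathbb{R}^2$ be the open rectangle of sides $a,b>0$, with outward unit normal $n=(n_1,n_2)$ (defined almost everywhere on $\partial\Omega$), and let $m\ge 0$. The Dirac operator with infinite-mass boundary conditions is the operator $H$ in the Hilbert space $L^2(\Omega;\mathbb{C}^2)$ acting as $$ H=\begin{bmatrix} m & -i(\partial_1-i\partial_2)\\ -i(\partial_1+i\partial_2) & -m\end{bmatrix}, $$ whose domain consists of all $u=\begin{bmatrix} u_1 \\ u_2 \end{bmatrix}\in H^1(\Omega;\mathbb{C}^2)$ (Sobolev space) satisfying, in the sense of traces, the boundary condition $$ u_2=i(n_1+in_2)\,u_1\quad\text{on }\partial\Omega . $$ Explicitly, $u_2=-u_1$ on the side $x_2=\frac b2$, $u_2=u_1$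 on the side $x_2=-\frac b2$, $u_2=iu_1$ on the side $x_1=\frac a2$, and $u_2=-iu_1$ on the side $x_1=-\frac a2$. The operator $H$ is self-adjoint with compact resolvent, so its spectrum is purely discrete. The spectrum is symmetric with respect to zero, and zero is not an eigenvalue. The eigenvalues are counted starting from the first positive one: $\lambda_1(a,b)>0$ denotes the smallest positive eigenvalue of $H$. Equivalently, $\lambda_1(a,b)^2=\inf_u \|Hu\|^2/\|u\|^2$, where the infimum is over all non-zero $u$ in the domain of $H$ and $\|\cdot\|$ is the norm of $L^2(\Omega;\mathbb{C}^2)$. *)

(* Defs.v *)
From HB Require Import structures.
From mathcomp Require Import all_boot all_order all_algebra.
From mathcomp Require Import complex.
From mathcomp Require Import all_classical all_reals all_analysis.

Set Implicit Arguments.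
Unset Strict Implicit.
Unset Printing Implicit Defensive.

Import Order.TTheory GRing.Theory Num.Theory.
Import numFieldNormedType.Exports.

Local Open Scope classical_set_scope.
Local Open Scope ring_scope.

Section SquareIntegrable.
Context (R : realType).

Definition square_integrable (d : measure_display) (T : measurableType d)
    (mu : set T -> \bar R) (D : set T) (f : T -> R) : Prop :=
  measurable_fun D f /\ mu.-integrable D (fun x => (f x ^+ 2)%:E).

Definition sqdist (d : measure_display) (T : measurableType d)
    (mu : set T -> \bar R) (D : set T) (f g : T -> R) : \bar R :=
  (\int[mu]_(x in D) ((f x - g x) ^+ 2)%:E)%E.

End SquareIntegrable.

Notation leb R := (@lebesgue_measure R).
Notation leb2 R := (@lebesgue_measure R \x @lebesgue_measure R)%E.

Section Sobolev.
Context (R : realType).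

Definition rectangle (a b : R) : set (R * R) :=
  `]- a / 2, a / 2[%classic `*` `]- b / 2, b / 2[%classic.

Definition e1 : R * R := (1, 0).
Definition e2 : R * R := (0, 1).

Fixpoint Ck (k : nat) (f : R * R -> R) : Prop :=
  if k is k'.+1 then
    [/\ continuous f,
        forall x, derivable f x e1 /\ derivable f x e2,
        Ck k' (fun x => 'D_e1 f x) & Ck k' (fun x => 'D_e2 f x)]
  else continuous f.

Definition smooth (f : R * R -> R) : Prop := forall k, Ck k f.

Definition test_function (Omega : set (R * R)) (phi : R * R -> R) : Prop :=
  smooth phi /\
  exists K : set (R * R), [/\ compact K, K `<=` Omega &
    forall x, ~ K x -> phi x = 0].

Definition weak_deriv (Omega : set (R * R)) (v : R * R) (f g : R * R -> R) :
    Prop :=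
  forall phi, test_function Omega phi ->
    (\int[leb2 R]_(x in Omega) (f x * 'D_v phi x)%:E =
     - \int[leb2 R]_(x in Omega) (g x * phi x)%:E)%E.

(* [f] lies in H^1(Omega) and has weak gradient [(d1, d2)]. *)
Definition H1_with (Omega : set (R * R)) (f d1 d2 : R * R -> R) : Prop :=
  [/\ square_integrable (leb2 R) Omega f,
      square_integrable (leb2 R) Omega d1,
      square_integrable (leb2 R) Omega d2,
      weak_deriv Omega e1 f d1 &
      weak_deriv Omega e2 f d2].

Inductive side := Right | Left | Top | Bottom.

Definition side_dom (a b : R) (s : side) : set R :=
  match s with
  | Right | Left => `]- b / 2, b / 2[%classic
  | Top | Bottom => `]- a / 2, a / 2[%classic
  end.

(* Arclength parametrisation of the side [s] by [side_dom a b s]. *)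
Definition side_pt (a b : R) (s : side) (t : R) : R * R :=
  match s with
  | Right => (a / 2, t)
  | Left => (- a / 2, t)
  | Top => (t, b / 2)
  | Bottom => (t, - b / 2)
  end.

Definition normal (s : side) : R * R :=
  match s with
  | Right => (1, 0)
  | Left => (-1, 0)
  | Top => (0, 1)
  | Bottom => (0, -1)
  end.

(* An element of L^2 of the boundary is given by its four restrictions to the
   open sides.  The trace operator on H^1 is the continuous extension of the
   restriction map [F |-> F|_boundary] from functions smooth up to the
   boundary: [g] is the trace of [f], an H^1 function with weak gradient
   [(d1, d2)], when smooth functions converge to [f] in H^1 while their
   restrictions to the boundary converge to [g] in L^2 of the boundary. *)
Definition is_trace (a b : R) (f d1 d2 : R * R -> R) (g : side -> R -> R) :
    Prop :=
  (forall s, square_integrable (leb R) (side_dom a b s) (g s)) /\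
  exists F : nat -> R * R -> R,
    [/\ forall k, smooth (F k),
        sqdist (leb2 R) (rectangle a b) (F k) f
          @[k --> \oo] --> 0%E,
        sqdist (leb2 R) (rectangle a b) (fun x => 'D_e1 (F k) x) d1
          @[k --> \oo] --> 0%E,
        sqdist (leb2 R) (rectangle a b) (fun x => 'D_e2 (F k) x) d2
          @[k --> \oo] --> 0%E &
        forall s, sqdist (leb R) (side_dom a b s)
          (fun t => F k (side_pt a b s t)) (g s) @[k --> \oo] --> 0%E].

End Sobolev.

Section Dirac.
Context (R : realType).
Local Open Scope complex_scope.

Definition re (T : Type) (f : T -> R[i]) : T -> R := fun x => complex.Re (f x).
Definition im (T : Type) (f : T -> R[i]) : T -> R := fun x => complex.Im (f x).

Definition H1C_with (Omega : set (R * R)) (f d1 d2 : R * R -> R[i]) : Prop :=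
  H1_with Omega (re f) (re d1) (re d2) /\ H1_with Omega (im f) (im d1) (im d2).

Definition is_traceC (a b : R) (f d1 d2 : R * R -> R[i])
    (g : side -> R -> R[i]) : Prop :=
  is_trace a b (re f) (re d1) (re d2) (fun s => re (g s)) /\
  is_trace a b (im f) (im d1) (im d2) (fun s => im (g s)).

Record spinor := Spinor { spin1 : R * R -> R[i]; spin2 : R * R -> R[i] }.

Definition scale_spinor (z : R[i]) (u : spinor) : spinor :=
  Spinor (fun x => z * spin1 u x) (fun x => z * spin2 u x).

Definition spinor_ae_eq (Omega : set (R * R)) (u v : spinor) : Prop :=
  {ae leb2 R, forall x, Omega x -> spin1 u x = spin1 v x /\ spin2 u x = spin2 v x}.

Definition spinor0 : spinor := Spinor (fun=> 0) (fun=> 0).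

(* [u] is in H^1, with the partial derivatives [d1u] and [d2u]. *)
Definition spinor_H1_with (Omega : set (R * R)) (u d1u d2u : spinor) : Prop :=
  H1C_with Omega (spin1 u) (spin1 d1u) (spin1 d2u) /\
  H1C_with Omega (spin2 u) (spin2 d1u) (spin2 d2u).

Definition infinite_mass (a b : R) (u d1u d2u : spinor) : Prop :=
  exists g1 g2 : side -> R -> R[i],
    [/\ is_traceC a b (spin1 u) (spin1 d1u) (spin1 d2u) g1,
        is_traceC a b (spin2 u) (spin2 d1u) (spin2 d2u) g2 &
        forall s, {ae leb R, forall t, side_dom a b s t ->
          g2 s t = 'i * ((normal R s).1%:C + 'i * (normal R s).2%:C) * g1 s t}].

Definition dirac_expr (m : R) (u d1u d2u : spinor) : spinor :=
  Spinor
    (fun x => m%:C * spin1 u x - 'i * (spin2 d1u x - 'i * spin2 d2u x))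
    (fun x => - 'i * (spin1 d1u x + 'i * spin1 d2u x) - m%:C * spin2 u x).

(* Graph of the unbounded operator: [u] is in the domain and [H u = f].  The
   weak derivatives are unique almost everywhere, so [f] is too. *)
Definition dirac_graph (a b m : R) (u f : spinor) : Prop :=
  exists d1u d2u : spinor,
    [/\ spinor_H1_with (rectangle a b) u d1u d2u,
        infinite_mass a b u d1u d2u &
        spinor_ae_eq (rectangle a b) f (dirac_expr m u d1u d2u)].

(* The operator is symmetric, so only real eigenvalues are considered. *)
Definition dirac_eigenvalue (a b m lambda : R) : Prop :=
  exists u : spinor,
    ~ spinor_ae_eq (rectangle a b) u spinor0 /\
    dirac_graph a b m u (scale_spinor lambda%:C u).

Definition lowest_positive_eigenvalue (a b m lambda : R) : Prop :=
  [/\ 0 < lambda, dirac_eigenvalue a b m lambda &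
      forall mu, 0 < mu -> dirac_eigenvalue a b m mu -> lambda <= mu].

End Dirac.

Section Nu.
Context (R : realType).

(* For [0 < mu] the root exists and is unique.  [tan] takes the junk value 0 at
   [pi / 2], where the equation therefore fails, as it should. *)
Definition nu1 (mu : R) : R :=
  if mu == 0 then pi / 2
  else xget 0 [set nu | pi / 2 <= nu < pi /\ tan nu / nu = - mu^-1].

End Nu.

(* Main.v *)
(* An eigenvalue of the operator has to be found below both bounds.  Splitting
   into real and imaginary parts turns [H] into two copies of the real operator
   [K (p, q) = (p_x - q_y - m q, - q_x - p_y + m p)] with the boundary conditions
   [p = 0] on the top, [q = 0] on the bottom, [q = - p] on the right and [q = p]
   on the left, coupled by [K P = - lam Q], [K Q = lam P].  On smooth pairs,
   [|K v|^2 >= |grad v|^2 + m^2 |v|^2], so a minimising sequence of the Rayleigh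
   quotient [|K v|^2 / |v|^2] converges in [H^1] by Rellich compactness and the
   parallelogram law; its limit [P] solves [K^* K P = lam^2 P] weakly.

   Weak solutions are strong because the range of the massless [K] is dense.  A
   field [w] orthogonal to the range has two potentials [phi], [psi], and the
   jumps [phi - psi] and [phi + psi] are constant on the right and left sides.
   Testing with [(phi, - psi)], corrected near the vertical sides by the jumps
   times the weights [xi ^+ n], gives [2 |w|^2 <= |w|^2 + o(1)], so [w = 0].

   The bounds are the Rayleigh quotients of [sin (nu (a/2 - x) / a) cos (pi y / b)]
   times [(1, 1)] and [sin (nu (b/2 - y) / b) cos (pi x / a)] times [(1, 0)]:  the
   boundary terms of the integration by parts vanish exactly because
   [nu cos nu + mu sin nu = 0]. *)
From HB Require Import structures.
Require Import Defs.
From mathcomp Require Import all_boot all_order all_algebra.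
From mathcomp Require Import all_classical all_reals all_analysis.
From mathcomp Require Import measurable_realfun complex ring lra.
Set Implicit Arguments.
Unset Strict Implicit.
Unset Printing Implicit Defensive.
Import Order.TTheory GRing.Theory Num.Theory.
Import numFieldNormedType.Exports.
Local Open Scope classical_set_scope.
Local Open Scope ring_scope.

(** * Hilbert spaces *)

(** The real unknowns are [P1 + i Q1 = u1 + u2] and [- Q2 + i P2 = u1 - u2]. This turns the
    conditions on the horizontal sides into Dirichlet conditions, hence a Poincare inequality and
    explicit modes, and leaves a coupling of the two components on the vertical sides only.

    The obstacle is to place the minimiser in the domain, although different conditions meet at the
    corners. No regularity theory is used: since [K] controls the whole gradient, solvability of the
    massless equation follows from density of the range, and a weak solution differs from the strong
    one by a vector orthogonal to the range.

    In that density proof the jumps approach their constants only in L^2 of a side, whereas lifting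
    a side function to H^1 costs half a derivative. Hence the weights [xi ^+ n] and Hardy's
    inequality: the lift costs [n] times the side norm plus a gradient norm weighted near the side.
    The first vanishes along the approximation at fixed [n], the second as [n] grows. The constant
    jumps contribute squares of favourable sign. *)

Lemma subrBB (Z : zmodType) (x y z : Z) : x - y - (z - y) = x - z.
Proof. by rewrite opprB addrA subrK. Qed.

Lemma subrKC' (Z : zmodType) (x y z : Z) : x - y + (z - x) = z - y.
Proof. by rewrite addrC addrA subrK. Qed.

Lemma addr_subK (Z : zmodType) (x y z : Z) : x - y + (y - z) = x - z.
Proof. by rewrite addrA subrK. Qed.

Lemma cvg_uniq (R : realType) (u : nat -> R) (l k : R) :
  u @ \oo --> l -> u @ \oo --> k -> l = k.
Proof.
by move=> /(cvg_lim (@Rhausdorff R)) <- /(cvg_lim (@Rhausdorff R)) <-.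
Qed.

Lemma cvg_cst_eq (R : realType) (r l : R) : (fun _ : nat => r) @ \oo --> l -> l = r.
Proof.
by move/(cvg_lim (@Rhausdorff R)) => <-; rewrite lim_cst//; exact: Rhausdorff.
Qed.

Section Hilbert.
Context (R : realType).

(** The form is only positive semidefinite, because L^2 will consist of functions rather than of
    classes. Equality of vectors is therefore often replaced by [ip (u - v) (u - v) = 0]. *)
Record inner (V : lmodType R) (ip : V -> V -> R) : Prop := Inner {
  ip_sym : forall u v, ip u v = ip v u;
  ip_lin : forall k u v w, ip (k *: u + v) w = k * ip u w + ip v w;
  ip_ge0 : forall u, 0 <= ip u u }.

Definition cauchy_ip (V : lmodType R) (ip : V -> V -> R) (u : nat -> V) :=
  forall e, 0 < e -> exists N, forall i j, (N <= i)%N -> (N <= j)%N ->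
    ip (u i - u j) (u i - u j) <= e.

Definition cvg_ip (V : lmodType R) (ip : V -> V -> R) (u : nat -> V) (l : V) :=
  (fun n => ip (u n - l) (u n - l)) @ \oo --> (0 : R).

Definition complete_ip (V : lmodType R) (ip : V -> V -> R) :=
  forall u, cauchy_ip ip u -> exists l, cvg_ip ip u l.

Definition subspace (V : lmodType R) (U : V -> Prop) :=
  U 0 /\ forall k u v, U u -> U v -> U (k *: u + v).

Section InnerTheory.
Context (V : lmodType R) (ip : V -> V -> R) (I : inner ip).
Local Notation nsq u := (ip u u).

Lemma ipDl u v w : ip (u + v) w = ip u w + ip v w.
Proof. by rewrite -[u]scale1r ip_lin// mul1r scale1r. Qed.

Lemma ip0l w : ip 0 w = 0.
Proof. by have := ipDl 0 0 w; rewrite addr0; lra. Qed.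

Lemma ipZl k u w : ip (k *: u) w = k * ip u w.
Proof. by rewrite -[k *: u]addr0 ip_lin// ip0l addr0. Qed.

Lemma ipNl u w : ip (- u) w = - ip u w.
Proof. by rewrite -scaleN1r ipZl mulN1r. Qed.

Lemma ipBl u v w : ip (u - v) w = ip u w - ip v w.
Proof. by rewrite ipDl ipNl. Qed.

Lemma ipDr u v w : ip w (u + v) = ip w u + ip w v.
Proof. by rewrite !(ip_sym I w) ipDl. Qed.

Lemma ip0r w : ip w 0 = 0. Proof. by rewrite ip_sym// ip0l. Qed.

Lemma ipZr k u w : ip w (k *: u) = k * ip w u.
Proof. by rewrite !(ip_sym I w) ipZl. Qed.

Lemma ipNr u w : ip w (- u) = - ip w u.
Proof. by rewrite !(ip_sym I w) ipNl. Qed.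

Lemma ipBr u v w : ip w (u - v) = ip w u - ip w v.
Proof. by rewrite ipDr ipNr. Qed.

Lemma ip_sumr (J : eqType) (s : seq J) (F : J -> V) w :
  ip w (\sum_(i <- s) F i) = \sum_(i <- s) ip w (F i).
Proof. by elim/big_rec2: _ => [|i x y _ <-]; rewrite ?ip0r// ipDr. Qed.

Lemma nsqD u v : nsq (u + v) = nsq u + 2 * ip u v + nsq v.
Proof. by rewrite ipDl !ipDr (ip_sym I v u); ring. Qed.

Lemma nsqB u v : nsq (u - v) = nsq u - 2 * ip u v + nsq v.
Proof. by rewrite nsqD ipNr ipNl ipNr; ring. Qed.

Lemma nsqZ k u : nsq (k *: u) = k ^+ 2 * nsq u.
Proof. by rewrite ipZl ipZr; ring. Qed.

Lemma nsqN u : nsq (- u) = nsq u. Proof. by rewrite ipNl ipNr opprK. Qed.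

Lemma cauchy_schwarz u v : ip u v ^+ 2 <= nsq u * nsq v.
Proof.
have [v0|v0] := eqVneq (nsq v) 0.
  (* A null vector may be non-zero, so this case is genuine: an affine function of [t] bounded below
     has slope zero. *)
  have H t : 0 <= nsq u + 2 * t * ip u v.
    by have := ip_ge0 I (u + t *: v); rewrite nsqD ipZr nsqZ v0; lra.
  suff -> : ip u v = 0 by rewrite expr0n/= mulr_ge0// ip_ge0.
  apply/eqP/negPn/negP => uv0.
  have := H (- (nsq u + 1) / (2 * ip u v)).
  rewrite (_ : 2 * _ * ip u v = - (nsq u + 1)); last by field.
  by lra.
have vp : 0 < nsq v by rewrite lt_neqAle eq_sym v0 ip_ge0.
have := ip_ge0 I (nsq v *: u - ip u v *: v).
rewrite nsqB !nsqZ ipZl ipZr => H.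
have : 0 <= nsq v * (nsq v * nsq u - ip u v ^+ 2).
  by apply: le_trans H _; rewrite le_eqVlt; apply/orP; left; apply/eqP; ring.
by rewrite pmulr_rge0// subr_ge0 mulrC.
Qed.

Lemma nsqD_le u v : nsq (u + v) <= 2 * nsq u + 2 * nsq v.
Proof. by have := ip_ge0 I (u - v); rewrite nsqB nsqD; lra. Qed.

Lemma nsqB_le u v : nsq (u - v) <= 2 * nsq u + 2 * nsq v.
Proof. by have := nsqD_le u (- v); rewrite nsqN. Qed.

(** Young's inequality with a free weight, from the squares of [e *: u + v] and [e *: u - v]; it
    avoids square roots of norms. *)
Lemma ip_abs_le u v e : 0 < e -> `|2 * ip u v| <= e * nsq u + e^-1 * nsq v.
Proof.
move=> e0; have en0 : e != 0 by rewrite gt_eqF.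
have H1 := ip_ge0 I (e *: u + v); have H2 := ip_ge0 I (e *: u - v).
rewrite nsqD nsqZ ipZl in H1; rewrite nsqB nsqZ ipZl in H2.
have E : e * (e * nsq u + e^-1 * nsq v) = e ^+ 2 * nsq u + nsq v by field.
rewrite ler_norml; apply/andP; split; rewrite -(ler_pM2l e0) ?mulrN E; lra.
Qed.

Lemma cvg_ip_ip (u : nat -> V) l w : cvg_ip ip u l ->
  (fun n => ip (u n) w) @ \oo --> ip l w.
Proof.
move=> ul; apply/cvgrPdist_le => e e0.
have [k k0 kw] : exists2 k, 0 < k & k^-1 * nsq w <= e.
  exists ((nsq w + 1) / e); first by rewrite divr_gt0// ltr_wpDl// ip_ge0.
  rewrite invf_div mulrAC ler_pdivrMr ?ltr_wpDl ?ip_ge0//.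
  by rewrite ler_pM2l// lerDl.
have ke : 0 < e / k by rewrite divr_gt0.
move/cvgrPdist_le/(_ _ ke) : ul; apply: filterS => n.
rewrite sub0r normrN ger0_norm ?ip_ge0// => H.
have := ip_abs_le (u n - l) w k0.
rewrite ipBl normrM ger0_norm// distrC => H2.
have : k * nsq (u n - l) <= e by rewrite mulrC -ler_pdivlMr.
by lra.
Qed.

Lemma cvg_ip_nsq (u : nat -> V) l : cvg_ip ip u l ->
  (fun n => nsq (u n)) @ \oo --> nsq l.
Proof.
move=> ul.
have -> : (fun n => nsq (u n)) =
    (fun n => nsq (u n - l) + (2 * ip (u n) l - nsq l)).
  by apply/funext => n; rewrite nsqB; ring.
have : (fun n => nsq (u n - l) + (2 * ip (u n) l - nsq l)) @ \oo -->
   0 + (2 * ip l l - nsq l).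
  apply: cvgD => //; apply: cvgB; last exact: cvg_cst.
  by apply: cvgM; [exact: cvg_cst|exact: cvg_ip_ip].
by rewrite (_ : 0 + _ = nsq l)//; ring.
Qed.

Lemma cvg_ip_le0 (u : nat -> V) l (f : nat -> R) :
  (forall n, nsq (u n - l) <= f n) -> f @ \oo --> (0 : R) -> cvg_ip ip u l.
Proof.
move=> uf f0; apply: (@squeeze_cvgr _ _ _ _ (fun=> 0) f) => //.
  by apply: nearW => n; rewrite ip_ge0//= uf.
exact: cvg_cst.
Qed.

Lemma cvg_ipD (u v : nat -> V) l k : cvg_ip ip u l -> cvg_ip ip v k ->
  cvg_ip ip (fun n => u n + v n) (l + k).
Proof.
move=> ul vk.
apply: (@cvg_ip_le0 _ _
  (fun n => 2 * nsq (u n - l) + 2 * nsq (v n - k))).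
  by move=> n; rewrite opprD addrACA nsqD_le.
rewrite (_ : (0 : R) = 2 * 0 + 2 * 0); last by ring.
by apply: cvgD; apply: cvgM => //; exact: cvg_cst.
Qed.

Lemma cvg_ipZ (u : nat -> V) l c : cvg_ip ip u l ->
  cvg_ip ip (fun n => c *: u n) (c *: l).
Proof.
move=> ul.
apply: (@cvg_ip_le0 _ _ (fun n => c ^+ 2 * nsq (u n - l))).
  by move=> n; rewrite -scalerBr nsqZ.
by rewrite -[X in _ --> X](mulr0 (c ^+ 2)); apply: cvgM => //; exact: cvg_cst.
Qed.

Lemma cvg_ipB (u v : nat -> V) l k : cvg_ip ip u l -> cvg_ip ip v k ->
  cvg_ip ip (fun n => u n - v n) (l - k).
Proof.
move=> ul vk; rewrite -[- k]scaleN1r.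
under [X in cvg_ip _ X _]eq_fun do rewrite -[- v _]scaleN1r.
by apply: cvg_ipD => //; exact: cvg_ipZ.
Qed.

(** Limits are determined up to null vectors only, so a limit may be exchanged for any vector at
    distance zero. *)
Lemma cvg_ip_shift (u : nat -> V) l k : cvg_ip ip u l -> nsq (k - l) = 0 ->
  cvg_ip ip u k.
Proof.
move=> ul kl; apply: (@cvg_ip_le0 _ _ (fun n => 2 * nsq (u n - l))).
  move=> n; have -> : u n - k = (u n - l) - (k - l) by rewrite subrBB.
  by have := nsqB_le (u n - l) (k - l); rewrite kl mulr0 addr0.
by rewrite -[X in _ --> X](mulr0 2); apply: cvgM => //; exact: cvg_cst.
Qed.

Lemma cvg_ip_cauchy (u : nat -> V) l : cvg_ip ip u l -> cauchy_ip ip u.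
Proof.
move=> ul e e0; have e4 : 0 < e / 4 by rewrite divr_gt0.
have /cvgrPdist_le/(_ _ e4) [N _ H] := ul.
exists N => i j Ni Nj.
have := H i Ni; have := H j Nj; rewrite /= !sub0r !normrN !ger0_norm ?ip_ge0//.
have := nsqB_le (u i - l) (u j - l).
rewrite (subrBB (u i) l); lra.
Qed.

Lemma cvg_ip_unique (u : nat -> V) l k : cvg_ip ip u l -> cvg_ip ip u k ->
  nsq (l - k) = 0.
Proof.
move=> ul uk; have := cvg_ipB ul uk.
under [X in cvg_ip _ X _]eq_fun do rewrite subrr.
rewrite /cvg_ip; under eq_fun do rewrite sub0r nsqN.
by move/(cvg_lim (@Rhausdorff R)); rewrite lim_cst//; exact: Rhausdorff.
Qed.

Lemma nsq0_ip u v : nsq u = 0 -> ip u v = 0.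
Proof.
move=> u0; have := cauchy_schwarz u v; rewrite u0 mul0r => H.
by apply/eqP; rewrite -(@sqrf_eq0 R) eq_le H sqr_ge0.
Qed.

Lemma subspaceD (U : V -> Prop) u v : subspace U -> U u -> U v -> U (u + v).
Proof. by move=> [_ HU] Uu Uv; rewrite -[u]scale1r; exact: HU. Qed.

Lemma subspaceZ (U : V -> Prop) k u : subspace U -> U u -> U (k *: u).
Proof. by move=> [U0 HU] Uu; rewrite -[_ *: _]addr0; exact: HU. Qed.

(* A minimising sequence of the distance is Cauchy by the parallelogram law. *)
Lemma projection (U : V -> Prop) (f : V) : complete_ip ip -> subspace U ->
  exists u f0, [/\ forall n, U (u n), cvg_ip ip u f0 &
    forall v, U v -> ip (f - f0) v = 0].
Proof.
move=> cV HU; pose D := [set nsq (f - u) | u in U].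
have D0 : D !=set0 by exists (nsq (f - 0)); exists 0 => //; case: HU.
have lbD : lbound D 0 by move=> _ [u _ <-]; exact: ip_ge0.
have hD : has_inf D by split => //; exists 0.
pose d := inf D.
have dle v : U v -> d <= nsq (f - v).
  by move=> Uv; apply: ge_inf; [exists 0|exists v].
have /choice[u Hu] : forall n : nat, exists u,
    U u /\ nsq (f - u) <= d + n.+1%:R^-1.
  move=> n; have n0 : 0 < n.+1%:R^-1 :> R by rewrite invr_gt0.
  have [_ [v Uv <-] H] := inf_adherent n0 hD.
  by exists v; split => //; exact: ltW.
have par i j : nsq (u i - u j) <= 2 * (i.+1%:R^-1 + j.+1%:R^-1).
  have [Ui Hi] := Hu i; have [Uj Hj] := Hu j.
  have := dle (2^-1 *: (u i + u j)) (subspaceZ _ HU (subspaceD HU Ui Uj)).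
  have -> : f - 2^-1 *: (u i + u j) = 2^-1 *: ((f - u i) + (f - u j)).
    rewrite addrACA -opprD scalerBr -{2 3}[f]scale1r -scalerDl scalerA.
    by rewrite mulVf// scale1r.
  rewrite nsqZ nsqD.
  have -> : u i - u j = (f - u j) - (f - u i) by rewrite opprB subrKC'.
  rewrite (nsqB (f - u j)) (ip_sym I (f - u j) (f - u i)).
  by move: (i.+1%:R^-1) (j.+1%:R^-1) Hi Hj => x y; lra.
have cu : cauchy_ip ip u.
  move=> e e0.
  have e4 : 0 < e / 4 by rewrite divr_gt0.
  have /cvgrPdist_le/(_ _ e4)[N _ HN] := @cvg_harmonic R.
  exists N => i j Ni Nj.
  have := HN i Ni; have := HN j Nj; rewrite /= /harmonic !sub0r !normrN !ger0_norm ?invr_ge0//.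
  by have := par i j; move: (i.+1%:R^-1) (j.+1%:R^-1) => x y; lra.
have [f0 uf0] := cV _ cu; exists u, f0; split => //; first by move=> n; case: (Hu n).
move=> v Uv.
have fd : nsq (f - f0) <= d.
  have H1 : (fun n => nsq (f - u n)) @ \oo --> nsq (f - f0).
    apply: (cvg_ip_nsq (u := fun n => f - u n)).
    by apply: cvg_ipB => //; rewrite /cvg_ip; under eq_fun do rewrite subrr ip0l; exact: cvg_cst.
  have H2 : (fun n => d + n.+1%:R^-1) @ \oo --> d + 0.
    by apply: cvgD; [exact: cvg_cst|exact: cvg_harmonic].
  rewrite addr0 in H2.
  by apply: (ler_cvg_to H1 H2); apply: nearW => n; case: (Hu n).
have H t : 0 <= t ^+ 2 * nsq v - 2 * t * ip (f - f0) v.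
  have H1 : (fun n => nsq (f - (u n + t *: v))) @ \oo --> nsq (f - (f0 + t *: v)).
    apply: (cvg_ip_nsq (u := fun n => f - (u n + t *: v))).
    apply: cvg_ipB; first by rewrite /cvg_ip; under eq_fun do rewrite subrr ip0l; exact: cvg_cst.
    apply: cvg_ipD => //; by rewrite /cvg_ip; under eq_fun do rewrite subrr ip0l; exact: cvg_cst.
  have : d <= nsq (f - (f0 + t *: v)).
    apply: (ler_cvg_to (cvg_cst d) H1); apply: nearW => n; apply: dle.
    by apply: subspaceD => //; [case: (Hu n)|apply: subspaceZ].
  by rewrite opprD addrA nsqB nsqZ ipZr; lra.
set c := ip (f - f0) v in H *.
have := ip_ge0 I v; set s := nsq v in H * => s0.
apply/eqP/negPn/negP => c0.
have c2 : 0 < c ^+ 2 by rewrite exprn_even_gt0.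
have s1 : 0 < s + 1 by lra.
(* Close to the minimum [c / s] of the quadratic, with a denominator that stays positive when
   [s = 0]. *)
have := H (c / (s + 1)).
have -> : (c / (s + 1)) ^+ 2 * s - 2 * (c / (s + 1)) * c =
   - (c ^+ 2 * (s + 2) / (s + 1) ^+ 2) by field; rewrite gt_eqF.
rewrite oppr_ge0 leNgt => /negP; apply.
by rewrite divr_gt0 ?exprn_gt0// mulr_gt0//; lra.
Qed.

End InnerTheory.

Definition ip2 (V W : lmodType R) (ip : V -> V -> R) (ip' : W -> W -> R)
  (u v : V * W) := ip u.1 v.1 + ip' u.2 v.2.

Lemma inner_ip2 (V W : lmodType R) (ip : V -> V -> R) (ip' : W -> W -> R) :
  inner ip -> inner ip' -> inner (ip2 ip ip').
Proof.
move=> I J; split=> [u v|k u v w|u]; rewrite /ip2.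
- by rewrite (ip_sym I) (ip_sym J).
- by rewrite (ip_lin I) (ip_lin J); ring.
- by rewrite addr_ge0// ?(ip_ge0 I) ?(ip_ge0 J).
Qed.

Lemma cvg_ip2 (V W : lmodType R) (ip : V -> V -> R) (ip' : W -> W -> R) u l :
  inner ip -> inner ip' ->
  cvg_ip (ip2 ip ip') u l <->
  cvg_ip ip (fun n => (u n).1) l.1 /\ cvg_ip ip' (fun n => (u n).2) l.2.
Proof.
move=> I J; split=> [H|[H1 H2]].
  split; [apply: (cvg_ip_le0 I _ H)|apply: (cvg_ip_le0 J _ H)] => n /=;
  by rewrite /ip2/= ?lerDl ?lerDr ?(ip_ge0 I) ?(ip_ge0 J).
rewrite /cvg_ip/ip2/= -[X in _ --> X](addr0 0).
exact: cvgD.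
Qed.

Lemma complete_ip2 (V W : lmodType R) (ip : V -> V -> R) (ip' : W -> W -> R) :
  inner ip -> inner ip' -> complete_ip ip -> complete_ip ip' ->
  complete_ip (ip2 ip ip').
Proof.
move=> I J cI cJ u cu.
have [l1 H1] : exists l, cvg_ip ip (fun n => (u n).1) l.
  apply: cI => e /cu[N HN]; exists N => i j Ni Nj; apply: le_trans (HN _ _ Ni Nj).
  by rewrite /ip2 lerDl ip_ge0.
have [l2 H2] : exists l, cvg_ip ip' (fun n => (u n).2) l.
  apply: cJ => e /cu[N HN]; exists N => i j Ni Nj; apply: le_trans (HN _ _ Ni Nj).
  by rewrite /ip2 lerDr ip_ge0.
by exists (l1, l2); apply/cvg_ip2.
Qed.

End Hilbert.

(** * Completeness of L^2 *)

Section L2Type.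
Context d (T : measurableType d) (R : realType) (mu : {measure set T -> \bar R}).
Context (D : set T).

Definition sqint (f : T -> R) := [/\ measurable D, measurable_fun setT f &
  mu.-integrable D (EFin \o (fun x => f x ^+ 2))].

Lemma sqint_mul f g : sqint f -> sqint g ->
  mu.-integrable D (EFin \o (fun x => f x * g x)).
Proof.
move=> [mD mf If] [_ mg Ig].
apply: (le_integrable mD _ _ (integrableD mD If Ig)).
  apply/measurable_EFinP; apply: (measurable_funS measurableT) => //.
  exact: measurable_funM.
move=> x _ /=; rewrite lee_fin [leRHS]ger0_norm ?addr_ge0 ?sqr_ge0//.
rewrite ler_norml; have H1 := sqr_ge0 (f x + g x); have H2 := sqr_ge0 (f x - g x).
rewrite sqrrD in H1; rewrite sqrrB in H2.
have := sqr_ge0 (f x); have := sqr_ge0 (g x).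
by move=> ? ?; apply/andP; split; lra.
Qed.

End L2Type.

Section L2.
Context d (T : measurableType d) (R : realType) (mu : {measure set T -> \bar R}).
Context (D : set T) (mD : measurable D).
Local Notation sqint := (sqint mu D).

(* The proof of measurability is a parameter, so that it can be read off the type [L2]. *)
Definition sqintp : {pred T -> R} := let _ := mD in [pred f | `[< sqint f >]].

Lemma sqintpP f : (f \in sqintp) = `[< sqint f >].
Proof. by []. Qed.

Lemma sqint_submod : submod_closed sqintp.
Proof.
split.
  rewrite sqintpP; apply/asboolP; split=> //; first exact: measurable_cst.
  rewrite (_ : EFin \o _ = cst 0%E) ?integrable0//.
  by apply/funext => x /=; rewrite expr0n.
move=> k f g; rewrite !sqintpP => /asboolP sf /asboolP sg; apply/asboolP.
have [_ mf If] := sf; have [_ mg Ig] := sg; split=> //.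
  by apply: measurable_funD => //; apply: measurable_funM => //; exact: measurable_cst.
rewrite (_ : _ \o _ = ((fun x => (k ^+ 2)%R%:E * (f x ^+ 2)%R%:E) \+
    ((fun x => (2 * k)%R%:E * (f x * g x)%R%:E) \+ (fun x => (g x ^+ 2)%R%:E)))%E).
  apply: integrableD => //; first exact: integrableZl.
  by apply: integrableD => //; apply: integrableZl => //; exact: sqint_mul.
apply/funext => x /=; rewrite -!EFinM -!EFinD; congr EFin.
have E (a b : R) : (k * a + b) ^+ 2 = k ^+ 2 * a ^+ 2 + (2 * k * (a * b) + b ^+ 2).
  by ring.
exact: E.
Qed.

HB.instance Definition _ := GRing.isSubmodClosed.Build _ _ sqintp sqint_submod.

Record L2 := MkL2 { l2fun :> T -> R; _ : l2fun \in sqintp }.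
HB.instance Definition _ := [isSub for l2fun].
HB.instance Definition _ := [Choice of L2 by <:].
HB.instance Definition _ := [SubChoice_isSubLmodule of L2 by <:].

Lemma L2P (f : L2) : sqint f.
Proof. by case: f => f /=; rewrite sqintpP => /asboolP. Qed.

Definition toL2 f (sf : sqint f) : L2 := MkL2 (etrans (sqintpP f) (asboolT sf)).

Definition ip (f g : L2) : R := \int[mu]_(x in D) (f x * g x).

Lemma integrable_ip (f g : L2) : mu.-integrable D (EFin \o (fun x => f x * g x)).
Proof. by apply: sqint_mul; exact: L2P. Qed.

Lemma integrable_nsq (f : L2) : mu.-integrable D (EFin \o (fun x => f x ^+ 2)).
Proof. by case: (L2P f). Qed.

Lemma ip_inner : inner ip.
Proof.
split=> [f g|k f g h|f].
- by apply: eq_Rintegral => x _; rewrite mulrC.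
- have E (a b c : R) : (k * a + b) * c = k * (a * c) + b * c by ring.
  transitivity (\int[mu]_(x in D) (k * (f x * h x) + g x * h x)).
    by apply: eq_Rintegral => x _; exact: E.
  rewrite RintegralD ?RintegralZl//; try exact: integrable_ip.
  by apply: (integrableZl mD k (f := fun x => (f x * h x)%:E)); exact: integrable_ip.
- by apply: Rintegral_ge0 => x _; rewrite -expr2 sqr_ge0.
Qed.

Lemma nsqE (f : L2) : (ip f f)%:E = (\int[mu]_(x in D) (f x ^+ 2)%:E)%E.
Proof.
rewrite /ip /Rintegral fineK; first by apply: eq_integral => x _; rewrite expr2.
by apply: integrable_fin_num => //; exact: integrable_ip.
Qed.

Lemma sqdistE (f g : L2) : sqdist mu D f g = (ip (f - g) (f - g))%:E.
Proof. by rewrite nsqE. Qed.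

Lemma nsq0_ae (f : L2) : ip f f = 0 -> {ae mu, forall x, D x -> f x = 0}.
Proof.
move=> f0; have := nsqE f; rewrite f0 => /esym H.
have : (\int[mu]_(x in D) `|(f x ^+ 2)%:E| = 0)%E.
  by apply: etrans H; apply: eq_integral => x _; rewrite gee0_abs ?lee_fin ?sqr_ge0.
move/(ae_eq_integral_abs mu mD) => [|N [mN N0 H2]].
  by apply: (measurable_int mu); exact: integrable_nsq.
exists N; split=> // x H3; apply: H2 => /= H4; apply: H3 => Dx.
by have /eqP := H4 Dx; rewrite eqe sqrf_eq0 => /eqP.
Qed.

Lemma cvg_sqdist (f : nat -> L2) (g : L2) : cvg_ip ip f g ->
  sqdist mu D (f k) g @[k --> \oo] --> 0%E.
Proof.
move=> fg; under eq_fun do rewrite sqdistE.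
by apply: cvg_EFin; first exact: nearW.
Qed.

(** Squared increments weighted by [2 ^+ k] still have summable integrals, so their sum is finite
    almost everywhere. Absolute convergence follows from [|t| <= 2 ^- k + 2 ^+ k * t ^+ 2]. *)
Lemma ae_cvg_rapid (u : nat -> L2) :
  (forall k, ip (u k.+1 - u k) (u k.+1 - u k) <= 4^-1 ^+ k) ->
  {ae mu, forall x, D x -> cvgn (fun n => u n x)}.
Proof.
move=> ule; pose g k x := ((2 ^+ k * (u k.+1 x - u k x) ^+ 2)%:E : \bar R).
have g0 k x : (0 <= g k x)%E by rewrite lee_fin; apply: mulr_ge0; [exact: exprn_ge0|exact: sqr_ge0].
have mg k : measurable_fun setT (g k).
  apply/measurable_EFinP; apply: measurable_funM => //.
  apply: measurable_funX; apply: measurable_funB.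
    by case: (L2P (u k.+1)).
  by case: (L2P (u k)).
have mgD k : measurable_fun D (g k) by exact: measurable_funS (mg k).
pose S x := (\sum_(k <oo) g k x)%E.
have mS : measurable_fun D S.
  by apply: ge0_emeasurable_sum => // k x _ _.
have iS : mu.-integrable D S.
  apply/integrableP; split=> //.
  under eq_integral => x _ do rewrite gee0_abs ?nneseries_ge0//.
  rewrite integral_nneseries//.
  have gle k : (\int[mu]_(x in D) g k x <= (2^-1 ^+ k)%:E)%E.
    under eq_integral => x _ do rewrite /g EFinM.
    rewrite integralZl//; last exact: (integrable_nsq (u k.+1 - u k)).
    rewrite -(nsqE (u k.+1 - u k)) -EFinM lee_fin.
    apply: (@le_trans _ _ (2 ^+ k * 4^-1 ^+ k)).
      by rewrite ler_pM2l ?exprn_gt0.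
    by rewrite -exprMn le_eqVlt; apply/orP; left; apply/eqP; congr (_ ^+ _); field.
  apply: (@le_lt_trans _ _ (\sum_(k <oo) (2^-1 ^+ k)%:E)%E).
    by apply: lee_nneseries => // k _ _; apply: integral_ge0.
  have : (fun n => \sum_(0 <= k < n) (2^-1 ^+ k)%:E)%E @ \oo --> (1 * (1 - 2^-1)^-1 : R)%:E.
    under eq_fun do rewrite sumEFin.
    apply: cvg_EFin; first exact: nearW.
    have -> : fine \o (fun n => (\sum_(0 <= k < n) 2^-1 ^+ k)%:E) =
        series (geometric (1 : R) 2^-1).
      by apply/funext => n; rewrite /series/= /geometric/=; under [RHS]eq_bigr do rewrite mul1r.
    by apply: cvg_geometric_series; rewrite ger0_norm// invf_lt1// ltr1n.
  by move/cvg_lim => ->//; exact: ltry.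
have := integrable_ae mD iS; apply: filterS => x H Dx; have {H}Sx := H Dx.
have cg : cvgn (series (fun k => fine (g k x))).
  have := @summable_cvg R xpredT (fun k => g k x) (fun k _ => g0 k x).
  apply; rewrite /summable -(nneseries_esum (P := xpredT))//.
  under eq_eseriesr do rewrite gee0_abs//.
  by rewrite -ge0_fin_numE// nneseries_ge0.
have cd : cvgn (series (fun k => `|u k.+1 x - u k x|)).
  apply: (@series_le_cvg _ _ (fun k => (geometric (1:R) 2^-1) k + fine (g k x))) => //.
  - move=> k; rewrite addr_ge0//; last exact: fine_ge0.
    by rewrite /geometric/= mul1r exprn_ge0.
  - move=> k; rewrite /geometric/= mul1r.
    set t := _ - _; rewrite exprVn; set c := 2 ^+ k.
    have c0 : 0 < c by rewrite exprn_gt0.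
    have cn : c != 0 by rewrite gt_eqF.
    rewrite -(ler_pM2l c0) mulrDr mulfV//.
    have := sqr_ge0 (c * `|t| - 2^-1).
    rewrite sqrrB -(real_normK (num_real t)); move: `|t| => r; rewrite exprMn => H.
    have -> : c * (c * r ^+ 2) = c ^+ 2 * r ^+ 2 by ring.
    have : (2^-1 : R) ^+ 2 <= 1 by rewrite expr2; lra.
    have -> : c * r = c * r * 2^-1 *+ 2 by field.
    lra.
  have -> : series (fun k => geometric (1:R) 2^-1 k + fine (g k x)) =
     (series (geometric (1:R) 2^-1) \+ series (fun k => fine (g k x))).
    by apply/funext => n; rewrite /series/= big_split.
  apply: is_cvgD => //; apply: is_cvg_geometric_series.
  by rewrite ger0_norm// invf_lt1// ltr1n.
have := @normed_cvg R R^o (fun k => u k.+1 x - u k x) cd.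
move=> /cvg_ex[l Hl]; apply/cvg_ex; exists (u 0%N x + l).
have -> : (fun n => u n x) = (fun n => u 0%N x + series (fun k => u k.+1 x - u k x) n).
  apply/funext => n; rewrite /series/= telescope_sumr//.
  by rewrite addrC subrK.
by apply: cvgD => //; exact: cvg_cst.
Qed.

(** Riesz-Fischer: a rapidly converging subsequence has a pointwise limit almost everywhere, and
    Fatou's lemma carries the Cauchy estimate over to that limit. *)
Lemma ip_complete : complete_ip ip.
Proof.
move=> f cf.
have /choice[N HN] : forall k : nat, exists N, forall i j, (N <= i)%N -> (N <= j)%N ->
    ip (f i - f j) (f i - f j) <= 4^-1 ^+ k.
  by move=> k; apply: cf; rewrite exprn_gt0.
(* Summing the thresholds makes [phi m] exceed [N k] for every [k <= m]; the successors give
   [k <= phi k]. *)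
pose phi k := (\sum_(i < k.+1) (N i).+1)%N.
have Nphi k m : (k <= m)%N -> (N k <= phi m)%N.
  move=> km; rewrite /phi (bigD1 (Ordinal (km : (k < m.+1)%N)))//=.
  by rewrite addSn ltnW// ltnS leq_addr.
have phige k : (k <= phi k)%N.
  rewrite /phi (leq_trans (leqnSn k))// -[X in (X <= _)%N](card_ord k.+1) -sum1_card.
  exact: leq_sum.
pose u k := f (phi k).
have uc := @ae_cvg_rapid u (fun k => HN k _ _ (Nphi k k.+1 (leqnSn k)) (Nphi k k (leqnn k))).
(* The upper limit is measurable everywhere, including points of divergence; where it is infinite,
   [fine] returns 0. *)
pose l x := fine (limn_esup (fun n => (u n x)%:E)).
have ml : measurable_fun setT l.
  apply: (measurableT_comp (fine_measurable measurableT)) => //.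
  by apply: measurable_fun_limn_esup => n; apply/measurable_EFinP; case: (L2P (u n)).
have ul x : cvgn (fun n => u n x) -> (fun n => u n x) @ \oo --> l x.
  move=> /cvg_ex[r Hr].
  suff -> : l x = r by [].
  have H : (fun n => (u n x)%:E) @ \oo --> r%:E by apply: cvg_EFin; first exact: nearW.
  rewrite /l is_cvg_limn_esupE; last by apply/cvg_ex; exists r%:E.
  by rewrite (cvg_lim _ H)//.
have mfi i : measurable_fun setT (f i) by case: (L2P (f i)).
have key e : 0 < e -> exists M, forall i, (M <= i)%N ->
    (\int[mu]_(x in D) ((f i x - l x) ^+ 2)%:E <= e%:E)%E.
  move=> e0; have [M HM] := cf e e0; exists M => i Mi.
  pose h n x := ((f i x - u n x) ^+ 2)%:E : \bar R.
  have mh n : measurable_fun D (h n).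
    apply: (measurable_funS measurableT) => //.
    apply/measurable_EFinP; apply: measurable_funX; apply: measurable_funB => //.
    exact: mfi.
  have h0 n x : D x -> (0 <= h n x)%E by move=> _; rewrite lee_fin sqr_ge0.
  have := fatou mu mD mh h0.
  have -> : (\int[mu]_(x in D) limn_einf (h^~ x) =
     \int[mu]_(x in D) ((f i x - l x) ^+ 2)%:E)%E.
    apply: ae_eq_integral => //.
    - rewrite (_ : (fun _ => _) = (fun x => - limn_esup (fun n => - h n x))%E).
        apply: measurableT_comp => //.
        by apply: measurable_fun_limn_esup => n; exact: measurableT_comp.
      apply/funext => x; rewrite -limn_einfN; congr limn_einf.
      by apply/funext => n; exact/esym/oppeK.
    - apply: (measurable_funS measurableT) => //.
      by apply/measurable_EFinP; apply: measurable_funX; apply: measurable_funB.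
    - apply: filterS uc => x H Dx.
      have H2 : h^~ x @ \oo --> ((f i x - l x) ^+ 2)%:E.
        apply: cvg_EFin; first exact: nearW.
        have H3 : (fun n => f i x - u n x) @ \oo --> f i x - l x.
          by apply: cvgB; [exact: cvg_cst|exact: ul (H Dx)].
        rewrite expr2; under [X in X @ _ --> _]eq_fun do rewrite /= expr2.
        exact: cvgM.
      by rewrite is_cvg_limn_einfE; [exact: cvg_lim|apply/cvg_ex; eexists; exact: H2].
  move/le_trans; apply; rewrite limn_einf_lim.
  apply: lime_le; first exact: is_cvg_einfs.
  apply: nearW => n.
  (* The index [maxn n M] is admissible in the infimum over the tail from [n] and lies in the range
     of the Cauchy estimate. *)
  apply: (@le_trans _ _ (\int[mu]_(x in D) h (maxn n M) x)%E).
    by apply: ereal_inf_lbound; exists (maxn n M) => //=; rewrite leq_maxl.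
  rewrite /h -(nsqE (f i - u (maxn n M))) lee_fin; apply: HM => //.
  by rewrite (leq_trans _ (phige _))// leq_maxr.
have sl : sqint l.
  have [M HM] := key 1 ltr01.
  have sd : sqint (fun x => f M x - l x).
    split=> //; first exact: measurable_funB.
    apply/integrableP; split.
      apply: (measurable_funS measurableT) => //.
      by apply/measurable_EFinP; apply: measurable_funX; apply: measurable_funB.
    under eq_integral => x _ do rewrite /= ger0_norm ?sqr_ge0//.
    by rewrite (le_lt_trans (HM M (leqnn M)))// ltry.
  have := L2P (f M - toL2 sd); congr sqint.
  by apply/funext => x /=; rewrite opprB addrC subrK.
exists (toL2 sl); apply/cvgrPdist_le => e /key[M HM].
exists M => // i Mi /=; rewrite sub0r normrN ger0_norm ?(ip_ge0 ip_inner)//.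
by rewrite -lee_fin nsqE; exact: HM.
Qed.

End L2.

(** * Symbolic smooth functions *)

Section Expr.
Context (R : realType).

(* With expressions instead of functions, smoothness, measurability and
   integrability hold once and for all, and [dx], [dy] are computed. *)
Inductive tf : Type :=
  | Cst of R | VX | VY | SinT of tf | CosT of tf | AddT of tf & tf | MulT of tf & tf.

Fixpoint ev (e : tf) (z : R * R) : R :=
  match e with
  | Cst r => r
  | VX => z.1
  | VY => z.2
  | SinT e => sin (ev e z)
  | CosT e => cos (ev e z)
  | AddT e f => ev e z + ev f z
  | MulT e f => ev e z * ev f z
  end.

Definition OppT e := MulT (Cst (-1)) e.
Definition SubT e f := AddT e (OppT f).

Fixpoint dx (e : tf) : tf :=
  match e with
  | Cst _ => Cst 0
  | VX => Cst 1
  | VY => Cst 0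
  | SinT e => MulT (CosT e) (dx e)
  | CosT e => OppT (MulT (SinT e) (dx e))
  | AddT e f => AddT (dx e) (dx f)
  | MulT e f => AddT (MulT (dx e) f) (MulT e (dx f))
  end.

Fixpoint dy (e : tf) : tf :=
  match e with
  | Cst _ => Cst 0
  | VX => Cst 0
  | VY => Cst 1
  | SinT e => MulT (CosT e) (dy e)
  | CosT e => OppT (MulT (SinT e) (dy e))
  | AddT e f => AddT (dy e) (dy f)
  | MulT e f => AddT (MulT (dy e) f) (MulT e (dy f))
  end.

Lemma ev_opp e z : ev (OppT e) z = - ev e z. Proof. by rewrite /= mulN1r. Qed.

Lemma ev_sub e f z : ev (SubT e f) z = ev e z - ev f z.
Proof. by rewrite /= mulN1r. Qed.

Lemma ev_dxdy e z : ev (dx (dy e)) z = ev (dy (dx e)) z.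
Proof. by elim: e => //= [e ->|e ->|e -> f ->|e -> f ->] //; ring. Qed.

Lemma is_derive_dx (e : tf) (x y : R) : is_derive (x : R) (1 : R) (fun t : R => ev e (t, y)) (ev (dx e) (x, y)).
Proof.
elim: e => /= [r|||e IH|e IH|e IHe f IHf|e IHe f IHf].
- exact: is_derive_cst.
- exact: is_derive_id.
- exact: is_derive_cst.
- by apply: (@is_derive1_comp _ sin); exact: is_derive_sin.
- rewrite mulN1r -mulNr.
  by apply: (@is_derive1_comp _ cos); exact: is_derive_cos.
- exact: is_deriveD.
- apply: is_derive_eq; rewrite /GRing.scale/=; ring.
Qed.

Lemma is_derive_dy (e : tf) (x y : R) : is_derive (y : R) (1 : R) (fun t : R => ev e (x, t)) (ev (dy e) (x, y)).
Proof.
elim: e => /= [r|||e IH|e IH|e IHe f IHf|e IHe f IHf].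
- exact: is_derive_cst.
- exact: is_derive_cst.
- exact: is_derive_id.
- by apply: (@is_derive1_comp _ sin); exact: is_derive_sin.
- rewrite mulN1r -mulNr.
  by apply: (@is_derive1_comp _ cos); exact: is_derive_cos.
- exact: is_deriveD.
- apply: is_derive_eq; rewrite /GRing.scale/=; ring.
Qed.

(** The difference quotient along [e1] sees only the row through the point, so a partial derivative
    is a derivative in one variable. *)
Lemma is_derive_e1 (f : R * R -> R) (x y df : R) :
  is_derive (x : R) (1 : R) (fun t : R => f (t, y)) df -> is_derive (x, y) (e1 R) f df.
Proof.
move=> H; have E : (fun h : R => h^-1 *: (f (h *: e1 R + (x, y)) - f (x, y))) =
   (fun h : R => h^-1 *: ((fun t => f (t, y)) (h *: (1 : R) + x) - f (x, y))).
  apply/funext => h; congr (_ *: (f _ - _)).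
  by rewrite /e1; congr (_, _); rewrite /= ?scaler0 ?add0r.
split.
- by have := @ex_derive _ _ _ _ _ _ _ H; rewrite /derivable E.
- by have := @derive_val _ _ _ _ _ _ _ H; rewrite /derive E.
Qed.

Lemma is_derive_e2 (f : R * R -> R) (x y df : R) :
  is_derive (y : R) (1 : R) (fun t : R => f (x, t)) df -> is_derive (x, y) (e2 R) f df.
Proof.
move=> H; have E : (fun h : R => h^-1 *: (f (h *: e2 R + (x, y)) - f (x, y))) =
   (fun h : R => h^-1 *: ((fun t => f (x, t)) (h *: (1 : R) + y) - f (x, y))).
  apply/funext => h; congr (_ *: (f _ - _)).
  by rewrite /e2; congr (_, _); rewrite /= ?scaler0 ?add0r.
split.
- by have := @ex_derive _ _ _ _ _ _ _ H; rewrite /derivable E.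
- by have := @derive_val _ _ _ _ _ _ _ H; rewrite /derive E.
Qed.

Lemma derive_ev1 e : (fun z => 'D_(e1 R) (ev e) z) = ev (dx e).
Proof.
by apply/funext => -[x y]; have [] := is_derive_e1 (is_derive_dx e x y).
Qed.

Lemma derive_ev2 e : (fun z => 'D_(e2 R) (ev e) z) = ev (dy e).
Proof.
by apply/funext => -[x y]; have [] := is_derive_e2 (is_derive_dy e x y).
Qed.

Lemma continuous_ev e : continuous (ev e).
Proof.
elim: e => [r|||e IH|e IH|e IHe f IHf|e IHe f IHf] z.
- exact: cvg_cst.
- exact: cvg_fst.
- exact: cvg_snd.
- by apply: continuous_comp; [exact: IH|exact: continuous_sin].
- by apply: continuous_comp; [exact: IH|exact: continuous_cos].
- by apply: cvgD; [exact: IHe|exact: IHf].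
- by apply: cvgM; [exact: IHe|exact: IHf].
Qed.

Lemma smooth_ev e : smooth (ev e).
Proof.
move=> k; elim: k e => [|k IH] e /=; first exact: continuous_ev.
split; first exact: continuous_ev.
- by move=> [x y]; split; [have [] := is_derive_e1 (is_derive_dx e x y)
   |have [] := is_derive_e2 (is_derive_dy e x y)].
- by rewrite derive_ev1.
- by rewrite derive_ev2.
Qed.

Lemma measurable_ev e : measurable_fun setT (ev e).
Proof.
elim: e => [r|||e IH|e IH|e IHe f IHf|e IHe f IHf].
- exact: measurable_cst.
- exact: measurable_fst.
- exact: measurable_snd.
- apply: (measurableT_comp (f := sin)) => //; apply: continuous_measurable_fun.
  exact: continuous_sin.
- apply: (measurableT_comp (f := cos)) => //; apply: continuous_measurable_fun.
  exact: continuous_cos.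
- exact: measurable_funD.
- exact: measurable_funM.
Qed.

Lemma bounded_ev e r : exists2 M, 0 <= M &
  forall x y, `|x| <= r -> `|y| <= r -> `|ev e (x, y)| <= M.
Proof.
elim: e => [c|||e IH|e IH|e [M M0 IHe] f [N N0 IHf]|e [M M0 IHe] f [N N0 IHf]].
- by exists `|c|.
- exists `|r| => // x y xr _ /=; exact: le_trans xr (ler_norm r).
- exists `|r| => // x y _ yr /=; exact: le_trans yr (ler_norm r).
- by exists 1 => // x y _ _ /=; rewrite ler_norml sin_le1 sin_geN1.
- by exists 1 => // x y _ _ /=; rewrite ler_norml cos_le1 cos_geN1.
- exists (M + N); first exact: addr_ge0.
  move=> x y xr yr /=; apply: le_trans (ler_normD _ _) _.
  by apply: lerD; [exact: IHe|exact: IHf].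
- exists (M * N); first exact: mulr_ge0.
  move=> x y xr yr /=; rewrite normrM.
  by apply: ler_pM => //; [exact: IHe|exact: IHf].
Qed.

End Expr.

Arguments VX {R}.
Arguments VY {R}.

(** * Integration over intervals and rectangles, and the divergence theorem *)

Section Interval.
Context (R : realType) (c : R).
Local Notation I := (`]- c / 2, c / 2[%classic : set R).
Local Notation leb := (@lebesgue_measure R).

Lemma lebesgue_sym_itv : 0 <= c -> leb I = c%:E.
Proof.
move=> c0; rewrite lebesgue_measure_itv/= lte_fin.
case: ifPn => [_|]; first by rewrite -EFinB; congr EFin; field.
rewrite -leNgt => H; congr EFin; lra.
Qed.

Lemma sym_itv_bound t : I t -> `|t| <= `|c|.
Proof.
rewrite /= in_itv/= => /andP[H1 H2].
have := ler_norm c; have := ler_norm (- c); rewrite normrN => *.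
by rewrite ler_norml; apply/andP; split; lra.
Qed.

Lemma integrable_bounded (f : R -> R) M : 0 <= c -> measurable_fun setT f ->
  (forall t, I t -> `|f t| <= M) -> leb.-integrable I (EFin \o f).
Proof.
move=> c0 mf fM; have mI : measurable I by exact: measurable_itv.
apply: (@le_integrable _ _ _ leb I mI _ (cst M%:E)).
- by apply/measurable_EFinP; exact: measurable_funS mf.
- by move=> x Ix; rewrite /= lee_fin (le_trans (fM x Ix))// ler_norm.
- apply/integrableP; split; first exact: measurable_cst.
  rewrite (_ : (fun x => _) = cst `|M|%:E)// integral_cst//.
  rewrite [X in (_ * X)%E](lebesgue_sym_itv c0).
  by rewrite -EFinM ltry.
Qed.

Lemma FTC_sym (f F : R -> R) : 0 < c -> continuous f ->
  (forall x : R, is_derive x (1 : R) F (f x)) ->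
  \int[leb]_(t in I) f t = F (c / 2) - F (- c / 2).
Proof.
move=> c0 cf dF; have cc : - c / 2 < c / 2 by lra.
have cF : continuous F.
  move=> x; apply: differentiable_continuous; apply/derivable1_diffP.
  by have [] := dF x.
have if_ : leb.-integrable `[- c / 2, c / 2] (EFin \o f).
  apply: continuous_compact_integrable; first exact: segment_compact.
  by apply: continuous_subspaceT.
have H1 : derivable_oo_LRcontinuous F (- c / 2) (c / 2).
  split; first by move=> x _; have [] := dF x.
    by apply: cvg_at_right_filter; exact: cF.
  by apply: cvg_at_left_filter; exact: cF.
have H2 : {in `]- c / 2, c / 2[, derive1 F =1 f}.
  by move=> x _; rewrite derive1E; have [] := dF x.
have E : \int[leb]_(t in I) f t = \int[leb]_(t in `[- c / 2, c / 2]) f t.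
  rewrite Rintegral_itv_bndo_bndc; last first.
    by apply: integrableS if_ => //; exact: subset_itv_oo_cc.
  rewrite Rintegral_itv_obnd_cbnd//.
  by apply: integrableS if_ => //; exact: subset_itv_oc_cc.
have cfs : {within `[- c / 2, c / 2], continuous f} by exact: continuous_subspaceT.
by rewrite E /Rintegral (continuous_FTC2 cc cfs H1 H2).
Qed.

End Interval.

Section Rectangle.
Context (R : realType) (a b : R) (ha : 0 < a) (hb : 0 < b).
Local Notation leb := (@lebesgue_measure R).
Local Notation Ia := (`]- a / 2, a / 2[%classic : set R).
Local Notation Ib := (`]- b / 2, b / 2[%classic : set R).
Local Notation Om := (rectangle a b).
Local Notation lb2 := (leb \x leb)%E.

Local Notation R1 := (measurableTypeR R).

Lemma measurable_rect : measurable (Om : set (R1 * R1)).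
Proof. by apply: measurableX; exact: measurable_itv. Qed.

Lemma lebesgue_rect : lb2 Om = (a * b)%:E.
Proof.
rewrite product_measure1E; try exact: measurable_itv.
by rewrite EFinM -(lebesgue_sym_itv (ltW ha)) -(lebesgue_sym_itv (ltW hb)).
Qed.

Lemma rect_bound x y : Om (x, y) -> `|x| <= a + b /\ `|y| <= a + b.
Proof.
move=> [/= /sym_itv_bound + /sym_itv_bound].
by rewrite (gtr0_norm ha) (gtr0_norm hb) /= => H1 H2; move: ha hb => h1 h2; split; lra.
Qed.

Let mIa : measurable (Ia : set R1). Proof. exact: measurable_itv. Qed.
Let mIb : measurable (Ib : set R1). Proof. exact: measurable_itv. Qed.

Section Fubini.
Variable f : R * R -> R.
Hypothesis If : lb2.-integrable Om (EFin \o f).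

Let g := (EFin \o f) \_ Om.

Let Ig : lb2.-integrable setT g.
Proof. exact: (integrable_mkcond _ measurable_rect).1. Qed.

Let gE1 x : (\int[leb]_y g (x, y))%E =
  ((fun x => \int[leb]_(y in Ib) (f (x, y))%:E) \_ Ia)%E x.
Proof.
rewrite patchE; case: ifPn => xI.
  rewrite [RHS]integral_mkcond; apply: eq_integral => y _.
  rewrite /g !patchE; congr (if _ then _ else _).
  by rewrite /rectangle in_setX/= xI.
rewrite (_ : (fun y => _) = cst 0%E) ?integral0//.
by apply/funext => y; rewrite /g patchE /rectangle in_setX/= (negbTE xI).
Qed.

Let gE2 y : (\int[leb]_x g (x, y))%E =
  ((fun y => \int[leb]_(x in Ia) (f (x, y))%:E) \_ Ib)%E y.
Proof.
rewrite patchE; case: ifPn => yI.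
  rewrite [RHS]integral_mkcond; apply: eq_integral => x _.
  rewrite /g !patchE; congr (if _ then _ else _).
  by rewrite /rectangle in_setX/= yI andbT.
rewrite (_ : (fun x => _) = cst 0%E) ?integral0//.
by apply/funext => x; rewrite /g patchE /rectangle in_setX/= (negbTE yI) andbF.
Qed.

Lemma fubini_rect1 : (\int[lb2]_(z in Om) (f z)%:E =
  \int[leb]_(x in Ia) \int[leb]_(y in Ib) (f (x, y))%:E)%E.
Proof.
rewrite [LHS]integral_mkcond -/g -(integral12_prod_meas1 Ig).
by rewrite [RHS]integral_mkcond; apply: eq_integral => x _; exact: gE1.
Qed.

Lemma fubini_rect2 : (\int[lb2]_(z in Om) (f z)%:E =
  \int[leb]_(y in Ib) \int[leb]_(x in Ia) (f (x, y))%:E)%E.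
Proof.
rewrite [LHS]integral_mkcond -/g -(integral21_prod_meas1 Ig).
by rewrite [RHS]integral_mkcond; apply: eq_integral => y _; exact: gE2.
Qed.

Lemma ae_integrable_rect1 :
  {ae leb, forall x, Ia x -> leb.-integrable Ib (fun y => (f (x, y))%:E)}.
Proof.
have := ae_integrable1 Ig; apply: filterS => x H /mem_set xI.
apply: (integrable_mkcond _ mIb).2.
apply: eq_integrable H => // y _; rewrite /g !patchE.
by rewrite /rectangle in_setX/= xI.
Qed.

Lemma integrable_fubini_rect1 :
  leb.-integrable Ia (fun x => \int[leb]_(y in Ib) (f (x, y))%:E)%E.
Proof.
apply: (integrable_mkcond _ mIa).2.
by apply: eq_integrable (integrable_fubini_F Ig) => // x _; exact: gE1.
Qed.

End Fubini.

Lemma integrable_ev e : lb2.-integrable Om (EFin \o ev e).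
Proof.
have [M M0 HM] := bounded_ev e (a + b).
apply: (@le_integrable _ _ _ lb2 Om measurable_rect _ (cst M%:E)).
- apply/measurable_EFinP; apply: measurable_funTS; exact: measurable_ev.
- move=> [x y] /rect_bound[xr yr]; rewrite /= lee_fin (le_trans (HM _ _ xr yr))//.
  exact: ler_norm.
- apply/integrableP; split; first exact: measurable_cst.
  rewrite (_ : (fun x => _) = cst `|M|%:E)// integral_cst//; last exact: measurable_rect.
  by rewrite [X in (_ * X)%E]lebesgue_rect -EFinM ltry.
Qed.

Lemma sqint_ev e : sqint lb2 Om (ev e).
Proof.
split; [exact: measurable_rect|exact: measurable_ev|].
exact: (integrable_ev (MulT e e)).
Qed.

Lemma measurable_ev_x e y : @measurable_fun _ _ R1 R setT (fun t => ev e (t, y)).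
Proof.
have H := measurable_ev e.
apply: (@measurableT_comp _ _ _ _ (R1 * R1)%type R (ev e)); first exact: H.
exact: measurable_pair2.
Qed.

Lemma measurable_ev_y e x : @measurable_fun _ _ R1 R setT (fun t => ev e (x, t)).
Proof.
have H := measurable_ev e.
apply: (@measurableT_comp _ _ _ _ (R1 * R1)%type R (ev e)); first exact: H.
exact: measurable_pair1.
Qed.

Lemma integrable_ev_x e y : leb.-integrable Ia (fun t => (ev e (t, y))%:E).
Proof.
have [M M0 HM] := bounded_ev e (a + `|y|).
apply: (@integrable_bounded _ a _ M (ltW ha) (measurable_ev_x e y)) => t /sym_itv_bound.
rewrite (gtr0_norm ha) => tI; apply: HM; last by rewrite lerDr ltW.
by rewrite (le_trans tI)// lerDl.
Qed.

Lemma integrable_ev_y e x : leb.-integrable Ib (fun t => (ev e (x, t))%:E).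
Proof.
have [M M0 HM] := bounded_ev e (b + `|x|).
apply: (@integrable_bounded _ b _ M (ltW hb) (measurable_ev_y e x)) => t /sym_itv_bound.
rewrite (gtr0_norm hb) => tI; apply: HM; first by rewrite lerDr ltW.
by rewrite (le_trans tI)// lerDl.
Qed.

Definition II e := \int[lb2]_(z in Om) ev e z.
Definition Sx e y := \int[leb]_(x in Ia) ev e (x, y).
Definition Sy e x := \int[leb]_(y in Ib) ev e (x, y).

Lemma IIE e : (II e)%:E = (\int[lb2]_(z in Om) (ev e z)%:E)%E.
Proof.
rewrite /II /Rintegral fineK//; apply: integrable_fin_num; last exact: integrable_ev.
exact: measurable_rect.
Qed.

Lemma II_Sx e : II e = \int[leb]_(y in Ib) Sx e y.
Proof.
rewrite [RHS]/Rintegral; apply: EFin_inj; rewrite IIE (fubini_rect2 (integrable_ev e)).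
have E y : (\int[leb]_(x in Ia) (ev e (x, y))%:E = (Sx e y)%:E)%E.
  by rewrite /Sx/Rintegral fineK//; apply: integrable_fin_num; [exact: measurable_itv|exact: integrable_ev_x].
have H : (II e)%:E = (\int[leb]_(y in Ib) (Sx e y)%:E)%E.
  by rewrite IIE (fubini_rect2 (integrable_ev e)); apply: eq_integral => y _; rewrite E.
by rewrite -H -(fubini_rect2 (integrable_ev e)) -IIE.
Qed.

Lemma II_Sy e : II e = \int[leb]_(x in Ia) Sy e x.
Proof.
rewrite [RHS]/Rintegral; apply: EFin_inj; rewrite IIE (fubini_rect1 (integrable_ev e)).
have E x : (\int[leb]_(y in Ib) (ev e (x, y))%:E = (Sy e x)%:E)%E.
  by rewrite /Sy/Rintegral fineK//; apply: integrable_fin_num; [exact: measurable_itv|exact: integrable_ev_y].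
have H : (II e)%:E = (\int[leb]_(x in Ia) (Sy e x)%:E)%E.
  by rewrite IIE (fubini_rect1 (integrable_ev e)); apply: eq_integral => x _; rewrite E.
by rewrite -H -(fubini_rect1 (integrable_ev e)) -IIE.
Qed.

Lemma Sx_scale r e y : Sx (MulT (Cst r) e) y = r * Sx e y.
Proof.
by rewrite /Sx/= RintegralZl//; exact: integrable_ev_x.
Qed.

Lemma Sy_scale r e x : Sy (MulT (Cst r) e) x = r * Sy e x.
Proof.
by rewrite /Sy/= RintegralZl//; exact: integrable_ev_y.
Qed.

Lemma II_add e f : II (AddT e f) = II e + II f.
Proof.
by rewrite /II/= RintegralD//; [exact: measurable_rect|exact: integrable_ev|exact: integrable_ev].
Qed.

Lemma II_scale r e : II (MulT (Cst r) e) = r * II e.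
Proof.
by rewrite /II/= RintegralZl//; [exact: measurable_rect|exact: integrable_ev].
Qed.

Lemma eq_II e f : (forall x y, ev e (x, y) = ev f (x, y)) -> II e = II f.
Proof. by move=> ef; apply: eq_Rintegral => -[x y] _. Qed.

Lemma eq_Sx e f y : (forall x, ev e (x, y) = ev f (x, y)) -> Sx e y = Sx f y.
Proof. by move=> ef; apply: eq_Rintegral. Qed.

Lemma eq_Sy e f x : (forall y, ev e (x, y) = ev f (x, y)) -> Sy e x = Sy f x.
Proof. by move=> ef; apply: eq_Rintegral. Qed.

Lemma Sx0 e y : (forall x, ev e (x, y) = 0) -> Sx e y = 0.
Proof. by move=> H; rewrite (@eq_Sx _ (MulT (Cst 0) e)) ?Sx_scale ?mul0r// => x; rewrite H/= mul0r. Qed.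

Lemma Sy0 e x : (forall y, ev e (x, y) = 0) -> Sy e x = 0.
Proof. by move=> H; rewrite (@eq_Sy _ (MulT (Cst 0) e)) ?Sy_scale ?mul0r// => y; rewrite H/= mul0r. Qed.

Lemma II_sub e f : II (SubT e f) = II e - II f.
Proof. by rewrite II_add II_scale mulN1r. Qed.

Lemma le_II e f : (forall x y, Om (x, y) -> ev e (x, y) <= ev f (x, y)) -> II e <= II f.
Proof.
move=> ef; apply: le_Rintegral; [exact: measurable_rect|exact: integrable_ev|exact: integrable_ev|].
by move=> [x y]; exact: ef.
Qed.

Lemma Sx_ge0 e y : (forall x, 0 <= ev e (x, y)) -> 0 <= Sx e y.
Proof. by move=> H; apply: Rintegral_ge0 => x _. Qed.

Lemma Sy_ge0 e x : (forall y, 0 <= ev e (x, y)) -> 0 <= Sy e x.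
Proof. by move=> H; apply: Rintegral_ge0 => y _. Qed.

Lemma continuous_ev_x (e : tf R) (y : R) : continuous (fun t : R => ev e (t, y)).
Proof.
move=> t; apply: differentiable_continuous; apply/derivable1_diffP.
by have [] := is_derive_dx e t y.
Qed.

Lemma continuous_ev_y (e : tf R) (x : R) : continuous (fun t : R => ev e (x, t)).
Proof.
move=> t; apply: differentiable_continuous; apply/derivable1_diffP.
by have [] := is_derive_dy e x t.
Qed.

Lemma Sx_dx e y : Sx (dx e) y = ev e (a / 2, y) - ev e (- a / 2, y).
Proof.
apply: (@FTC_sym R a _ (fun t => ev e (t, y))) => // [|x]; first exact: continuous_ev_x.
exact: is_derive_dx.
Qed.

Lemma Sy_dy e x : Sy (dy e) x = ev e (x, b / 2) - ev e (x, - b / 2).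
Proof.
apply: (@FTC_sym R b _ (fun t => ev e (x, t))) => // [|y]; first exact: continuous_ev_y.
exact: is_derive_dy.
Qed.

Lemma II_dx e : II (dx e) = Sy e (a / 2) - Sy e (- a / 2).
Proof.
rewrite II_Sx; under eq_Rintegral do rewrite Sx_dx.
by rewrite RintegralB//; exact: integrable_ev_y.
Qed.

Lemma II_dy e : II (dy e) = Sx e (b / 2) - Sx e (- b / 2).
Proof.
rewrite II_Sy; under eq_Rintegral do rewrite Sy_dy.
by rewrite RintegralB//; exact: integrable_ev_x.
Qed.

End Rectangle.

(** * Estimates for pairs satisfying the boundary conditions *)

Section ExprExtra.
Context (R : realType).
Implicit Types e f p q s : tf R.

(** [dx] acts on syntax, but its value on a row depends only on the values of the function there.
    Boundary conditions can thus be differentiated along the side. *)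
Lemma dx_ext e f (y : R) : (forall x, ev e (x, y) = ev f (x, y)) ->
  forall x, ev (dx e) (x, y) = ev (dx f) (x, y).
Proof.
move=> ef x; have := is_derive_dx e x y.
rewrite (_ : (fun t => ev e (t, y)) = (fun t => ev f (t, y))); last exact/funext.
by move=> [_ <-]; have [_ <-] := is_derive_dx f x y.
Qed.

Lemma dy_ext e f (x : R) : (forall y, ev e (x, y) = ev f (x, y)) ->
  forall y, ev (dy e) (x, y) = ev (dy f) (x, y).
Proof.
move=> ef y; have := is_derive_dy e x y.
rewrite (_ : (fun t => ev e (x, t)) = (fun t => ev f (x, t))); last exact/funext.
by move=> [_ <-]; have [_ <-] := is_derive_dy f x y.
Qed.

Lemma dx_ext0 e (y : R) : (forall x, ev e (x, y) = 0) ->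
  forall x, ev (dx e) (x, y) = 0.
Proof. by move=> H x; rewrite (@dx_ext e (Cst 0) y H). Qed.

Lemma dy_ext0 e (x : R) : (forall y, ev e (x, y) = 0) ->
  forall y, ev (dy e) (x, y) = 0.
Proof. by move=> H y; rewrite (@dy_ext e (Cst 0) x H). Qed.

Fixpoint powT e n := if n is m.+1 then MulT e (powT e m) else Cst 1.

Lemma ev_mul e f z : ev (MulT e f) z = ev e z * ev f z. Proof. by []. Qed.

Lemma ev_add e f z : ev (AddT e f) z = ev e z + ev f z. Proof. by []. Qed.

Lemma ev_cst (r : R) z : ev (Cst r) z = r. Proof. by []. Qed.

Lemma ev_dx_mul e f z :
  ev (dx (MulT e f)) z = ev (dx e) z * ev f z + ev e z * ev (dx f) z.
Proof. by []. Qed.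

Lemma ev_dy_mul e f z :
  ev (dy (MulT e f)) z = ev (dy e) z * ev f z + ev e z * ev (dy f) z.
Proof. by []. Qed.

Lemma ev_powT e n z : ev (powT e n) z = ev e z ^+ n.
Proof. by elim: n => [|n IH] //=; rewrite IH exprS. Qed.

Lemma ev_dx_powT e n z :
  ev (dx (powT e n.+1)) z = n.+1%:R * ev e z ^+ n * ev (dx e) z.
Proof.
elim: n => [|n IH]; first by rewrite /=; ring.
have -> : ev (dx (powT e n.+2)) z =
  ev (dx e) z * ev (powT e n.+1) z + ev e z * ev (dx (powT e n.+1)) z by [].
rewrite IH ev_powT [in RHS]mulrSr exprS; ring.
Qed.

Definition sqT e := MulT e e.

Lemma ev_sq_ge0 e z : 0 <= ev (sqT e) z.
Proof. by rewrite /= -expr2 sqr_ge0. Qed.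

(** The two components of the massless part of [K]. *)
Definition k1 p q := SubT (dx p) (dy q).
Definition k2 p q := OppT (AddT (dx q) (dy p)).

End ExprExtra.

Section Estimates.
Context (R : realType) (a b : R) (ha : 0 < a) (hb : 0 < b).
Local Notation II := (II a b).
Local Notation Sy := (Sy b).
Implicit Types e f p q s : tf R.

Definition bc p q := [/\ forall x, ev p (x, b / 2) = 0,
  forall x, ev q (x, - b / 2) = 0,
  forall y, ev q (a / 2, y) = - ev p (a / 2, y) &
  forall y, ev q (- a / 2, y) = ev p (- a / 2, y)].

Definition nn e := II (sqT e).

Lemma nn_ge0 e : 0 <= nn e.
Proof. by apply: Rintegral_ge0 => z _; exact: ev_sq_ge0. Qed.

Lemma nn_add_le e f : nn (AddT e f) <= 2 * nn e + 2 * nn f.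
Proof.
rewrite /nn -!(II_scale ha hb) -(II_add ha hb); apply: (le_II ha hb) => x y _ /=.
by have := sqr_ge0 (ev e (x, y) - ev f (x, y)); lra.
Qed.

(* The cross terms of [|K0(p,q)|^2] form a Jacobian, which integrates to a boundary term. *)
Lemma energy_identity p q : bc p q ->
  nn (k1 p q) + nn (k2 p q) = nn (dx p) + nn (dy p) + nn (dx q) + nn (dy q).
Proof.
move=> [pT qB qR qL].
pose J := SubT (dy (MulT p (dx q))) (dx (MulT p (dy q))).
have -> : nn (dx p) + nn (dy p) + nn (dx q) + nn (dy q) =
  nn (k1 p q) + nn (k2 p q) - 2 * II J.
  rewrite /nn -(II_scale ha hb 2) -!(II_add ha hb) -(II_sub ha hb); apply: eq_II => x y.
  by rewrite /= !ev_dxdy; ring.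
suff -> : II J = 0 by ring.
rewrite (II_sub ha hb) (II_dy ha hb) (II_dx ha hb).
rewrite (@Sx0 _ a ha) => [|x]; last by rewrite /= pT mul0r.
rewrite (@Sx0 _ a ha) => [|x]; last by rewrite /= (dx_ext0 qB) mulr0.
(* On the vertical sides [q] is [p] up to sign, so the flux [p * q_y] is the tangential derivative
   of [h] or [- h] and leaves corner values. These vanish: [p = 0] on the top, and at the bottom
   corners [p] equals [q] up to sign, where [q = 0]. *)
pose h := MulT (Cst (- 2^-1)) (sqT p).
have dR y : ev (dy q) (a / 2, y) = - ev (dy p) (a / 2, y).
  rewrite (@dy_ext _ q (OppT p)) => [|t]; first by rewrite /=; ring.
  by rewrite qR /=; ring.
have dL y : ev (dy q) (- a / 2, y) = ev (dy p) (- a / 2, y) by rewrite (@dy_ext _ q p).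
rewrite (@eq_Sy _ b _ (dy h) (a / 2)) => [|y]; last by rewrite /= dR; field.
rewrite (@eq_Sy _ b _ (dy (OppT h)) (- a / 2)) => [|y]; last by rewrite /= dL; field.
have p0 : ev p (a / 2, - b / 2) = 0.
  by have := qR (- b / 2); rewrite qB; lra.
have p0' : ev p (- a / 2, - b / 2) = 0 by rewrite -qL qB.
by rewrite !(Sy_dy hb) /= !pT p0 p0'; ring.
Qed.

(** The two pairings add up to the divergence of [(p p' - q q', - p q' - q p')], whose normal
    component is annihilated by the boundary conditions on each side. *)
Lemma skew_identity p q p' q' : bc p q -> bc p' q' ->
  II (AddT (MulT p (k1 p' q')) (MulT q (k2 p' q'))) =
  - II (AddT (MulT (k1 p q) p') (MulT (k2 p q) q')).
Proof.
move=> [pT qB qR qL] [pT' qB' qR' qL']; apply/eqP; rewrite -addr_eq0.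
rewrite -(II_add ha hb) (@eq_II _ a b _ (SubT (dx (SubT (MulT p p') (MulT q q')))
  (dy (AddT (MulT p q') (MulT q p'))))); last by move=> x y /=; ring.
rewrite (II_sub ha hb) (II_dx ha hb) (II_dy ha hb).
rewrite (Sx0 ha) => [|x]; last by rewrite /= pT pT'; ring.
rewrite (Sx0 ha) => [|x]; last by rewrite /= qB qB'; ring.
rewrite (Sy0 hb) => [|y]; last by rewrite /= qR qR'; ring.
rewrite (Sy0 hb) => [|y]; last by rewrite /= qL qL'; ring.
by apply/eqP; ring.
Qed.

(** The cross term between mass and massless operator is the divergence of
    [(- p q, (q^2 - p^2) / 2)]. With these boundary conditions its outward flux is a non-negative
    square on every side, so a mass [m >= 0] can only raise the energy. *)
Lemma mass_term_ge0 p q : bc p q ->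
  0 <= II (AddT (MulT (k1 p q) (OppT q)) (MulT (k2 p q) p)).
Proof.
move=> [pT qB qR qL].
rewrite (@eq_II _ a b _ (AddT (dx (OppT (MulT p q)))
   (dy (MulT (Cst 2^-1) (SubT (sqT q) (sqT p)))))); last first.
  by move=> x y /=; field.
rewrite (II_add ha hb) (II_dx ha hb) (II_dy ha hb).
rewrite (@eq_Sy _ b _ (sqT p)) => [|y]; last by rewrite /= qR; ring.
rewrite (@eq_Sy _ b _ (OppT (sqT p)) (- a / 2)) => [|y]; last by rewrite /= qL; ring.
rewrite (@eq_Sx _ a _ (MulT (Cst 2^-1) (sqT q))) => [|y]; last by rewrite /= pT; ring.
rewrite (@eq_Sx _ a _ (MulT (Cst (-2^-1)) (sqT p)) (- b / 2)) => [|y]; last by rewrite /= qB; ring.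
rewrite !(Sx_scale ha) (Sy_scale hb).
have H1 := Sy_ge0 b (fun y => ev_sq_ge0 p (a / 2, y)).
have H2 := Sy_ge0 b (fun y => ev_sq_ge0 p (- a / 2, y)).
have H3 := Sx_ge0 a (fun x => ev_sq_ge0 q (x, b / 2)).
have H4 := Sx_ge0 a (fun x => ev_sq_ge0 p (x, - b / 2)).
lra.
Qed.

(** The function [(y + w) p^2] vanishes on both horizontal sides, on [y = w] through [p] and on
    [y = - w] through the weight. Integrating its [y]-derivative and absorbing half of [p^2] by
    Young's inequality gives the constant, as [|y + w| <= b]. *)
Lemma poincare p (w : R) : w = b / 2 \/ w = - b / 2 ->
  (forall x, ev p (x, w) = 0) -> nn p <= 4 * b ^+ 2 * nn (dy p).
Proof.
move=> wE p0; pose v := AddT VY (Cst w).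
have : II (dy (MulT v (sqT p))) = 0.
  rewrite (II_dy ha hb); case: wE => wE; rewrite /v; rewrite {}wE in p0 *.
    rewrite (Sx0 ha) => [|x]; last by rewrite /= p0 mul0r mulr0.
    by rewrite (Sx0 ha) ?subrr// => x /=; rewrite mulNr addNr mul0r.
  rewrite (Sx0 ha) => [|x]; last by rewrite /= mulNr subrr mul0r.
  by rewrite (Sx0 ha) ?subrr// => x /=; rewrite p0 mul0r mulr0.
rewrite (@eq_II _ a b _ (AddT (sqT p) (MulT (Cst 2) (MulT v (MulT p (dy p)))))); last first.
  by move=> x y /=; ring.
rewrite (II_add ha hb) (II_scale ha hb) => /eqP; rewrite addr_eq0 => /eqP H.
have : - (2 * II (MulT v (MulT p (dy p)))) <=
    II (AddT (MulT (Cst 2^-1) (sqT p)) (MulT (Cst (2 * b ^+ 2)) (sqT (dy p)))).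
  rewrite -mulNr -(II_scale ha hb); apply: (le_II ha hb) => x y /= [_].
  rewrite /= in_itv/= => /andP[y1 y2].
  set P := ev p _; set D := ev (dy p) _.
  have : (y + w) ^+ 2 <= b ^+ 2.
    rewrite -subr_ge0 subr_sqr mulr_ge0//; case: wE => ->; lra.
  have := sqr_ge0 (P + 2 * ((y + w) * D)) => H1 H2.
  have H3 : (y + w) ^+ 2 * D ^+ 2 <= b ^+ 2 * D ^+ 2 by rewrite ler_wpM2r// sqr_ge0.
  suff : 0 <= 2^-1 * (P * P) + 2 * b ^+ 2 * (D * D) + 2 * ((y + w) * (P * D)) by lra.
  apply: (@le_trans _ _ (2^-1 * (P + 2 * ((y + w) * D)) ^+ 2)).
    by rewrite mulr_ge0.
  rewrite -subr_ge0 [leRHS](_ : _ = 2 * (b ^+ 2 * D ^+ 2 - (y + w) ^+ 2 * D ^+ 2)).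
    by rewrite mulr_ge0// subr_ge0.
  by field.
rewrite (II_add ha hb) !(II_scale ha hb) /nn -H; lra.
Qed.

Section Weighted.
Variable eps : R.
Hypothesis epsE : eps = 1 \/ eps = -1.

Let eps2 : eps ^+ 2 = 1. Proof. by case: epsE => ->; rewrite ?sqrrN expr1n. Qed.

(** The affine function of [x] equal to 1 on the side [x = eps * a / 2] and to 0 on the opposite
    side. *)
Definition xi := AddT (Cst 2^-1) (MulT (Cst (eps / a)) VX).
Definition sgn_side := eps * a / 2.

Lemma ev_dx_xi z : ev (dx xi) z = eps / a.
Proof. by rewrite /=; ring. Qed.

Lemma xi_01 x y : rectangle a b (x, y) -> 0 <= ev xi (x, y) <= 1.
Proof.
move=> [/=+ _]; rewrite in_itv/= => /andP[x1 x2].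
have an : a != 0 by rewrite gt_eqF.
have -> : 2^-1 + eps / a * x = (a / 2 + eps * x) / a by field.
rewrite divr_ge0 ?(ltW ha)//=; last by case: epsE => ->; lra.
by rewrite ler_pdivrMr// mul1r; case: epsE => ->; lra.
Qed.

Lemma xi_side y : ev xi (sgn_side, y) = 1.
Proof.
have an : a != 0 by rewrite gt_eqF.
rewrite /= /sgn_side (_ : eps / a * (eps * a / 2) = eps ^+ 2 / 2); last by field.
by rewrite eps2; field.
Qed.

Lemma xi_opp y : ev xi (- sgn_side, y) = 0.
Proof.
have an : a != 0 by rewrite gt_eqF.
rewrite /= /sgn_side (_ : eps / a * (- (eps * a / 2)) = - (eps ^+ 2 / 2)); last by field.
by rewrite eps2; field.
Qed.

Lemma II_dx_side e : (forall y, ev e (- sgn_side, y) = 0) ->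
  eps * II (dx e) = Sy e sgn_side.
Proof.
rewrite (II_dx ha hb) /sgn_side; case: epsE => ->.
  rewrite !mul1r -mulNr => H.
  by rewrite [X in _ - X](Sy0 hb)// subr0.
rewrite !mulN1r mulNr opprK => H.
by rewrite (Sy0 hb H) sub0r opprK.
Qed.

(** A trace inequality: the side integral of [s^2] is the integral of the derivative of [xi * s^2],
    which vanishes on the opposite side. *)
Lemma side_le s : Sy (sqT s) sgn_side <= (a^-1 + 1) * nn s + nn (dx s).
Proof.
have an : a != 0 by rewrite gt_eqF.
rewrite (@eq_Sy _ _ _ (MulT xi (sqT s))); last first.
  move=> y; rewrite -[LHS]mul1r -(xi_side y) //.
rewrite -II_dx_side; last by move=> y; rewrite -[LHS]/(ev xi _ * ev (sqT s) _) xi_opp mul0r.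
rewrite /nn -!(II_scale ha hb) -(II_add ha hb); apply: (le_II ha hb) => x y O.
have /andP[X0 X1] := xi_01 O; rewrite -[leLHS]/(eps * (ev (dx xi) _ * ev (sqT s) _ + ev xi _ * ev (dx (sqT s)) _)) ev_dx_xi.
set X := ev xi _ in X0 X1 *; rewrite /=; set S := ev s _; set D := ev (dx s) _.
have -> : eps * (eps / a * (S * S) + X * (D * S + S * D)) =
   eps ^+ 2 / a * S ^+ 2 + 2 * (eps * X * S) * D by field.
rewrite eps2.
have H1 := sqr_ge0 (eps * X * S - D).
have H2 : (eps * X * S) ^+ 2 <= S ^+ 2.
  rewrite !exprMn eps2 mul1r ler_piMl ?sqr_ge0//.
  by rewrite expr_le1.
suff : 2 * (eps * X * S) * D <= S ^+ 2 + D ^+ 2 by rewrite !expr2; lra.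
rewrite sqrrB in H1; lra.
Qed.

(* Hardy's inequality at the side, where the weight [xi ^+ n] concentrates. *)
Lemma weighted_hardy s n (N := n.+1%:R : R) :
  (N / a) ^+ 2 * II (MulT (powT xi n.*2) (sqT s)) <=
  2 * N / a * Sy (sqT s) sgn_side + 4 * II (MulT (powT xi n.+1.*2) (sqT (dx s))).
Proof.
have an : a != 0 by rewrite gt_eqF.
have N1 : 1 <= N by rewrite ler1n.
have N2 : 2 * N - 1 = n.*2.+1%:R by rewrite /N -!natr1 -mul2n natrM; ring.
have N0 : 0 < N by lra.
have Nn : N != 0 by rewrite gt_eqF.
clearbody N.
(* The exponent [2 n + 1] equals [2 N - 1]. Differentiating [E] yields [s^2] with weight
   [xi ^+ (2 n)] and a cross term whose weight splits as [xi ^+ n * xi ^+ (n + 1)], the two factors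
   used in Young's inequality. *)
pose E := MulT (powT xi n.*2.+1) (sqT s).
have H : eps * II (dx E) = Sy (sqT s) sgn_side.
  rewrite II_dx_side; last first.
    by move=> y; rewrite /E ev_mul ev_powT xi_opp expr0n mul0r.
  apply: eq_Sy => y; rewrite /E ev_mul ev_powT xi_side.
  by rewrite expr1n mul1r.
set I0 := II (MulT (powT xi n.*2) _); set J := II (MulT (powT xi n.+1.*2) _).
set S := Sy _ _ in H *.
pose G := MulT (powT xi n.*2.+1) (MulT s (dx s)).
have H2 : S = (2 * N - 1) / a * I0 + 2 * eps * II G.
  rewrite -H /I0 -!(II_scale ha hb) -(II_add ha hb); apply: eq_II => x y.
  rewrite ev_mul /E ev_dx_mul ev_dx_powT ev_dx_xi /G /sqT.
  rewrite [RHS]ev_add !(ev_mul, ev_cst, ev_powT, ev_dx_mul).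
  rewrite N2.
  set X := _ ^+ n.*2; set Y := _ ^+ n.*2.+1; set m := n.*2.+1%:R.
  set u := ev s _; set D := ev (dx s) _.
  have -> : eps * (m * X * (eps / a) * (u * u) + Y * (D * u + u * D)) =
    m / a * eps ^+ 2 * (X * (u * u)) + 2 * eps * (Y * (u * D)) by ring.
  by rewrite eps2; ring.
have H3 : - (2 * eps * II G) <= N / (2 * a) * I0 + 2 * a / N * J.
  rewrite -mulNr /I0 /J -!(II_scale ha hb) -(II_add ha hb); apply: (le_II ha hb) => x y _.
  rewrite /G /sqT [leRHS]ev_add !(ev_mul, ev_cst, ev_powT); set X := ev xi _.
  set u := ev s _; set D := ev (dx s) _.
  have -> : X ^+ n.*2 = X ^+ n * X ^+ n by rewrite -addnn exprD.
  have -> : X ^+ n.*2.+1 = X ^+ n * X ^+ n.+1 by rewrite -addnn -addnS exprD.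
  have -> : X ^+ n.+1.*2 = X ^+ n.+1 * X ^+ n.+1 by rewrite -addnn exprD.
  move: (X ^+ n) (X ^+ n.+1) => p q.
  have c0 : 0 <= N / (2 * a) by rewrite divr_ge0 ?ltW// mulr_gt0.
  have := mulr_ge0 c0 (sqr_ge0 (p * u + eps * (2 * a / N) * (q * D))).
  have -> : N / (2 * a) * (p * u + eps * (2 * a / N) * (q * D)) ^+ 2 =
    N / (2 * a) * (p * p * (u * u)) + 2 * eps * (p * q * (u * D)) +
    eps ^+ 2 * (2 * a / N * (q * q * (D * D))) by field; rewrite ?Nn ?an.
  rewrite eps2; lra.
have I00 : 0 <= I0.
  apply: Rintegral_ge0 => z _; rewrite ev_mul.
  by rewrite mulr_ge0 ?ev_sq_ge0// ev_powT -addnn exprD -expr2 sqr_ge0.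
(* After absorption the coefficient [(2 N - 1) / a - N / (2 a)] is still at least [N / (2 a)],
   because [N >= 1]. *)
have H5 : N / (2 * a) * I0 <= S + 2 * a / N * J.
  have : N / (2 * a) * I0 <= (2 * N - 1) / a * I0 - N / (2 * a) * I0.
    have -> : (2 * N - 1) / a * I0 - N / (2 * a) * I0 =
      N / (2 * a) * I0 + (N - 1) / a * I0 by field.
    by rewrite lerDl mulr_ge0// divr_ge0 ?(ltW ha)//; lra.
  lra.
have c0 : 0 <= 2 * N / a by rewrite divr_ge0 ?(ltW ha)// mulr_ge0// ltW.
have := ler_wpM2l c0 H5; rewrite mulrDr.
have -> : 2 * N / a * (N / (2 * a) * I0) = (N / a) ^+ 2 * I0 by field.
by have -> : 2 * N / a * (2 * a / N * J) = 4 * J by field; rewrite ?Nn ?an.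
Qed.

End Weighted.
End Estimates.

(** * Completeness of trigonometric systems *)

Section Step.
Context (R : realType).

Lemma bernoulli_sub (x : R) m : 0 <= x <= 1 -> 1 - m%:R * x <= (1 - x) ^+ m.
Proof.
move=> /andP[x0 x1]; elim: m => [|m IH]; first by rewrite mul0r subr0 expr0.
rewrite exprS -natr1.
apply: (@le_trans _ _ ((1 - x) * (1 - m%:R * x))).
  have : 0 <= m%:R * (x * x) by rewrite mulr_ge0 ?mulr_ge0.
  by move=> ?; lra.
by rewrite ler_wpM2l// subr_ge0.
Qed.

Lemma bernoulli_add (x : R) m : 0 <= x -> 1 + m%:R * x <= (1 + x) ^+ m.
Proof.
move=> x0; elim: m => [|m IH]; first by rewrite mul0r addr0 expr0.
rewrite exprS -natr1.
apply: (@le_trans _ _ ((1 + x) * (1 + m%:R * x))).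
  have : 0 <= m%:R * (x * x) by rewrite mulr_ge0 ?mulr_ge0.
  by move=> ?; lra.
by rewrite ler_wpM2l// addr_ge0.
Qed.

(** The polynomials of Brosowski and Deutsch from the elementary proof of the Stone-Weierstrass
    theorem. By Bernoulli's inequality they tend to 1 where [2 s < 1] and to 0 where [2 s > 1]. *)
Definition stepq n (s : R) := (1 - s ^+ n) ^+ (2 ^ n)%N.

Lemma stepq_01 n s : 0 <= s <= 1 -> 0 <= stepq n s <= 1.
Proof.
move=> /andP[s0 s1]; have H : 0 <= 1 - s ^+ n <= 1.
  by rewrite subr_ge0 exprn_ile1//= lerBlDr lerDl exprn_ge0.
by case/andP: H => ? ?; rewrite /stepq exprn_ge0//= exprn_ile1.
Qed.

Lemma stepq_cvg1 s : 0 <= s < 2^-1 -> (fun n => stepq n s) @ \oo --> (1 : R).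
Proof.
move=> /andP[s0 s1]; have s01 : 0 <= s <= 1 by apply/andP; split; lra.
apply: (@squeeze_cvgr _ _ _ _ (fun n => 1 - (2 * s) ^+ n) (fun=> 1)).
- apply: nearW => n; have /andP[_ ->] := stepq_01 n s01; rewrite andbT.
  have := @bernoulli_sub (s ^+ n) (2 ^ n)%N; rewrite natrX -exprMn; apply.
  by case/andP: s01 => ? ?; rewrite exprn_ge0//= exprn_ile1.
- rewrite -[X in _ --> X]subr0; apply: cvgB; first exact: cvg_cst.
  by apply: cvg_expr; rewrite ger0_norm ?mulr_ge0//; lra.
- exact: cvg_cst.
Qed.

Lemma stepq_cvg0 s : 2^-1 < s <= 1 -> (fun n => stepq n s) @ \oo --> (0 : R).
Proof.
move=> /andP[s0 s1]; have s01 : 0 <= s <= 1 by apply/andP; split; lra.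
have s2 : 0 < 2 * s by lra.
apply: (@squeeze_cvgr _ _ _ _ (fun=> 0) (fun n => (2 * s)^-1 ^+ n)).
- apply: nearW => n; have /andP[-> _] := stepq_01 n s01; rewrite /=.
  rewrite exprVn -[leRHS]mul1r ler_pdivlMr ?exprn_gt0//.
  have sn : 0 <= s ^+ n <= 1.
    by case/andP: s01 => ? ?; rewrite exprn_ge0//= exprn_ile1.
  apply: (@le_trans _ _ (stepq n s * (1 + s ^+ n) ^+ (2 ^ n)%N)).
    rewrite ler_wpM2l//; first by have /andP[] := stepq_01 n s01.
    have := @bernoulli_add (s ^+ n) (2 ^ n)%N; rewrite natrX -exprMn.
    by case/andP: sn => sn _ /(_ sn); lra.
  rewrite /stepq -exprMn exprn_ile1//; case/andP: sn => u v.
    by rewrite mulr_ge0//; lra.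
  rewrite (_ : _ * _ = 1 - (s ^+ n) ^+ 2); last by ring.
  by rewrite lerBlDr lerDl sqr_ge0.
- exact: cvg_cst.
- by apply: cvg_expr; rewrite ger0_norm ?invr_ge0 ?ltW// invf_lt1//; lra.
Qed.

End Step.

Section Completeness1.
Context (R : realType) (c : R) (hc : 0 < c).
Local Notation leb := (@lebesgue_measure R).
Local Notation Ic := (`]- c / 2, c / 2[%classic : set R).

(** Carries the interval onto []0, pi[], where the cosine is strictly decreasing, so that
    [cos (tau x)] separates points. *)
Definition tau (x : R) := pi / c * (x + c / 2).

Lemma tau_itv x : Ic x -> 0 < tau x < pi.
Proof.
rewrite /= in_itv/= => /andP[x1 x2]; rewrite /tau.
have pc : 0 < pi / c :> R by rewrite divr_gt0 ?pi_gt0.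
rewrite mulr_gt0//=; last by lra.
rewrite [X in _ < X](_ : _ = pi / c * c); last by rewrite divfK// gt_eqF.
by rewrite ltr_pM2l//; lra.
Qed.

Lemma lt_tau x y : (tau x < tau y) = (x < y).
Proof. by rewrite /tau ltr_pM2l ?ltrD2r// divr_gt0 ?pi_gt0. Qed.

Lemma continuous_tau : continuous tau.
Proof.
move=> x; apply: cvgM; first exact: cvg_cst.
by apply: cvgD; [exact: cvg_id|exact: cvg_cst].
Qed.

Lemma measurable_cos_tau : measurable_fun setT (fun x : R => cos (tau x)).
Proof.
apply: continuous_measurable_fun => x.
by apply: continuous_comp; [exact: continuous_tau|exact: continuous_cos].
Qed.

Let mIc : measurable (Ic : set (measurableTypeR R)).
Proof. exact: measurable_itv. Qed.

Lemma integrable_mul_bounded (f g : R -> R) M : leb.-integrable Ic (EFin \o f) ->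
  measurable_fun setT g -> (forall x, Ic x -> `|g x| <= M) ->
  leb.-integrable Ic (EFin \o (fun x => f x * g x)).
Proof.
move=> If mg gM; have mf : measurable_fun Ic f by apply/measurable_EFinP; exact: (measurable_int leb).
apply: (@le_integrable _ _ _ leb Ic mIc _ (fun x => (M%:E * (f x)%:E)%E)).
- by apply/measurable_EFinP; apply: measurable_funM => //; exact: measurable_funS mg.
- move=> x Ix; rewrite /= lee_fin !normrM mulrC ler_wpM2r// (le_trans (gM x Ix))//.
  exact: ler_norm.
- exact: integrableZl.
Qed.

(** Step polynomials in [cos (tau x)] converge boundedly, off [x0], to the indicator of [x < x0],
    and dominated convergence transfers the vanishing of all moments. *)
Lemma integral_halfline0 (f : R -> R) (x0 : R) : leb.-integrable Ic (EFin \o f) ->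
  (forall n, \int[leb]_(x in Ic) (f x * cos (tau x) ^+ n) = 0) -> Ic x0 ->
  \int[leb]_(x in Ic) (f x * (x < x0)%R%:R) = 0.
Proof.
move=> If f0 Ix0.
have Icos n : leb.-integrable Ic (EFin \o (fun x => f x * cos (tau x) ^+ n)).
  apply: (integrable_mul_bounded (M := 1) If).
    by apply: measurable_funX; exact: measurable_cos_tau.
  by move=> x _; rewrite normrX exprn_ile1// ler_norml cos_le1 cos_geN1.
(* The additional power of the cosine makes the induction work, as multiplication by ['X] raises it
   by one. *)
have poly0 (p : {poly R}) k :
    leb.-integrable Ic (EFin \o (fun x => f x * (p.[cos (tau x)] * cos (tau x) ^+ k))) /\
    \int[leb]_(x in Ic) (f x * (p.[cos (tau x)] * cos (tau x) ^+ k)) = 0.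
  elim/poly_ind: p k => [|p r IH] k.
    rewrite (_ : (fun x => _) = (fun=> 0)); last first.
      by apply/funext => x; rewrite horner0 mul0r mulr0.
    split; first exact: integrable0.
    by rewrite Rintegral_cst// mul0r.
  have E x : f x * ((p * 'X + r%:P).[cos (tau x)] * cos (tau x) ^+ k) =
      f x * (p.[cos (tau x)] * cos (tau x) ^+ k.+1) + r * (f x * cos (tau x) ^+ k).
    by rewrite hornerMXaddC exprS; ring.
  have [I1 I2] := IH k.+1.
  have I3 : leb.-integrable Ic (EFin \o (fun x => r * (f x * cos (tau x) ^+ k))).
    exact: (integrableZl mIc r (Icos k)).
  rewrite (_ : (fun x => f x * _) = fun x => f x * (p.[cos (tau x)] * cos (tau x) ^+ k.+1) +
    r * (f x * cos (tau x) ^+ k)); last by apply/funext => x; exact: E.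
  split; first exact: (integrableD mIc I1 I3).
  by rewrite RintegralD// I2 RintegralZl// f0 mulr0 addr0.
(* The factor [4^-1] keeps [s] within [[0, 1]], and [s x < 2^-1] holds exactly when
   [cos (tau x) > cos (tau x0)], that is when [x < x0]. *)
pose s x := 2^-1 + 4^-1 * (cos (tau x0) - cos (tau x)).
pose P n := (1 - ((2^-1 + 4^-1 * cos (tau x0))%:P - 4^-1%:P * 'X) ^+ n) ^+ (2 ^ n)%N : {poly R}.
have PE n x : (P n).[cos (tau x)] = stepq n (s x).
  rewrite /P /stepq !hornerE; congr ((1 - _ ^+ _) ^+ _); rewrite /s; ring.
have s01 x : 0 <= s x <= 1.
  have := cos_le1 (tau x); have := cos_geN1 (tau x).
  have := cos_le1 (tau x0); have := cos_geN1 (tau x0) => *.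
  by apply/andP; split; rewrite /s; lra.
have ms n : measurable_fun setT (fun x => stepq n (s x)).
  under eq_fun do rewrite -PE.
  apply: (@measurableT_comp _ _ _ _ _ _ (fun t => (P n).[t])).
    by apply: continuous_measurable_fun; exact: continuous_horner.
  exact: measurable_cos_tau.
have mf : measurable_fun Ic f by apply/measurable_EFinP; exact: (measurable_int leb).
have tauI y : Ic y -> tau y \in `[0, pi].
  by move=> /tau_itv/andP[? ?]; rewrite in_itv/= !ltW.
have H := @dominated_convergence _ _ R leb Ic mIc
  (fun n x => (f x * stepq n (s x))%:E) (fun x => (f x * (x < x0)%R%:R)%:E)
  (fun x => `|(f x)%:E|%E).
have [| | | | |_ _] := H.
- by move=> n; apply/measurable_EFinP; apply: measurable_funM => //; exact: measurable_funS (ms n).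
- apply/measurable_EFinP; apply: measurable_funM => //.
  rewrite (_ : (fun x => _) = \1_(`]-oo, x0[%classic : set R)).
    by apply: measurable_indic; exact: measurable_itv.
  apply/funext => x; rewrite indicE; congr (nat_of_bool _)%:R.
  by apply/idP/idP; rewrite inE /= in_itv.
- exists [set x0]; split; [exact: measurable_set1|exact: lebesgue_measure_set1|].
  move=> x /=; apply: contra_notP => xx0 Ix.
  apply: cvg_EFin; first exact: nearW.
  apply: cvgM; first exact: cvg_cst.
  case: (ltgtP x x0) => // xlt.
    apply: stepq_cvg1; have /andP[-> _] := s01 x; rewrite /= /s.
    have : cos (tau x0) < cos (tau x) by rewrite ltr_cos ?lt_tau// tauI.
    lra.
  apply: stepq_cvg0; have /andP[_ ->] := s01 x; rewrite andbT /s.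
  have : cos (tau x) < cos (tau x0) by rewrite ltr_cos ?lt_tau// tauI.
  lra.
- exact: integrable_abse.
- apply: aeW => x n _; rewrite /= lee_fin normrM ler_piMr//.
  by have /andP[q0 q1] := stepq_01 n (s01 x); rewrite ger0_norm.
rewrite (_ : [sequence _]_n = fun=> 0%E); last first.
  apply/funext => n /=.
  have [I1 I2] := poly0 (P n) 0%N.
  rewrite -[LHS]fineK; last first.
    apply: integrable_fin_num => //; move: I1; apply: eq_integrable => // x _ /=.
    by rewrite expr0 mulr1 PE.
  congr EFin; rewrite -[RHS]I2; apply: eq_Rintegral => x _.
  by rewrite expr0 mulr1 PE.
move/(cvg_unique (@ereal_hausdorff R)) => /(_ _ (cvg_cst _)).
by rewrite /Rintegral => ->.
Qed.

(** All integrals over half-lines vanish, so Lebesgue differentiation of the constant primitive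
    recovers [f = 0] almost everywhere. *)
Lemma cos_moments_ae0 (f : R -> R) : leb.-integrable Ic (EFin \o f) ->
  (forall n, \int[leb]_(x in Ic) (f x * cos (tau x) ^+ n) = 0) ->
  {ae leb, forall x, Ic x -> f x = 0}.
Proof.
move=> If f0; pose g := f \_ Ic.
have Ig : leb.-integrable setT (EFin \o g).
  by rewrite /g -restrict_EFin; exact: (integrable_mkcond _ mIc).1.
have mT (x : R) : measurable (`]-oo, x]%classic : set (measurableTypeR R)).
  exact: measurable_itv.
have F0 (x : R) : \int[leb]_(t in `]-oo, x]) g t = 0.
  rewrite -Rintegral_itv_bndo_bndc; last first.
    by apply: integrableS Ig => //; exact: measurable_itv.
  transitivity (\int[leb]_(t in Ic) (f t * (t < x)%R%:R)).
    rewrite Rintegral_mkcond [RHS]Rintegral_mkcond; apply: eq_Rintegral => t _.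
    rewrite /g !patchE.
    have -> : (t \in (`]-oo, x[%classic : set R)) = (t < x).
      by apply/idP/idP; rewrite inE /= in_itv.
    by case: (t < x); rewrite ?mulr1// mulr0 if_same.
  have [xI|xI] := pselect (Ic x); first exact: integral_halfline0.
  have [xc|xc] := ltP x (c / 2).
    rewrite -[RHS](mul0r (fine (leb Ic))) -Rintegral_cst//.
    apply: eq_Rintegral => t /set_mem/=; rewrite in_itv/= => /andP[t1 _].
    case: ltP => tx; last by rewrite mulr0.
    by exfalso; apply: xI; rewrite /= in_itv/= xc andbT (lt_trans t1).
  rewrite -[RHS](f0 0%N); apply: eq_Rintegral => t /set_mem/=.
  by rewrite in_itv/= => /andP[_ t2]; rewrite (lt_le_trans t2 xc) expr0.
have := @FTC1Ny R g (fun y => integrableS measurableT (mT y) (@subsetT _ _) Ig).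
have Lg : locally_integrable [set: R] g.
  by apply: open_integrable_locally => //; exact: openT.
move=> /(_ Lg); apply: (@filterS _ _ (ae_filter_ringOfSetsType leb)) => x [_ Hx] Ix.
move: Hx; rewrite derive1E (_ : (fun x0 : R => _) = cst 0); last exact/funext.
by rewrite derive_cst /g patchE mem_set.
Qed.

(** Totality is tested against integrable functions because slices obtained from Fubini's theorem
    are integrable. *)
Definition complete_sys (h : nat -> R -> R) := forall f : R -> R,
  leb.-integrable Ic (EFin \o f) ->
  (forall l, \int[leb]_(x in Ic) (f x * h l x) = 0) ->
  {ae leb, forall x, Ic x -> f x = 0}.

(** By the recurrence the span of [h] is stable under multiplication by [cos (tau x)]. Orthogonality
    to [h] therefore kills every cosine moment of [f * h 0], and [h 0] has no zero in the
    interval. *)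
Lemma complete_sysP (h : nat -> R -> R) (M : R) :
  (forall l, continuous (h l)) -> (forall l x, Ic x -> `|h l x| <= M) ->
  (forall x, Ic x -> h 0%N x != 0) ->
  (forall l, exists k1 l1 k2 l2, forall x,
     cos (tau x) * h l x = k1 * h l1 x + k2 * h l2 x) ->
  complete_sys h.
Proof.
move=> ch hM h0 rec f If f0.
have mh l : measurable_fun setT (h l) by exact: continuous_measurable_fun.
have Ih l n : leb.-integrable Ic (EFin \o (fun x => f x * (cos (tau x) ^+ n * h l x))).
  apply: (integrable_mul_bounded (M := M) If).
    apply: measurable_funM => //; apply: measurable_funX; exact: measurable_cos_tau.
  move=> x Ix; rewrite normrM (le_trans _ (hM l x Ix))// ler_piMl//.
  by rewrite normrX exprn_ile1// ler_norml cos_le1 cos_geN1.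
have f0n l n : \int[leb]_(x in Ic) (f x * (cos (tau x) ^+ n * h l x)) = 0.
  elim: n l => [|n IH] l.
    by rewrite -[RHS](f0 l); apply: eq_Rintegral => x _; rewrite expr0 mul1r.
  have [k1 [l1 [k2 [l2 E]]]] := rec l.
  transitivity (\int[leb]_(x in Ic) (k1 * (f x * (cos (tau x) ^+ n * h l1 x)) +
      k2 * (f x * (cos (tau x) ^+ n * h l2 x)))).
    apply: eq_Rintegral => x _; rewrite exprSr -[_ * _ * h l x]mulrA E; ring.
  rewrite RintegralD//; [|exact: (integrableZl mIc k1 (Ih l1 n))|exact: (integrableZl mIc k2 (Ih l2 n))].
  rewrite !RintegralZl//.
  by rewrite !IH !mulr0 addr0.
have I0 : leb.-integrable Ic (EFin \o (fun x => f x * h 0%N x)).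
  by apply: (integrable_mul_bounded (M := M) If) => // x Ix; exact: hM.
have := @cos_moments_ae0 _ I0; move=> H.
apply: (@filterS _ _ (ae_filter_ringOfSetsType leb) _ _ _ (H _)) => [x Hx Ix|n].
  by have /eqP := Hx Ix; rewrite mulf_eq0 (negbTE (h0 x Ix)) orbF => /eqP.
by rewrite -[RHS](f0n 0%N n); apply: eq_Rintegral => x _; ring.
Qed.

End Completeness1.

Section TrigSystems.
Context (R : realType) (c : R) (hc : 0 < c).
Local Notation tau := (tau c).

Lemma cos_mul_cos (t u : R) : cos t * cos u = 2^-1 * cos (u + t) + 2^-1 * cos (u - t).
Proof. by rewrite cosB cosD; field. Qed.

Lemma cos_mul_sin (t u : R) : cos t * sin u = 2^-1 * sin (u + t) + 2^-1 * sin (u - t).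
Proof. by rewrite sinB sinD; field. Qed.

Lemma continuous_cosM (w : R) : continuous (fun x => cos (w * tau x)).
Proof.
move=> x; apply: continuous_comp; last exact: continuous_cos.
by apply: cvgM; [exact: cvg_cst|exact: continuous_tau].
Qed.

Lemma continuous_sinM (w : R) : continuous (fun x => sin (w * tau x)).
Proof.
move=> x; apply: continuous_comp; last exact: continuous_sin.
by apply: cvgM; [exact: cvg_cst|exact: continuous_tau].
Qed.

Lemma cos_normle1 (t : R) : `|cos t| <= 1.
Proof. by rewrite ler_norml cos_le1 cos_geN1. Qed.

Lemma sin_normle1 (t : R) : `|sin t| <= 1.
Proof. by rewrite ler_norml sin_le1 sin_geN1. Qed.

Lemma complete_cos : complete_sys c (fun k x => cos (k%:R * tau x)).
Proof.
apply: (@complete_sysP _ _ hc _ 1) => [l|l x _|x _|l].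
- exact: continuous_cosM.
- exact: cos_normle1.
- by rewrite mul0r cos0 oner_neq0.
- case: l => [|l].
    by exists 1, 1%N, 0, 0%N => x; rewrite !mul0r cos0 mulr1 !mul1r addr0.
  exists 2^-1, l.+2, 2^-1, l => x; rewrite cos_mul_cos -[in X in X = _](natr1 l).
  by congr (_ * cos _ + _ * cos _); rewrite -?natr1; ring.
Qed.

Lemma complete_sin : complete_sys c (fun k x => sin (k.+1%:R * tau x)).
Proof.
apply: (@complete_sysP _ _ hc _ 1) => [l|l x _|x Ix|l].
- exact: continuous_sinM.
- exact: sin_normle1.
- rewrite mul1r; have /andP[? ?] := tau_itv hc Ix.
  by rewrite gt_eqF// sin_gt0_pi//; apply/andP.
- case: l => [|l].
    exists 2^-1, 1%N, 0, 0%N => x; rewrite cos_mul_sin mul1r subrr sin0 mulr0 !mul0r.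
    by congr (_ * sin _ + _); ring.
  exists 2^-1, l.+2, 2^-1, l => x; rewrite cos_mul_sin.
  by congr (_ * sin _ + _ * sin _); rewrite -?natr1; ring.
Qed.

(** Half-integer frequencies fit mixed conditions: Dirichlet at [tau = pi] and Neumann at [tau = 0].
    Stepping down from frequency 1/2 leads to -1/2, which parity folds back. *)
Lemma complete_coshalf : complete_sys c (fun k x => cos ((k%:R + 2^-1) * tau x)).
Proof.
apply: (@complete_sysP _ _ hc _ 1) => [l|l x _|x Ix|l].
- exact: continuous_cosM.
- exact: cos_normle1.
- have /andP[? ?] := tau_itv hc Ix; rewrite gt_eqF// cos_gt0_pihalf//.
  by apply/andP; split; lra.
- case: l => [|l].
    exists 2^-1, 1%N, 2^-1, 0%N => x; rewrite cos_mul_cos.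
    rewrite -[cos ((0%:R + 2^-1) * tau x)]cosN.
    by congr (_ * cos _ + _ * cos _); field.
  exists 2^-1, l.+2, 2^-1, l => x; rewrite cos_mul_cos.
  by congr (_ * cos _ + _ * cos _); rewrite -?natr1; ring.
Qed.

Lemma complete_sinhalf : complete_sys c (fun k x => sin ((k%:R + 2^-1) * tau x)).
Proof.
apply: (@complete_sysP _ _ hc _ 1) => [l|l x _|x Ix|l].
- exact: continuous_sinM.
- exact: sin_normle1.
- have /andP[? ?] := tau_itv hc Ix; rewrite gt_eqF// sin_gt0_pi//.
  by apply/andP; split; lra.
- case: l => [|l].
    exists 2^-1, 1%N, (- 2^-1), 0%N => x; rewrite cos_mul_sin mulNr -mulrN -sinN.
    by congr (_ * sin _ + _ * sin _); field.
  exists 2^-1, l.+2, 2^-1, l => x; rewrite cos_mul_sin.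
  by congr (_ * sin _ + _ * sin _); rewrite -?natr1; ring.
Qed.

End TrigSystems.

Section Completeness2.
Context (R : realType) (a b : R) (ha : 0 < a) (hb : 0 < b).
Local Notation leb := (@lebesgue_measure R).
Local Notation Ia := (`]- a / 2, a / 2[%classic : set R).
Local Notation Ib := (`]- b / 2, b / 2[%classic : set R).
Local Notation Om := (rectangle a b).
Local Notation lb2 := (leb \x leb)%E.
Local Notation R1 := (measurableTypeR R).

(** For each [l], completeness in [x] annihilates the partial moment [E l] almost everywhere.
    Countably many [l] share one null set, and off it completeness in [y] applies to the slice of
    [f]. *)
Lemma complete_rect (h g : nat -> R -> R) (f : R * R -> R) :
  complete_sys a h -> complete_sys b g ->
  (forall k, continuous (h k)) -> (forall k x, `|h k x| <= 1) ->
  (forall k, continuous (g k)) -> (forall k x, `|g k x| <= 1) ->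
  lb2.-integrable Om (EFin \o f) ->
  (forall k l, \int[lb2]_(z in Om) (f z * (h k z.1 * g l z.2)) = 0) ->
  {ae lb2, forall z, Om z -> f z = 0}.
Proof.
move=> Ch Cg ch h1 cg g1 If f0.
have mO : measurable (Om : set (R1 * R1)) by exact: measurable_rect.
have mIa : measurable (Ia : set R1) by exact: measurable_itv.
have mIb : measurable (Ib : set R1) by exact: measurable_itv.
have mh k : @measurable_fun _ _ R1 R setT (h k) by exact: continuous_measurable_fun.
have mg k : @measurable_fun _ _ R1 R setT (g k) by exact: continuous_measurable_fun.
have mf : @measurable_fun _ _ (R1 * R1)%type R Om f.
  by apply/measurable_EFinP; exact: (measurable_int lb2).
have mh2 k : @measurable_fun _ _ (R1 * R1)%type R Om (fun z => h k z.1).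
  apply: measurable_funTS; apply: (@measurableT_comp _ _ _ _ R1 R (h k)) => //.
have mg2 k : @measurable_fun _ _ (R1 * R1)%type R Om (fun z => g k z.2).
  apply: measurable_funTS; apply: (@measurableT_comp _ _ _ _ R1 R (g k)) => //.
have Ifg l : lb2.-integrable Om (EFin \o (fun z => f z * g l z.2)).
  apply: (@le_integrable _ _ _ lb2 Om mO _ (fun z => (f z)%:E)) => //.
    by apply/measurable_EFinP; exact: measurable_funM.
  by move=> z _; rewrite /= lee_fin normrM ler_piMr.
have Ifhg k l : lb2.-integrable Om (EFin \o (fun z => f z * (h k z.1 * g l z.2))).
  apply: (@le_integrable _ _ _ lb2 Om mO _ (fun z => (f z)%:E)) => //.
    by apply/measurable_EFinP; do 2 apply: measurable_funM => //.
  by move=> z _; rewrite /= lee_fin !normrM ler_piMr// mulr_ile1.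
pose E l x := (\int[leb]_(y in Ib) (f (x, y) * g l y)%:E)%E.
have IE l : leb.-integrable Ia (E l) := integrable_fubini_rect1 (Ifg l).
have aeF := ae_filter_ringOfSetsType leb.
have aef := ae_integrable_rect1 If.
have EfinE l : {ae leb, forall x, Ia x -> E l x \is a fin_num} := integrable_ae mIa (IE l).
have IF l : leb.-integrable Ia (EFin \o (fine \o E l)).
  apply: (@le_integrable _ _ _ leb Ia mIa _ (E l)) => //.
    apply/measurable_EFinP; apply: (measurableT_comp (fine_measurable measurableT)) => //.
    exact: (measurable_int leb).
  by move=> x _ /=; case: (E l x) => //=; rewrite normr0 ?leey.
have EF0 k l : \int[leb]_(x in Ia) (fine (E l x) * h k x) = 0.
  have := f0 k l; rewrite /Rintegral (fubini_rect1 (Ifhg k l)) => <-; congr fine.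
  apply: ae_eq_integral => //.
  - apply/measurable_EFinP; apply: measurable_funM; last exact: measurable_funTS.
    by apply/measurable_EFinP; exact: (measurable_int leb (IF l)).
  - exact: (measurable_int leb (integrable_fubini_rect1 (Ifhg k l))).
  - apply: (@filterS2 _ _ aeF _ _ _ _ (ae_integrable_rect1 (Ifg l)) (EfinE l)) => x H1 H2 Ix.
    transitivity (\int[leb]_(y in Ib) ((h k x)%:E * (f (x, y) * g l y)%:E))%E.
      by rewrite integralZl ?H1// -/(E l x) -[in RHS](fineK (H2 Ix)) -EFinM mulrC.
    by apply: eq_integral => y _; rewrite -EFinM; congr EFin => /=; ring.
have aeE l : {ae leb, forall x, Ia x -> fine (E l x) = 0} by exact: (Ch (fine \o E l) (IF l) (fun k => EF0 k l)).
have aeEl : {ae leb, forall x, Ia x -> forall l, fine (E l x) = 0}.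
  have := ae_foralln aeE; apply: filterS => x H Ix l; exact: H.
have aeEf : {ae leb, forall x, Ia x -> forall l, E l x \is a fin_num}.
  have := ae_foralln EfinE; apply: filterS => x H Ix l; exact: H.
have aex : {ae leb, forall x, Ia x -> (\int[leb]_(y in Ib) `|(f (x, y))%:E| = 0)%E}.
  apply: (@filterS2 _ _ aeF _ _ _ _ aef aeEl) => x H1 H2 Ix.
  have H3 := Cg (fun y => f (x, y)) (H1 Ix) (H2 Ix).
  apply/(ae_eq_integral_abs leb mIb); first exact: (measurable_int leb (H1 Ix)).
  by apply: filterS H3 => y H3 Iy; congr EFin; exact: H3.
have If' : lb2.-integrable Om (EFin \o (fun z => `|f z|)) by exact: integrable_norm.
have : (\int[lb2]_(z in Om) `|(f z)%:E| = 0)%E.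
  rewrite (fubini_rect1 If').
  have -> : (\int[leb]_(x in Ia) \int[leb]_(y in Ib) (`|f (x, y)|)%:E =
     \int[leb]_(x in Ia) cst 0 x)%E; last by rewrite integral0.
  apply: ae_eq_integral => //; exact: (measurable_int leb (integrable_fubini_rect1 If')).
move/(ae_eq_integral_abs lb2 mO) => [|N [mN N0 H]]; first exact/measurable_EFinP.
exists N; split => // z Hz; apply: H => /= H; apply: Hz => Oz.
by have := H Oz => -[].
Qed.

End Completeness2.

(** * Potentials *)

Section RectL2.
Context (R : realType) (a b : R) (ha : 0 < a) (hb : 0 < b).
Local Notation leb := (@lebesgue_measure R).
Local Notation Om := (rectangle a b).
Local Notation lb2 := (leb \x leb)%E.
Local Notation R1 := (measurableTypeR R).
Local Notation II := (II a b).
Local Notation nn := (nn a b).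
Implicit Types e f p q s : tf R.

(** L^2 of the two-dimensional rectangle, not a Sobolev space of order two. *)
Definition H2 := L2 lb2 (@measurable_rect R a b).
Local Notation H := H2.
Definition ipH : H -> H -> R := @ip _ _ _ lb2 Om (@measurable_rect R a b).

Lemma ipH_inner : inner ipH. Proof. exact: ip_inner. Qed.
Lemma ipH_complete : complete_ip ipH. Proof. exact: ip_complete. Qed.

Definition te e : H := toL2 (@measurable_rect R a b) (sqint_ev ha hb e).

Lemma te_ext e f : (forall x y, ev e (x, y) = ev f (x, y)) -> te e = te f.
Proof. by move=> ef; apply/val_inj/funext => -[x y]; exact: ef. Qed.

Lemma te_add e f : te (AddT e f) = te e + te f.
Proof. exact/val_inj/funext. Qed.

Lemma te_scale r e : te (MulT (Cst r) e) = r *: te e.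
Proof. exact/val_inj/funext. Qed.

Lemma te_opp e : te (OppT e) = - te e.
Proof. by rewrite te_scale scaleN1r. Qed.

Lemma te_sub e f : te (SubT e f) = te e - te f.
Proof. by rewrite te_add te_opp. Qed.

Lemma ip_te e f : ipH (te e) (te f) = II (MulT e f). Proof. by []. Qed.

Lemma nsq_te e : ipH (te e) (te e) = nn e. Proof. by []. Qed.

Lemma nsq_te_sub e f : ipH (te e - te f) (te e - te f) = nn (SubT e f).
Proof. by rewrite -te_sub. Qed.

Lemma complete_H (h g : nat -> R -> R) (hT gT : nat -> tf R) (f : H) :
  complete_sys a h -> complete_sys b g ->
  (forall k, continuous (h k)) -> (forall k x, `|h k x| <= 1) ->
  (forall k, continuous (g k)) -> (forall k x, `|g k x| <= 1) ->
  (forall k z, ev (hT k) z = h k z.1) -> (forall k z, ev (gT k) z = g k z.2) ->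
  (forall k l, ipH f (te (MulT (hT k) (gT l))) = 0) -> ipH f f = 0.
Proof.
move=> Ch Cg ch h1 cg g1 hE gE f0.
have [_ mf _] := L2P f.
have If : lb2.-integrable Om (EFin \o f).
  have := integrable_ip f (te (Cst 1)); apply: eq_integrable.
    exact: measurable_rect.
  by move=> z _ /=; rewrite mulr1.
have := complete_rect Ch Cg ch h1 cg g1 If.
move=> H0; have {}H0 : {ae lb2, forall z, Om z -> f z = 0}.
  apply: H0 => k l; rewrite -[RHS](f0 k l); apply: eq_Rintegral => z _.
  by rewrite /= hE gE.
apply: EFin_inj; rewrite nsqE.
rewrite (_ : 0%:E = (\int[lb2]_(x in Om) (cst 0%E x))%E); last by rewrite integral0.
have mO : measurable (Om : set (R1 * R1)) by exact: measurable_rect.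
apply: ae_eq_integral => //; first exact: (measurable_int lb2 (integrable_nsq f)).
by apply: (@filterS _ _ (ae_filter_ringOfSetsType lb2)) H0 => z H0 Oz; rewrite H0// expr0n.
Qed.

Definition linX := MulT (Cst (pi / a)) (AddT VX (Cst (a / 2))).
Definition linY := MulT (Cst (pi / b)) (AddT VY (Cst (b / 2))).
Definition ckT k := CosT (MulT (Cst k%:R) linX).
Definition skT k := SinT (MulT (Cst k%:R) linX).
Definition cT l := CosT (MulT (Cst (l%:R + 2^-1)) linY).
Definition sT l := SinT (MulT (Cst (l%:R + 2^-1)) linY).
Definition kap k : R := k%:R * (pi / a).
Definition alp l : R := (l%:R + 2^-1) * (pi / b).

Lemma tau_end c : 0 < c -> tau c (c / 2) = pi :> R.
Proof. by move=> c0; rewrite /tau -splitr divfK// gt_eqF. Qed.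

Lemma tau_start c : tau c (- c / 2) = 0 :> R.
Proof. by rewrite /tau mulNr addNr mulr0. Qed.

Lemma sin_natpi k : sin (k%:R * pi) = 0 :> R.
Proof.
elim: k => [|k IH]; first by rewrite mul0r sin0.
by rewrite -natr1 mulrDl mul1r sinD IH sinpi mul0r mulr0 addr0.
Qed.

Lemma cos_halfpi l : cos ((l%:R + 2^-1) * pi) = 0 :> R.
Proof.
rewrite mulrDl cosD sin_natpi mul0r subr0 [2^-1 * _]mulrC.
by rewrite cos_pihalf mulr0.
Qed.

Lemma skT_R k y : ev (skT k) (a / 2, y) = 0.
Proof. by rewrite -[LHS]/(sin (_ * tau a (a / 2))) tau_end// sin_natpi. Qed.

Lemma skT_L k y : ev (skT k) (- a / 2, y) = 0.
Proof. by rewrite -[LHS]/(sin (_ * tau a (- a / 2))) tau_start mulr0 sin0. Qed.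

Lemma cT_T l x : ev (cT l) (x, b / 2) = 0.
Proof. by rewrite -[LHS]/(cos (_ * tau b (b / 2))) tau_end// cos_halfpi. Qed.

Lemma sT_B l x : ev (sT l) (x, - b / 2) = 0.
Proof. by rewrite -[LHS]/(sin (_ * tau b (- b / 2))) tau_start mulr0 sin0. Qed.

Lemma dx_ckT k z : ev (dx (ckT k)) z = - kap k * ev (skT k) z.
Proof. by rewrite /= /kap; ring. Qed.
Lemma dx_skT k z : ev (dx (skT k)) z = kap k * ev (ckT k) z.
Proof. by rewrite /= /kap; ring. Qed.
Lemma dy_ckT k z : ev (dy (ckT k)) z = 0. Proof. by rewrite /=; ring. Qed.
Lemma dy_skT k z : ev (dy (skT k)) z = 0. Proof. by rewrite /=; ring. Qed.
Lemma dx_cT l z : ev (dx (cT l)) z = 0. Proof. by rewrite /=; ring. Qed.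
Lemma dx_sT l z : ev (dx (sT l)) z = 0. Proof. by rewrite /=; ring. Qed.
Lemma dy_cT l z : ev (dy (cT l)) z = - alp l * ev (sT l) z.
Proof. by rewrite /= /alp; ring. Qed.
Lemma dy_sT l z : ev (dy (sT l)) z = alp l * ev (cT l) z.
Proof. by rewrite /= /alp; ring. Qed.

Lemma alp_gt0 l : 0 < alp l.
Proof. by rewrite /alp mulr_gt0 ?divr_gt0 ?pi_gt0// ltr_wpDl. Qed.

(* [u] and [v] are the cosine and sine half-integer systems, in either order;
   [u l] vanishes on the side [y = w] and [v l] on the side [y = - w]. *)
Record half_pair (u v : nat -> tf R) (be : nat -> R) (w : R) : Prop := HalfPair {
  hp_w : w = b / 2 \/ w = - b / 2;
  hp_be : forall l, be l != 0;
  hp_be2 : forall l, be l ^+ 2 = alp l ^+ 2;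
  hp_dxu : forall l z, ev (dx (u l)) z = 0;
  hp_dxv : forall l z, ev (dx (v l)) z = 0;
  hp_dyu : forall l z, ev (dy (u l)) z = - be l * ev (v l) z;
  hp_dyv : forall l z, ev (dy (v l)) z = be l * ev (u l) z;
  hp_u0 : forall l x, ev (u l) (x, w) = 0;
  hp_v0 : forall l x, ev (v l) (x, - w) = 0;
  hp_cu : forall f : H, (forall k l, ipH f (te (MulT (ckT k) (u l))) = 0) -> ipH f f = 0;
  hp_su : forall f : H, (forall k l, ipH f (te (MulT (skT k.+1) (u l))) = 0) -> ipH f f = 0;
  hp_cv : forall f : H, (forall k l, ipH f (te (MulT (ckT k) (v l))) = 0) -> ipH f f = 0 }.

Lemma half_pair_cs : half_pair cT sT alp (b / 2).
Proof.
have cc := complete_cos ha; have cs := complete_sin ha.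
have dc := complete_coshalf hb; have ds := complete_sinhalf hb.
split => //; try by left.
- by move=> l; rewrite gt_eqF// alp_gt0.
- exact: dx_cT.
- exact: dx_sT.
- exact: dy_cT.
- exact: dy_sT.
- exact: cT_T.
- by move=> l x; rewrite -mulNr; exact: sT_B.
- move=> f; apply: (complete_H cc dc) => //; try (by move=> *; exact: cos_normle1);
    by move=> *; exact: continuous_cosM.
- move=> f; apply: (complete_H (hT := fun k => skT k.+1) cs dc) => //;
    try (by move=> *; exact: cos_normle1); try (by move=> *; exact: sin_normle1);
    by move=> *; try exact: continuous_cosM; try exact: continuous_sinM.
- move=> f; apply: (complete_H cc ds) => //; 
    try (by move=> *; exact: cos_normle1); try (by move=> *; exact: sin_normle1);
    by move=> *; try exact: continuous_cosM; try exact: continuous_sinM.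
Qed.

Lemma half_pair_sc : half_pair sT cT (fun l => - alp l) (- b / 2).
Proof.
have cc := complete_cos ha; have cs := complete_sin ha.
have dc := complete_coshalf hb; have ds := complete_sinhalf hb.
split => //; try by right.
- by move=> l; rewrite oppr_eq0 gt_eqF// alp_gt0.
- by move=> l; rewrite sqrrN.
- exact: dx_sT.
- exact: dx_cT.
- by move=> l z; rewrite opprK; exact: dy_sT.
- exact: dy_cT.
- exact: sT_B.
- by move=> l x; rewrite mulNr opprK; exact: cT_T.
- move=> f; apply: (complete_H cc ds) => //;
    try (by move=> *; exact: cos_normle1); try (by move=> *; exact: sin_normle1);
    by move=> *; try exact: continuous_cosM; try exact: continuous_sinM.
- move=> f; apply: (complete_H (hT := fun k => skT k.+1) cs ds) => //;
    try (by move=> *; exact: cos_normle1); try (by move=> *; exact: sin_normle1);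
    by move=> *; try exact: continuous_cosM; try exact: continuous_sinM.
- move=> f; apply: (complete_H cc dc) => //; 
    try (by move=> *; exact: cos_normle1); try (by move=> *; exact: sin_normle1);
    by move=> *; try exact: continuous_cosM; try exact: continuous_sinM.
Qed.


(** The integrand is a Jacobian, hence the divergence of [(f q_y, - f q_x)]. Its flux vanishes
    through [f] on [y = w], and through the tangential derivative of [q] on the other three
    sides. *)
Lemma II_rot_grad f q w : w = b / 2 \/ w = - b / 2 ->
  (forall x, ev f (x, w) = 0) -> (forall x, ev q (x, - w) = 0) ->
  (forall y, ev q (a / 2, y) = 0) -> (forall y, ev q (- a / 2, y) = 0) ->
  II (SubT (MulT (dx f) (dy q)) (MulT (dy f) (dx q))) = 0.
Proof.
move=> wE f0 q0 qR qL.
rewrite (@eq_II _ a b _ (SubT (dx (MulT f (dy q))) (dy (MulT f (dx q))))); last first.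
  by move=> x y; rewrite /= ev_dxdy; ring.
rewrite (II_sub ha hb) (II_dx ha hb) (II_dy ha hb).
rewrite (Sy0 hb) => [|y]; last by rewrite /= (dy_ext0 qR) mulr0.
rewrite (Sy0 hb) => [|y]; last by rewrite /= (dy_ext0 qL) mulr0.
have F (x : R) : ev f (x, w) * ev (dx q) (x, w) = 0 by rewrite f0 mul0r.
have G (x : R) : ev f (x, - w) * ev (dx q) (x, - w) = 0 by rewrite (dx_ext0 q0) mulr0.
case: wE => wE; rewrite {}wE in F G *.
  rewrite (Sx0 ha) => [|x]; last exact: F.
  rewrite (Sx0 ha) => [|x]; last by rewrite mulNr; exact: G.
  by rewrite !subrr.
rewrite (Sx0 ha) => [|x]; last by have := G x; rewrite mulNr opprK.
rewrite (Sx0 ha) => [|x]; last exact: F.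
by rewrite !subrr.
Qed.

(** The sign of the second component is the one dictated by orthogonality to the range of [K]. *)
Definition graph_rot (f : tf R) : H * H := (te (dx f), te (OppT (dy f))).

Lemma graph_rot_lin k f g :
  graph_rot (AddT (MulT (Cst k) f) g) = k *: graph_rot f + graph_rot g.
Proof.
transitivity (k *: te (dx f) + te (dx g), k *: te (OppT (dy f)) + te (OppT (dy g))) => //.
by rewrite /graph_rot -!te_scale -!te_add; congr pair; apply: te_ext => x y /=; ring.
Qed.

(** A Poincare lemma in L^2. The part of [(w1, w2)] orthogonal to the space of [graph_rot] is also
    orthogonal to the rotated gradients; testing it with product modes gives a regular 2 by 2 system
    for each pair of frequencies, so it is null by completeness. *)
Lemma potential u v be w (w1 w2 : H) : half_pair u v be w ->
  (forall q, (forall x, ev q (x, - w) = 0) -> (forall y, ev q (a / 2, y) = 0) ->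
     (forall y, ev q (- a / 2, y) = 0) -> ipH w1 (te (dy q)) + ipH w2 (te (dx q)) = 0) ->
  exists f : nat -> tf R, [/\ forall n x, ev (f n) (x, w) = 0,
    cvg_ip ipH (fun n => te (dx (f n))) w1 &
    cvg_ip ipH (fun n => te (OppT (dy (f n)))) w2].
Proof.
move=> hp w0.
have I := inner_ip2 ipH_inner ipH_inner.
have cI := complete_ip2 ipH_inner ipH_inner ipH_complete ipH_complete.
pose U (m : H * H) := exists2 f, (forall x, ev f (x, w) = 0) & m = graph_rot f.
have HU : subspace U.
  split; first by exists (Cst 0) => //; congr pair; apply/val_inj/funext => z /=; rewrite ?mulr0.
  move=> k _ _ [f f0 ->] [g g0 ->]; exists (AddT (MulT (Cst k) f) g).
    by move=> x; rewrite /= f0 g0 mulr0 addr0.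
  exact/esym/graph_rot_lin.
have [um [[m1 m2] [Um umc mo]]] := projection I (w1, w2) cI HU.
have /choice[f Hf] : forall n, exists f, (forall x, ev f (x, w) = 0) /\ um n = graph_rot f.
  by move=> n; have [f f0 E] := Um n; exists f.
have [c1 c2] := (cvg_ip2 um (m1, m2) ipH_inner ipH_inner).1 umc.
have mq q : (forall x, ev q (x, - w) = 0) -> (forall y, ev q (a / 2, y) = 0) ->
     (forall y, ev q (- a / 2, y) = 0) -> ipH m1 (te (dy q)) + ipH m2 (te (dx q)) = 0.
  move=> q0 qR qL.
  have L1 := cvg_ip_ip ipH_inner (w := te (dy q)) c1.
  have L2 := cvg_ip_ip ipH_inner (w := te (dx q)) c2.
  have : (fun n => ipH (um n).1 (te (dy q)) + ipH (um n).2 (te (dx q))) @ \oo -->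
    ipH m1 (te (dy q)) + ipH m2 (te (dx q)) by exact: cvgD L1 L2.
  rewrite (_ : (fun n => _) = fun=> 0); last first.
    apply/funext => n /=; have [f0 ->] := Hf n.
    rewrite !ip_te -(II_add ha hb) -[RHS](II_rot_grad (hp_w hp) f0 q0 qR qL).
    by apply: eq_II => x y /=; ring.
  exact: cvg_cst_eq.
pose d1 := w1 - m1; pose d2 := w2 - m2.
have dq q : (forall x, ev q (x, - w) = 0) -> (forall y, ev q (a / 2, y) = 0) ->
     (forall y, ev q (- a / 2, y) = 0) -> ipH d1 (te (dy q)) + ipH d2 (te (dx q)) = 0.
  move=> q0 qR qL; rewrite !(ipBl ipH_inner).
  by have := mq q q0 qR qL; have := w0 q q0 qR qL; lra.
have df g : (forall x, ev g (x, w) = 0) -> ipH d1 (te (dx g)) + ipH d2 (te (OppT (dy g))) = 0.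
  by move=> g0; apply: (mo (graph_rot g)); exists g.
have key k l : ipH d1 (te (MulT (skT k) (u l))) = 0 /\ ipH d2 (te (MulT (ckT k) (v l))) = 0.
  set A := ipH d1 _; set B := ipH d2 _.
  have E1 : - kap k * A + be l * B = 0.
    have := df (MulT (ckT k) (u l)).
    rewrite (@te_ext (dx _) (MulT (Cst (- kap k)) (MulT (skT k) (u l)))); last first.
      by move=> x y; rewrite ev_dx_mul dx_ckT (hp_dxu hp) !ev_mul ev_cst; ring.
    rewrite (@te_ext (OppT _) (MulT (Cst (be l)) (MulT (ckT k) (v l)))); last first.
      by move=> x y; rewrite ev_opp ev_dy_mul dy_ckT (hp_dyu hp) !ev_mul ev_cst; ring.
    rewrite !te_scale !(ipZr ipH_inner); apply => x.
    by rewrite ev_mul (hp_u0 hp) mulr0.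
  have E2 : be l * A + kap k * B = 0.
    have := dq (MulT (skT k) (v l)).
    rewrite (@te_ext (dx _) (MulT (Cst (kap k)) (MulT (ckT k) (v l)))); last first.
      by move=> x y; rewrite ev_dx_mul dx_skT (hp_dxv hp) !ev_mul ev_cst; ring.
    rewrite (@te_ext (dy _) (MulT (Cst (be l)) (MulT (skT k) (u l)))); last first.
      by move=> x y; rewrite ev_dy_mul dy_skT (hp_dyv hp) !ev_mul ev_cst; ring.
    rewrite !te_scale !(ipZr ipH_inner); apply => x; rewrite ev_mul.
    - by rewrite (hp_v0 hp) mulr0.
    - by rewrite skT_R mul0r.
    - by rewrite skT_L mul0r.
  (* The determinant up to sign; it is positive even for [k = 0], since half-integer frequencies
     never vanish. *)
  have D0 : kap k ^+ 2 + be l ^+ 2 != 0.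
    by rewrite gt_eqF// ltr_wpDl ?sqr_ge0// exprn_even_gt0//= (hp_be hp).
  split; apply/eqP; rewrite -(mulrI_eq0 _ (mulfI D0)); apply/eqP.
    rewrite (_ : _ * A = be l * (be l * A + kap k * B) - kap k * (- kap k * A + be l * B)); last by ring.
    by rewrite E1 E2 !mulr0 subr0.
  rewrite (_ : _ * B = kap k * (be l * A + kap k * B) + be l * (- kap k * A + be l * B)); last by ring.
  by rewrite E1 E2 !mulr0 addr0.
have d10 : ipH d1 d1 = 0 by apply: (hp_su hp) => k l; have [] := key k.+1 l.
have d20 : ipH d2 d2 = 0 by apply: (hp_cv hp) => k l; have [] := key k l.
exists f; split.
- by move=> n; have [] := Hf n.
- apply: (cvg_ip_shift ipH_inner _ d10).
  rewrite (_ : (fun n => te _) = fun n => (um n).1); first exact: c1.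
  by apply/funext => n; rewrite (Hf n).2.
- apply: (cvg_ip_shift ipH_inner _ d20).
  rewrite (_ : (fun n => te _) = fun n => (um n).2); first exact: c2.
  by apply/funext => n; rewrite (Hf n).2.
Qed.

End RectL2.

(** * Density of the range of the massless operator *)

Section Cokernel.
Context (R : realType) (a b : R) (ha : 0 < a) (hb : 0 < b).
Local Notation leb := (@lebesgue_measure R).
Local Notation R1 := (measurableTypeR R).
Local Notation II := (II a b).
Local Notation Sy := (Sy b).
Local Notation nn := (nn a b).
Local Notation H := (H2 a b).
Local Notation ipH := (@ipH R a b).
Local Notation te := (te ha hb).
Implicit Types (e : bool) (s : side) (f g p q : tf R).

Lemma measurable_side s : measurable (side_dom a b s : set R1).
Proof. by case: s; exact: measurable_itv. Qed.

Definition Sd s f := \int[leb]_(t in side_dom a b s) ev f (side_pt a b s t).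

Lemma integrable_side s f :
  leb.-integrable (side_dom a b s) (fun t => (ev f (side_pt a b s t))%:E).
Proof. by case: s; try exact: integrable_ev_x; exact: integrable_ev_y. Qed.

Lemma measurable_ev_side s f :
  @measurable_fun _ _ R1 R setT (fun t => ev f (side_pt a b s t)).
Proof. by case: s; try exact: measurable_ev_x; exact: measurable_ev_y. Qed.

Lemma sqint_side s f : sqint leb (side_dom a b s) (fun t => ev f (side_pt a b s t)).
Proof.
split; [exact: measurable_side|exact: measurable_ev_side|].
exact: (integrable_side s (MulT f f)).
Qed.

Definition G1 s := L2 leb (measurable_side s).
Definition ipG s : G1 s -> G1 s -> R := @ip _ _ _ leb _ (measurable_side s).
Definition trs s f : G1 s := toL2 (measurable_side s) (sqint_side s f).

Lemma ipG_inner s : inner (@ipG s). Proof. exact: ip_inner. Qed.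
Lemma ipG_complete s : complete_ip (@ipG s). Proof. exact: ip_complete. Qed.

Lemma trs_sub s f g : trs s (SubT f g) = trs s f - trs s g.
Proof. by apply/val_inj/funext => t /=; rewrite mulN1r. Qed.

Lemma trs_scale s r f : trs s (MulT (Cst r) f) = r *: trs s f.
Proof. exact/val_inj/funext. Qed.

Lemma ip_trs s f g : ipG (trs s f) (trs s g) = Sd s (MulT f g).
Proof. by []. Qed.

(** The vertical sides are indexed by booleans, so that right and left share one proof: [eb] is the
    sign of the outward normal, [xb] the abscissa. *)
Definition eb (e : bool) : R := if e then 1 else -1.
Definition sb (e : bool) : side := if e then Right else Left.
Definition xb (e : bool) : R := if e then a / 2 else - a / 2.

Lemma ebE e : eb e = 1 \/ eb e = -1.
Proof. by case: e; [left|right]. Qed.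

Lemma eb2 e : eb e * eb e = 1.
Proof. by case: e; rewrite /eb ?mulr1// mulrNN mulr1. Qed.

Lemma Sd_sb e f : Sd (sb e) f = Sy f (xb e). Proof. by case: e. Qed.

Lemma sb2 e t : (side_pt a b (sb e) t).2 = t. Proof. by case: e. Qed.

Lemma sgn_sideE e : sgn_side a (eb e) = xb e.
Proof. by case: e; rewrite /sgn_side/eb ?mul1r// mulN1r. Qed.

Lemma sgn_sideN e : - xb e = xb (~~ e).
Proof. by case: e; rewrite /xb/= mulNr// opprK. Qed.

Lemma II_dx_eb e f : (forall y, ev f (xb (~~ e), y) = 0) ->
  II (dx f) = eb e * Sy f (xb e).
Proof.
move=> f0; have := @II_dx_side _ _ _ ha hb _ (ebE e) f.
rewrite sgn_sideE sgn_sideN => /(_ f0) <-.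
by rewrite mulrA eb2 mul1r.
Qed.

Lemma ev_xi_side e y : ev (xi a (eb e)) (xb e, y) = 1.
Proof. by rewrite -sgn_sideE xi_side//; exact: ebE. Qed.

Lemma ev_xi_opp e y : ev (xi a (eb e)) (xb (~~ e), y) = 0.
Proof. by rewrite -sgn_sideN -sgn_sideE xi_opp//; exact: ebE. Qed.

Lemma bc_side e p q :
  (forall x, ev p (x, b / 2) = 0) -> (forall x, ev q (x, - b / 2) = 0) ->
  (forall y, ev p (xb (~~ e), y) = 0) -> (forall y, ev q (xb (~~ e), y) = 0) ->
  (forall y, ev q (xb e, y) = - eb e * ev p (xb e, y)) -> bc a b p q.
Proof.
case: e; rewrite /xb /eb /= => pT qB p0 q0 pq; split => // y.
- by rewrite pq mulN1r.
- by rewrite p0 q0.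
- by rewrite p0 q0 oppr0.
- by rewrite pq opprK mul1r.
Qed.

Definition cosY j := CosT (MulT (Cst j%:R) (linY b)).
Definition sinY j := SinT (MulT (Cst j%:R) (linY b)).

Lemma dy_sinY j z : ev (dy (sinY j)) z = j%:R * (pi / b) * ev (cosY j) z.
Proof. by rewrite /=; ring. Qed.

Lemma sinY_T j x : ev (sinY j) (x, b / 2) = 0.
Proof. by rewrite -[LHS]/(sin (_ * tau b (b / 2))) tau_end// sin_natpi. Qed.

Lemma sinY_B j x : ev (sinY j) (x, - b / 2) = 0.
Proof. by rewrite -[LHS]/(sin (_ * tau b (- b / 2))) tau_start mulr0 sin0. Qed.

Lemma complete_cosY e (l : G1 (sb e)) :
  (forall j, ipG l (trs (sb e) (cosY j)) = 0) -> ipG l l = 0.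
Proof.
move=> l0.
have mI := measurable_side (sb e).
have Il : leb.-integrable (side_dom a b (sb e)) (EFin \o l).
  have := integrable_ip l (trs (sb e) (Cst 1)); apply: eq_integrable => //.
  by move=> t _ /=; rewrite mulr1.
have dE : side_dom a b (sb e) = (`]- b / 2, b / 2[%classic : set R) by case: (e).
have H0 : {ae leb, forall t, side_dom a b (sb e) t -> l t = 0}.
  have := @complete_cos R b hb (l : R -> R); rewrite -dE; apply => // j.
  rewrite -[RHS](l0 j); apply: eq_Rintegral => t _; congr (_ * _).
  by rewrite /= sb2.
apply: EFin_inj; rewrite nsqE.
rewrite (_ : 0%:E = (\int[leb]_(x in side_dom a b (sb e)) (cst 0%E x))%E); last by rewrite integral0.
apply: ae_eq_integral => //; first exact: (measurable_int leb (integrable_nsq l)).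
by apply: (@filterS _ _ (ae_filter_ringOfSetsType leb)) H0 => t H0 It; rewrite H0// expr0n.
Qed.

Section Potentials.
Variables (w1 w2 : H) (phi psi : nat -> tf R).
Hypothesis phiT : forall n x, ev (phi n) (x, b / 2) = 0.
Hypothesis psiB : forall n x, ev (psi n) (x, - b / 2) = 0.
Hypothesis phix : cvg_ip ipH (fun n => te (dx (phi n))) w1.
Hypothesis phiy : cvg_ip ipH (fun n => te (OppT (dy (phi n)))) w2.
Hypothesis psix : cvg_ip ipH (fun n => te (dx (psi n))) w2.
Hypothesis psiy : cvg_ip ipH (fun n => te (OppT (dy (psi n)))) (- w1).

(** The amount by which [(phi n, - psi n)] violates the boundary condition on the side [sb e]. *)
Definition jump e n := SubT (phi n) (MulT (Cst (eb e)) (psi n)).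

Lemma pairing_side e p q :
  (forall x, ev p (x, b / 2) = 0) -> (forall x, ev q (x, - b / 2) = 0) ->
  (forall y, ev p (xb (~~ e), y) = 0) -> (forall y, ev q (xb (~~ e), y) = 0) ->
  (forall y, ev (dy q) (xb e, y) = - eb e * ev (dy p) (xb e, y)) ->
  (fun n => Sy (MulT (jump e n) (dy p)) (xb e)) @ \oo -->
  ipH w1 (te (k1 p q)) + ipH w2 (te (k2 p q)).
Proof.
move=> pT qB p0 q0 dpq.
have I := ipH_inner a b.
(* Derivatives of [p] are paired with [psi] and derivatives of [q] with [phi]. Each integrand then
   becomes a Jacobian, and the horizontal sides drop out as [psi] and [q] vanish on the bottom,
   [phi] and [p] on the top. *)
have -> : ipH w1 (te (k1 p q)) + ipH w2 (te (k2 p q)) =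
    (- ipH (- w1) (te (dx p)) - ipH w2 (te (dy p))) - (ipH w1 (te (dy q)) + ipH w2 (te (dx q))).
  by rewrite /k1 /k2 te_sub te_opp te_add (ipNl I) (ipBr I) (ipNr I) (ipDr I); ring.
have -> : (fun n => Sy (MulT (jump e n) (dy p)) (xb e)) = fun n =>
   (- ipH (te (OppT (dy (psi n)))) (te (dx p)) - ipH (te (dx (psi n))) (te (dy p))) -
   (ipH (te (dx (phi n))) (te (dy q)) + ipH (te (OppT (dy (phi n)))) (te (dx q))).
  apply/funext => n; rewrite !ip_te -mulN1r -(II_scale ha hb) -!(II_add ha hb, II_sub ha hb).
  pose B := AddT (MulT (psi n) (dx p)) (MulT (phi n) (dx q)).
  pose C := AddT (MulT (psi n) (dy p)) (MulT (phi n) (dy q)).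
  rewrite (@eq_II _ a b _ (SubT (dy B) (dx C))); last first.
    by move=> x y; rewrite /= !ev_dxdy; ring.
  rewrite (II_sub ha hb) (II_dy ha hb) (@II_dx_eb e); last first.
    by move=> y; rewrite /= (dy_ext0 p0) (dy_ext0 q0) !mulr0 addr0.
  rewrite (Sx0 ha) => [|x]; last by rewrite /= phiT (dx_ext0 pT) mulr0 mul0r addr0.
  rewrite (Sx0 ha) => [|x]; last by rewrite /= psiB (dx_ext0 qB) mulr0 mul0r addr0.
  rewrite subrr sub0r -mulNr -(Sy_scale hb); apply: eq_Sy => y.
  rewrite /jump /C /= dpq; set u := ev (phi n) _; set v := ev (psi n) _; set t := ev (dy p) _.
  have -> : - eb e * (v * t + u * (- eb e * t)) = - eb e * v * t + eb e * eb e * u * t by ring.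
  by rewrite eb2; ring.
apply: cvgB.
  apply: cvgB; last exact: cvg_ip_ip.
  by apply: cvgN; exact: cvg_ip_ip.
by apply: cvgD; exact: cvg_ip_ip.
Qed.

Lemma cauchy_zero_side (f : nat -> tf R) (w : R) (l : H) :
  w = b / 2 \/ w = - b / 2 -> (forall n x, ev (f n) (x, w) = 0) ->
  cvg_ip ipH (fun n => te (OppT (dy (f n)))) l -> cauchy_ip ipH (fun n => te (f n)).
Proof.
move=> wE f0 /(cvg_ip_cauchy (ipH_inner a b)) cf e e0.
have c0 : 0 < 4 * b ^+ 2 by rewrite mulr_gt0 ?exprn_gt0.
have [N HN] := cf (e / (4 * b ^+ 2)) (divr_gt0 e0 c0).
exists N => i j Ni Nj; rewrite nsq_te_sub.
have := HN i j Ni Nj; rewrite nsq_te_sub ler_pdivlMr// mulrC; apply: le_trans.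
apply: (le_trans (poincare ha hb wE _)) => [x|]; first by rewrite /= !f0; ring.
rewrite ler_wpM2l ?(ltW c0)// le_eqVlt; apply/orP; left; apply/eqP.
by apply: eq_II => x y /=; ring.
Qed.

(** Convergence of the gradients gives convergence of the potentials by [poincare], and [side_le]
    passes it on to the side. *)
Lemma cauchy_jump e : cauchy_ip (@ipG (sb e)) (fun n => trs (sb e) (jump e n)).
Proof.
have I := ipH_inner a b.
have C0 := cvg_ip_cauchy I phix; have C1 := cvg_ip_cauchy I psix.
have C2 := cauchy_zero_side (or_introl erefl) phiT phiy.
have C3 := cauchy_zero_side (or_intror erefl) psiB psiy.
move=> d d0; pose K := 4 * (a^-1 + 1 + 1).
have K0 : 0 < K by rewrite mulr_gt0// !addr_gt0// invr_gt0.
have dK : 0 < d / K by rewrite divr_gt0.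
have [N0 H0] := C0 _ dK; have [N1 H1] := C1 _ dK.
have [N2 H2] := C2 _ dK; have [N3 H3] := C3 _ dK.
exists (maxn (maxn N0 N1) (maxn N2 N3)) => i j; rewrite !geq_max.
move=> /andP[/andP[i0 i1] /andP[i2 i3]] /andP[/andP[j0 j1] /andP[j2 j3]].
rewrite -trs_sub ip_trs Sd_sb -sgn_sideE.
apply: (le_trans (side_le ha hb (ebE e) _)).
set u := SubT (phi i) (phi j); set v := MulT (Cst (- eb e)) (SubT (psi i) (psi j)).
have nv : nn v = nn (SubT (psi i) (psi j)).
  apply: eq_II => x y; rewrite /v ![LHS]/= mulrACA mulrNN eb2 mul1r //.
have nvx : nn (dx v) = nn (SubT (dx (psi i)) (dx (psi j))).
  apply: eq_II => x y; rewrite /v [LHS]/= !mul0r !add0r mulrACA mulrNN eb2 mul1r; rewrite /=; ring.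
have E0 : nn (SubT (jump e i) (jump e j)) <= 2 * nn u + 2 * nn v.
  rewrite (_ : nn (SubT _ _) = nn (AddT u v)); first exact: nn_add_le.
  by apply: eq_II => x y; rewrite /jump /u /v /=; ring.
have E1 : nn (dx (SubT (jump e i) (jump e j))) <= 2 * nn (SubT (dx (phi i)) (dx (phi j))) + 2 * nn (dx v).
  rewrite (_ : nn (dx _) = nn (AddT (SubT (dx (phi i)) (dx (phi j))) (dx v))); first exact: nn_add_le.
  by apply: eq_II => x y; rewrite /jump /v /=; ring.
have := H0 i j i0 j0; have := H1 i j i1 j1; have := H2 i j i2 j2; have := H3 i j i3 j3.
rewrite !nsq_te_sub -nv -nvx -/u => h3 h2 h1 h0.
have a1 : 0 <= a^-1 + 1 by rewrite addr_ge0// invr_ge0 ltW.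
apply: (@le_trans _ _ ((a^-1 + 1) * (2 * (d / K) + 2 * (d / K)) + (2 * (d / K) + 2 * (d / K)))).
  apply: lerD; last by lra.
  by apply: ler_wpM2l => //; lra.
rewrite le_eqVlt; apply/orP; left; apply/eqP; rewrite /K; field.
by rewrite !gt_eqF// ?addr_gt0 ?invr_gt0//.
Qed.

Hypothesis ortho : forall p q, bc a b p q ->
  ipH w1 (te (k1 p q)) + ipH w2 (te (k2 p q)) = 0.

(** The pairs [p = xi * sin], [q = - eb e * p] satisfy all boundary conditions, so orthogonality
    makes every non-constant cosine coefficient of the limiting jump vanish. *)
Lemma jump_const e : exists c,
  (fun n => Sy (sqT (SubT (jump e n) (Cst c))) (xb e)) @ \oo --> (0 : R).
Proof.
have [l Hl] := ipG_complete (cauchy_jump e).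
have I := ipG_inner (sb e).
have lj j : ipG l (trs (sb e) (cosY j.+1)) = 0.
  pose p := MulT (xi a (eb e)) (sinY j.+1); pose q := MulT (Cst (- eb e)) p.
  have pT x : ev p (x, b / 2) = 0 by rewrite /p ev_mul sinY_T mulr0.
  have pB x : ev p (x, - b / 2) = 0 by rewrite /p ev_mul sinY_B mulr0.
  have qB x : ev q (x, - b / 2) = 0 by rewrite /q ev_mul pB mulr0.
  have p0 y : ev p (xb (~~ e), y) = 0 by rewrite /p ev_mul ev_xi_opp mul0r.
  have q0 y : ev q (xb (~~ e), y) = 0 by rewrite /q ev_mul p0 mulr0.
  have pq y : ev q (xb e, y) = - eb e * ev p (xb e, y) by [].
  have dpq y : ev (dy q) (xb e, y) = - eb e * ev (dy p) (xb e, y).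
    by rewrite /q ev_dy_mul mul0r add0r.
  have := pairing_side pT qB p0 q0 dpq; rewrite (ortho (bc_side pT qB p0 q0 pq)).
  pose k : R := j.+1%:R * (pi / b).
  have kn : k != 0 by rewrite gt_eqF// mulr_gt0// divr_gt0 ?pi_gt0.
  rewrite (_ : (fun n => _) = fun n => k * ipG (trs (sb e) (jump e n)) (trs (sb e) (cosY j.+1))); last first.
    apply/funext => n; rewrite ip_trs Sd_sb -(Sy_scale hb); apply: eq_Sy => y.
    rewrite !ev_mul ev_cst /p ev_dy_mul dy_sinY ev_xi_side -/k.
    rewrite (_ : ev (dy (xi a (eb e))) _ = 0); last by rewrite /=; ring.
    by ring.
  move=> L0; have L1 : (fun n => k * ipG (trs (sb e) (jump e n)) (trs (sb e) (cosY j.+1))) @ \oo -->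
     k * ipG l (trs (sb e) (cosY j.+1)) by apply: cvgM; [exact: cvg_cst|exact: cvg_ip_ip].
  have /eqP := cvg_uniq L1 L0.
  by rewrite mulf_eq0 (negbTE kn)/= => /eqP.
pose one := trs (sb e) (Cst 1).
have one_one : ipG one one = b.
  rewrite ip_trs Sd_sb (@eq_Sy _ b _ (dy VY)) => [|y]; last by rewrite /= mulr1.
  by rewrite (Sy_dy hb) /=; field.
have one_cos j : ipG one (trs (sb e) (cosY j.+1)) = 0.
  have kn : j.+1%:R * (pi / b) != 0 by rewrite gt_eqF// mulr_gt0// divr_gt0 ?pi_gt0.
  apply: (mulfI kn); rewrite mulr0 ip_trs Sd_sb -(Sy_scale hb).
  rewrite (@eq_Sy _ b _ (dy (sinY j.+1))) => [|y]; last by rewrite dy_sinY !ev_mul !ev_cst mul1r.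
  by rewrite (Sy_dy hb) sinY_T sinY_B subrr.
pose c := ipG l one / b.
exists c.
have lc : ipG (l - c *: one) (l - c *: one) = 0.
  apply: complete_cosY => -[|j].
    have -> : trs (sb e) (cosY 0) = one.
      by apply/val_inj/funext => t; rewrite /= mul0r cos0.
    by rewrite (ipBl I) (ipZl I) one_one /c divfK ?subrr// gt_eqF.
  by rewrite (ipBl I) (ipZl I) lj one_cos mulr0 subrr.
apply: (@squeeze_cvgr _ _ _ _ (fun=> 0) (fun n => 2 * ipG (trs (sb e) (jump e n) - l) (trs (sb e) (jump e n) - l))).
- apply: nearW => n.
  have -> : Sy (sqT (SubT (jump e n) (Cst c))) (xb e) =
     ipG (trs (sb e) (jump e n) - c *: one) (trs (sb e) (jump e n) - c *: one).
    rewrite /one -trs_scale -trs_sub ip_trs Sd_sb; apply: eq_Sy => y.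
    by rewrite /=; ring.
  rewrite (ip_ge0 I) /=.
  have -> : trs (sb e) (jump e n) - c *: one = (trs (sb e) (jump e n) - l) + (l - c *: one).
    by rewrite addr_subK.
  by have := nsqD_le I (trs (sb e) (jump e n) - l) (l - c *: one); rewrite lc mulr0 addr0.
- exact: cvg_cst.
- by rewrite -[X in _ --> X](mulr0 2); apply: cvgM => //; exact: cvg_cst.
Qed.

End Potentials.
End Cokernel.

(** * Lifting the jumps and vanishing of the cokernel *)

Section CokernelTrivial.
Context (R : realType) (a b : R) (ha : 0 < a) (hb : 0 < b).
Local Notation leb := (@lebesgue_measure R).
Local Notation Om := (rectangle a b).
Local Notation lb2 := (leb \x leb)%E.
Local Notation R1 := (measurableTypeR R).
Local Notation II := (II a b).
Local Notation Sy := (Sy b).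
Local Notation nn := (nn a b).
Local Notation H := (H2 a b).
Local Notation ipH := (@ipH R a b).
Local Notation te := (te ha hb).
Local Notation eb := (@eb R).
Local Notation xb := (xb a).
Implicit Types (e : bool) (s : side) (f g p q : tf R).

Let mO : measurable (Om : set (R1 * R1)). Proof. exact: measurable_rect. Qed.

(** The squared norm of [xi ^+ (n + 1) * u]: as [n] grows it retains only a thin layer at the side
    [e]. *)
Definition JN e n (u : H) := \int[lb2]_(z in Om) (ev (powT (xi a (eb e)) n.+1.*2) z * u z ^+ 2).

Lemma xi_lt1 e x y : Om (x, y) -> 0 <= ev (xi a (eb e)) (x, y) < 1.
Proof.
move=> O; have /andP[-> _] := xi_01 ha (ebE R e) O; rewrite /=.
move: O => [/=+ _]; rewrite in_itv/= => /andP[x1 x2].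
have an : a != 0 by rewrite gt_eqF.
have -> : 2^-1 + eb e / a * x = (a / 2 + eb e * x) / a by field.
by rewrite ltr_pdivrMr// mul1r; case: e; rewrite /eb; lra.
Qed.

Lemma powT_xi_01 e k x y : Om (x, y) -> 0 <= ev (powT (xi a (eb e)) k) (x, y) <= 1.
Proof.
move=> /(xi_lt1 e)/andP[t0 /ltW t1].
by rewrite ev_powT exprn_ge0//= exprn_ile1.
Qed.

Lemma integrable_JN e n (u : H) :
  lb2.-integrable Om (EFin \o (fun z => ev (powT (xi a (eb e)) n.+1.*2) z * u z ^+ 2)).
Proof.
have [_ mu _] := L2P u.
apply: (@le_integrable _ _ _ lb2 Om mO _ (fun z => (u z ^+ 2)%:E)).
- apply/measurable_EFinP; apply: measurable_funM.
    by apply: measurable_funTS; exact: measurable_ev.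
  by apply: measurable_funTS; exact: measurable_funX.
- move=> [x y] /(powT_xi_01 e n.+1.*2); rewrite /comp.
  move: (ev (powT _ _) _) => t /andP[t0 t1] /=.
  by rewrite lee_fin normrM ler_piMl// ger0_norm.
- exact: integrable_nsq.
Qed.

Lemma JN_le e n (u v : H) : JN e n u <= 2 * JN e n v + 2 * ipH (u - v) (u - v).
Proof.
rewrite /JN /ipH /ip.
have I2 := integrable_JN e n v.
have I3 : lb2.-integrable Om (EFin \o (fun z => (u - v) z * (u - v) z)) := integrable_ip _ _.
rewrite -!RintegralZl// -RintegralD//; last 2 first.
- exact: (integrableZl mO 2 I2).
- exact: (integrableZl mO 2 I3).
apply: le_Rintegral => //.
- exact: integrable_JN.
- exact: (integrableD mO (integrableZl mO 2 I2) (integrableZl mO 2 I3)).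
move=> [x y] /(xi_lt1 e)/andP[t0 /ltW t1]; rewrite ev_powT.
have -> : (u - v) (x, y) = u (x, y) - v (x, y) by [].
set X := _ ^+ n.+1.*2; move: (u (x, y)) (v (x, y)) => r s.
have X0 : 0 <= X by rewrite exprn_ge0.
have X1 : X <= 1 by rewrite exprn_ile1.
have := sqr_ge0 (r - 2 * s); have := sqr_ge0 (r - s) => H1 H2.
have H3 : X * (r ^+ 2) <= X * (2 * s ^+ 2 + 2 * (r - s) ^+ 2).
  by rewrite ler_wpM2l//; lra.
have H4 : X * (r - s) ^+ 2 <= (r - s) ^+ 2 by rewrite ler_piMl.
lra.
Qed.

Lemma JN_te e n f : JN e n (te f) = II (MulT (powT (xi a (eb e)) n.+1.*2) (sqT f)).
Proof. by apply: eq_Rintegral => z _; rewrite /= expr2. Qed.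

(** Inside the open rectangle [xi < 1], so the weights tend to 0 pointwise and dominated convergence
    applies. *)
Lemma JN_cvg0 e (u : H) : (fun n => JN e n u) @ \oo --> (0 : R).
Proof.
have [_ mu _] := L2P u.
have := @dominated_convergence _ _ R lb2 Om mO
  (fun n z => (ev (powT (xi a (eb e)) n.+1.*2) z * u z ^+ 2)%:E) (cst 0%E)
  (fun z => (u z ^+ 2)%:E).
case=> [n|||||_ _].
- by have := measurable_int lb2 (integrable_JN e n u).
- exact: measurable_cst.
- apply: aeW => -[x y] /(xi_lt1 e)/andP[t0 t1].
  apply: cvg_EFin; first exact: nearW.
  set t := ev _ _ in t0 t1.
  rewrite (_ : fine \o _ = fun n => (t ^+ 2) ^+ n * t ^+ 2 * u (x, y) ^+ 2); last first.
    by apply/funext => n; rewrite /comp /fine ev_powT -/t -exprSr -exprM mul2n.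
  rewrite -[X in _ --> X](mul0r (u (x, y) ^+ 2)); apply: cvgM; last exact: cvg_cst.
  rewrite -[X in _ --> X](mul0r (t ^+ 2)); apply: cvgM; last exact: cvg_cst.
  by apply: cvg_expr; rewrite ger0_norm ?exprn_ge0// exprn_ilt1.
- exact: integrable_nsq.
- apply: aeW => -[x y] n /(powT_xi_01 e n.+1.*2).
  move: (ev (powT _ _) _) => t /andP[t0 t1] /=.
  by rewrite lee_fin normrM (ger0_norm t0) (ger0_norm (sqr_ge0 _)) ler_piMl// sqr_ge0.
rewrite integral0 => Hc; apply: fine_cvg.
exact: Hc.
Qed.

(** Differentiating the weight costs [(N / a) ^+ 2] times the integral of [xi ^+ (2 n) * f^2], which
    Hardy's inequality trades for the side norm and a weighted gradient. [K] collects this cost from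
    the [x]-derivative and, as [N >= 1], from the cutoff [h], whose [y]-derivative is at most
    [1 / b]. *)
Lemma lift_bound e n h f (N := n.+1%:R : R) (K := 2 + 2 * (a / b) ^+ 2)
  (L := MulT h (MulT (powT (xi a (eb e)) n.+1) f)) :
  (forall x y, Om (x, y) -> ev h (x, y) ^+ 2 <= 1) ->
  (forall z, ev (dx h) z = 0) ->
  (forall x y, Om (x, y) -> ev (dy h) (x, y) ^+ 2 <= b ^- 2) ->
  nn (dx L) + nn (dy L) <= K * (2 * N / a) * Sy (sqT f) (xb e) +
    (4 * K + 2) * (JN e n (te (dx f)) + JN e n (te (dy f))).
Proof.
move=> h1 hx hy.
have an : a != 0 by rewrite gt_eqF.
have bn : b != 0 by rewrite gt_eqF.
have N1 : 1 <= N by rewrite ler1n.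
have NE : N = n.+1%:R by [].
rewrite !JN_te; set Jx := II _; set Jy := II (MulT _ (sqT (dy f))).
set S := Sy _ _; pose I0 := II (MulT (powT (xi a (eb e)) n.*2) (sqT f)).
have Hdy : (N / a) ^+ 2 * I0 <= 2 * N / a * S + 4 * Jx.
  by rewrite /S -sgn_sideE; exact: (weighted_hardy ha hb (ebE R e)).
clearbody N.
have I00 : 0 <= I0.
  apply: Rintegral_ge0 => z _; rewrite ev_mul mulr_ge0 ?ev_sq_ge0//.
  by rewrite ev_powT -addnn exprD -expr2 sqr_ge0.
have Jx0 : 0 <= Jx.
  apply: Rintegral_ge0 => z _; rewrite ev_mul mulr_ge0 ?ev_sq_ge0//.
  by rewrite ev_powT -addnn exprD -expr2 sqr_ge0.
have Jy0 : 0 <= Jy.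
  apply: Rintegral_ge0 => z _; rewrite ev_mul mulr_ge0 ?ev_sq_ge0//.
  by rewrite ev_powT -addnn exprD -expr2 sqr_ge0.
have E1 k (X : R) : X ^+ k.*2 = (X ^+ k) ^+ 2 by rewrite -muln2 exprM.
have Bx : nn (dx L) <= 2 * (N / a) ^+ 2 * I0 + 2 * Jx.
  rewrite /I0 /Jx -!(II_scale ha hb) -(II_add ha hb); apply: (le_II ha hb) => x y O.
  have r1 := h1 x y O; rewrite /sqT [leRHS]ev_add !ev_mul !ev_cst /L ev_dx_mul hx.
  rewrite ev_dx_mul ev_dx_powT !ev_powT ev_dx_xi// mul0r add0r.
  rewrite !E1 exprS -NE; set X := ev (xi _ _) _; set r := ev h _ in r1 *; move: (ev f _) (ev (dx f) _) (X ^+ n) => u v w.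
  have P2 : (N * w * (eb e / a) * u + X * w * v) ^+ 2 <= 2 * (N / a) ^+ 2 * (w ^+ 2 * (u * u)) + 2 * ((X * w) ^+ 2 * (v * v)).
    have := sqr_ge0 (N * w * (eb e / a) * u - X * w * v).
    have -> : 2 * (N / a) ^+ 2 * (w ^+ 2 * (u * u)) = 2 * (N * w * (eb e / a) * u) ^+ 2.
      rewrite -[LHS]mulr1 -(eb2 R e); field; exact: an.
    lra.
  have P3 := ler_piMl (sqr_ge0 (N * w * (eb e / a) * u + X * w * v)) r1.
  lra.
have By : nn (dy L) <= 2 * (a / b) ^+ 2 * ((N / a) ^+ 2 * I0) + 2 * Jy.
  apply: (@le_trans _ _ (2 * b ^- 2 * I0 + 2 * Jy)).
    rewrite /I0 /Jy -!(II_scale ha hb) -(II_add ha hb); apply: (le_II ha hb) => x y O.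
    have r1 := h1 x y O; have t1 := hy x y O.
    have /andP[X0 /ltW X1] := xi_lt1 e O.
    rewrite /sqT [leRHS]ev_add !ev_mul !ev_cst /L ev_dy_mul.
    rewrite [ev (dy (MulT (powT _ _) f)) _]ev_dy_mul.
    have -> : ev (dy (powT (xi a (eb e)) n.+1)) (x, y) = 0.
      elim: n {Jx Jy I0 Hdy I00 Jx0 Jy0 Bx NE L} => [|n IH]; first by rewrite /=; ring.
      rewrite -[powT _ n.+2]/(MulT (xi a (eb e)) (powT (xi a (eb e)) n.+1)) ev_dy_mul IH mulr0 addr0.
      by rewrite (_ : ev (dy (xi a (eb e))) _ = 0) ?mul0r//= ; ring.
    rewrite mul0r add0r !ev_mul !ev_powT !E1 exprS; set X := ev (xi _ _) _ in X0 X1 *.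
    set r := ev h _ in r1 *; set t := ev (dy h) _ in t1 *.
    move: (ev f _) (ev (dy f) _) (X ^+ n) => u v w.
    have Q1 : (X * w * u) ^+ 2 <= w ^+ 2 * (u * u).
      rewrite (_ : (X * w * u) ^+ 2 = X ^+ 2 * (w * u) ^+ 2); last by ring.
      rewrite (_ : w ^+ 2 * (u * u) = (w * u) ^+ 2); last by ring.
      by rewrite ler_piMl ?sqr_ge0// exprn_ile1.
    have Q2 : t ^+ 2 * (X * w * u) ^+ 2 <= b ^- 2 * (w ^+ 2 * (u * u)).
      by apply: ler_pM => //; rewrite sqr_ge0.
    have Q3 := ler_piMl (sqr_ge0 (X * w * v)) r1.
    have := sqr_ge0 (t * (X * w * u) - r * (X * w * v)).
    lra.
  rewrite lerD2r (_ : 2 * (a / b) ^+ 2 * ((N / a) ^+ 2 * I0) = N ^+ 2 * (2 * b ^- 2 * I0)); last first.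
    by field; rewrite an bn.
  rewrite ler_peMl ?exprn_ege1// mulr_ge0// mulr_ge0// invr_ge0 exprn_ge0//.
  exact: ltW.
have K0 : 0 <= K by rewrite /K addr_ge0// mulr_ge0// sqr_ge0.
have := ler_wpM2l K0 Hdy.
have H5 : 0 <= K * Jy by rewrite mulr_ge0.
have -> : K * ((N / a) ^+ 2 * I0) = 2 * (N / a) ^+ 2 * I0 +
  2 * (a / b) ^+ 2 * ((N / a) ^+ 2 * I0) by rewrite /K; ring.
move: Bx By; move: (2 * (N / a) ^+ 2 * I0) (2 * (a / b) ^+ 2 * _) => A B.
have -> : K * (2 * N / a) * S + (4 * K + 2) * (Jx + Jy) =
  K * (2 * N / a * S + 4 * Jx) + 4 * (K * Jy) + 2 * Jx + 2 * Jy by ring.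
move: (K * (_ + _)) => C; lra.
Qed.

Definition PW (w1 w2 : H) p q := ipH w1 (te (k1 p q)) + ipH w2 (te (k2 p q)).

Lemma PW_ext w1 w2 p q p' q' : (forall x y, ev (k1 p q) (x, y) = ev (k1 p' q') (x, y)) ->
  (forall x y, ev (k2 p q) (x, y) = ev (k2 p' q') (x, y)) -> PW w1 w2 p q = PW w1 w2 p' q'.
Proof. by move=> H1 H2; rewrite /PW (te_ext ha hb H1) (te_ext ha hb H2). Qed.

Lemma PW_add w1 w2 p q p' q' :
  PW w1 w2 (AddT p p') (AddT q q') = PW w1 w2 p q + PW w1 w2 p' q'.
Proof.
have I := ipH_inner a b.
rewrite /PW addrACA -!(ipDr I) -!te_add; congr (ipH _ _ + ipH _ _); apply: te_ext => x y /=; ring.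
Qed.

Lemma PW_scale w1 w2 r p q : PW w1 w2 (MulT (Cst r) p) (MulT (Cst r) q) = r * PW w1 w2 p q.
Proof.
have I := ipH_inner a b.
rewrite /PW mulrDr -!(ipZr I) -!te_scale; congr (ipH _ _ + ipH _ _); apply: te_ext => x y /=; ring.
Qed.

Lemma PW_le w1 w2 p q :
  2 * PW w1 w2 p q <= (ipH w1 w1 + ipH w2 w2) + (nn (k1 p q) + nn (k2 p q)).
Proof.
have I := ipH_inner a b.
have := ip_abs_le I w1 (te (k1 p q)) ltr01; have := ip_abs_le I w2 (te (k2 p q)) ltr01.
rewrite !nsq_te invr1 !mul1r /PW mulrDr => /(le_trans (ler_norm _)) + /(le_trans (ler_norm _)); lra.
Qed.

(** Decreases from 1 on the bottom to 0 on the top. Giving the share [thT] of a jump to [p] and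
    [thcT] to [q] respects [p = 0] on the top and [q = 0] on the bottom, corners included. *)
Definition thT := MulT (Cst b^-1) (SubT (Cst (b / 2)) VY).
Definition thcT := SubT (Cst 1) thT.

Lemma thT_T x : ev thT (x, b / 2) = 0. Proof. by rewrite /=; ring. Qed.
Lemma thcT_B x : ev thcT (x, - b / 2) = 0.
Proof. by rewrite /=; field; rewrite gt_eqF. Qed.

Lemma thT_01 x y : Om (x, y) -> 0 <= ev thT (x, y) <= 1.
Proof.
move=> [_ /=]; rewrite in_itv/= => /andP[y1 y2].
rewrite mulN1r mulrC divr_ge0 ?(ltW hb)//=; last by lra.
by rewrite ler_pdivrMr// mul1r; lra.
Qed.

(** Subtracting [(liftp, liftq)] of the jump from [(phi, - psi)] restores the boundary condition on
    the side [e] and changes nothing on the opposite one. *)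
Definition liftp e n f := MulT thT (MulT (powT (xi a (eb e)) n.+1) f).
Definition liftq e n f := MulT (MulT (Cst (eb e)) thcT) (MulT (powT (xi a (eb e)) n.+1) f).

Lemma nn_opp f : nn (OppT f) = nn f.
Proof. by apply: eq_II => x y /=; ring. Qed.

Lemma lift_energy e n f (N := n.+1%:R : R) (K := 2 + 2 * (a / b) ^+ 2) :
  nn (k1 (liftp e n f) (liftq e n f)) + nn (k2 (liftp e n f) (liftq e n f)) <=
  4 * (K * (2 * N / a) * Sy (sqT f) (xb e) +
    (4 * K + 2) * (JN e n (te (dx f)) + JN e n (te (dy f)))).
Proof.
have bn : b != 0 by rewrite gt_eqF.
set B := _ + _ * (_ + _).
have Bp : nn (dx (liftp e n f)) + nn (dy (liftp e n f)) <= B.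
  apply: lift_bound => [x y /thT_01/andP[t0 t1]|z|x y _].
  - exact: exprn_ile1.
  - by rewrite /=; ring.
  - by rewrite (_ : _ ^+ 2 = b ^- 2)//=; field.
have Bq : nn (dx (liftq e n f)) + nn (dy (liftq e n f)) <= B.
  apply: lift_bound => [x y /thT_01/andP[t0 t1]|z|x y _].
  - rewrite ev_mul ev_cst ev_sub ev_cst exprMn expr2 eb2 mul1r exprn_ile1//; lra.
  - by rewrite /=; ring.
  - rewrite (_ : _ ^+ 2 = eb e * eb e * b ^- 2); first by rewrite eb2 mul1r.
    by rewrite /=; field.
have Hk1 : nn (k1 (liftp e n f) (liftq e n f)) <= 2 * nn (dx (liftp e n f)) + 2 * nn (dy (liftq e n f)).
  apply: (le_trans (nn_add_le ha hb _ _)).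
  by rewrite nn_opp.
have Hk2 : nn (k2 (liftp e n f) (liftq e n f)) <= 2 * nn (dx (liftq e n f)) + 2 * nn (dy (liftp e n f)).
  by rewrite /k2 nn_opp; exact: nn_add_le.
lra.
Qed.

Lemma liftp_T e n f x : ev (liftp e n f) (x, b / 2) = 0.
Proof. by rewrite /liftp ev_mul thT_T mul0r. Qed.

Lemma liftq_B e n f x : ev (liftq e n f) (x, - b / 2) = 0.
Proof. by rewrite /liftq ev_mul [ev (MulT _ thcT) _]ev_mul thcT_B mulr0 mul0r. Qed.

Lemma liftp_opp e n f y : ev (liftp e n f) (xb (~~ e), y) = 0.
Proof.
rewrite /liftp ev_mul [ev (MulT (powT _ _) _) _]ev_mul ev_powT ev_xi_opp// expr0n.
by rewrite [0%:R * _]mul0r mulr0.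
Qed.

Lemma liftq_opp e n f y : ev (liftq e n f) (xb (~~ e), y) = 0.
Proof.
rewrite /liftq ev_mul [ev (MulT (powT _ _) _) _]ev_mul ev_powT ev_xi_opp// expr0n.
by rewrite [0%:R * _]mul0r mulr0.
Qed.

Lemma liftp_side e n f y :
  ev (liftp e n f) (xb e, y) = ev thT (xb e, y) * ev f (xb e, y).
Proof.
by rewrite /liftp ev_mul [ev (MulT (powT _ _) _) _]ev_mul ev_powT ev_xi_side// expr1n mul1r.
Qed.

Lemma liftq_side e n f y :
  ev (liftq e n f) (xb e, y) = eb e * (1 - ev thT (xb e, y)) * ev f (xb e, y).
Proof.
rewrite /liftq ev_mul [ev (MulT (powT _ _) _) _]ev_mul ev_powT ev_xi_side// expr1n mul1r.
by rewrite ev_mul ev_cst ev_sub ev_cst.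
Qed.

(** Pairing [w] with [(phi, - psi)] gives [2 W] in the limit, while the lifts that correct the
    boundary values can produce at most [W] plus an error. The error vanishes when first [n] and
    then [N] tends to infinity; in this order the factor [N] in front of the side norm is
    harmless. *)
Lemma cokernel_trivial (w1 w2 : H) :
  (forall p q, bc a b p q -> PW w1 w2 p q = 0) -> ipH w1 w1 + ipH w2 w2 = 0.
Proof.
move=> ortho; have I := ipH_inner a b.
have bn : b != 0 by rewrite gt_eqF.
have [phi [phiT phix phiy]] : exists f : nat -> tf R, [/\ forall n x, ev (f n) (x, b / 2) = 0,
    cvg_ip ipH (fun n => te (dx (f n))) w1 &
    cvg_ip ipH (fun n => te (OppT (dy (f n)))) w2].
  apply: (potential (half_pair_cs ha hb)) => q q0 qR qL.
  have := ortho (Cst 0) q; rewrite /PW.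
  have -> : te (k1 (Cst 0) q) = - te (dy q) by rewrite -te_opp; apply: te_ext => x y /=; ring.
  have -> : te (k2 (Cst 0) q) = - te (dx q) by rewrite -te_opp; apply: te_ext => x y /=; ring.
  rewrite !(ipNr I) => H0; suff : - ipH w1 (te (dy q)) - ipH w2 (te (dx q)) = 0 by lra.
  by apply: H0; split=> [x|x|y|y]; rewrite ?qR ?qL ?oppr0// mulNr q0.
have [psi [psiB psix psiy]] : exists f : nat -> tf R, [/\ forall n x, ev (f n) (x, - b / 2) = 0,
    cvg_ip ipH (fun n => te (dx (f n))) w2 &
    cvg_ip ipH (fun n => te (OppT (dy (f n)))) (- w1)].
  apply: (potential (half_pair_sc ha hb)) => p p0 pR pL.
  have := ortho p (Cst 0); rewrite /PW.
  have -> : te (k1 p (Cst 0)) = te (dx p) by apply: te_ext => x y /=; ring.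
  have -> : te (k2 p (Cst 0)) = - te (dy p) by rewrite -te_opp; apply: te_ext => x y /=; ring.
  rewrite (ipNr I) (ipNl I) => H0.
  suff : ipH w1 (te (dx p)) - ipH w2 (te (dy p)) = 0 by lra.
  by apply: H0; split=> [x|x|y|y]; rewrite ?pR ?pL ?oppr0// -[b / 2]opprK -mulNr p0.
have cj e := jump_const phiT psiB phix phiy psix psiy ortho e.
have /choice[c Hc] := cj.
pose W := ipH w1 w1 + ipH w2 w2.
have W0 : 0 <= W by rewrite addr_ge0// ip_ge0.
pose f e n := SubT (jump phi psi e n) (Cst (c e)).
(* By the choice of the potentials, massless [K] applied to [(phi, - psi)] tends to [2 w]. *)
have PWlim : (fun n => PW w1 w2 (phi n) (OppT (psi n))) @ \oo --> 2 * W.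
  have -> : (fun n => PW w1 w2 (phi n) (OppT (psi n))) = (fun n =>
     (ipH (te (dx (phi n))) w1 - ipH (te (OppT (dy (psi n)))) w1) +
     (ipH (te (dx (psi n))) w2 + ipH (te (OppT (dy (phi n)))) w2)).
    apply/funext => n; rewrite -(ipBl I) -(ipDl I) !(ip_sym I _ w1) !(ip_sym I _ w2).
    rewrite -te_sub -te_add /PW; congr (ipH _ _ + ipH _ _); apply: te_ext => x y /=; ring.
  rewrite (_ : 2 * W = (ipH w1 w1 - ipH (- w1) w1) + (ipH w2 w2 + ipH w2 w2)); last first.
    by rewrite (ipNl I) /W; ring.
  by apply: cvgD; [apply: cvgB|apply: cvgD]; exact: cvg_ip_ip.
(* On the side the [p]-part of this lift is [thT], of slope [- 1 / b], and the jump tends to [c e]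
   over a side of length [b]; the value does not depend on [N]. *)
have PWone e N : PW w1 w2 (liftp e N (Cst 1)) (liftq e N (Cst 1)) = - c e.
  have dp y : ev (dy (liftp e N (Cst 1))) (xb e, y) = - b^-1.
    rewrite (@dy_ext _ _ thT) => [|t]; first by rewrite /=; ring.
    by rewrite liftp_side ev_cst mulr1.
  have dq y : ev (dy (liftq e N (Cst 1))) (xb e, y) = - eb e * ev (dy (liftp e N (Cst 1))) (xb e, y).
    rewrite dp (@dy_ext _ _ (MulT (Cst (eb e)) thcT)) => [|t]; first by rewrite /=; ring.
    by rewrite liftq_side ev_mul ev_sub !ev_cst mulr1.
  have L1 := pairing_side phiT psiB phix phiy psix psiy (liftp_T e N (Cst 1))
    (liftq_B e N (Cst 1)) (liftp_opp e N (Cst 1)) (liftq_opp e N (Cst 1)) dq.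
  apply: (cvg_uniq L1).
  have Ht : cvg_ip (@ipG R a b (sb e)) (fun n => trs ha hb (sb e) (jump phi psi e n)) (trs ha hb (sb e) (Cst (c e))).
    rewrite /cvg_ip (_ : (fun n => _) = fun n => Sy (sqT (SubT (jump phi psi e n) (Cst (c e)))) (xb e)).
      exact: Hc.
    by apply/funext => n; rewrite -trs_sub ip_trs Sd_sb.
  have L2 : (fun n => - b^-1 * ipG (trs ha hb (sb e) (jump phi psi e n)) (trs ha hb (sb e) (Cst 1))) @ \oo -->
     - b^-1 * ipG (trs ha hb (sb e) (Cst (c e))) (trs ha hb (sb e) (Cst 1)).
    by apply: cvgM; [exact: cvg_cst|apply: cvg_ip_ip => //; exact: ipG_inner].
  rewrite (_ : - c e = - b^-1 * ipG (trs ha hb (sb e) (Cst (c e))) (trs ha hb (sb e) (Cst 1))); last first.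
    rewrite ip_trs Sd_sb (@eq_Sy _ b _ (dy (MulT (Cst (c e)) VY))) => [|y]; last by rewrite /=; ring.
    by rewrite (Sy_dy hb) /=; field.
  rewrite (_ : (fun n => _) = fun n => - b^-1 * ipG (trs ha hb (sb e) (jump phi psi e n)) (trs ha hb (sb e) (Cst 1))) //.
  apply/funext => n; rewrite ip_trs Sd_sb -(Sy_scale hb); apply: eq_Sy => y.
  by rewrite !ev_mul dp !ev_cst; ring.
have PWlift e n N : PW w1 w2 (liftp e N (jump phi psi e n)) (liftq e N (jump phi psi e n)) =
    PW w1 w2 (liftp e N (f e n)) (liftq e N (f e n)) - c e ^+ 2.
  rewrite (_ : - c e ^+ 2 = c e * PW w1 w2 (liftp e N (Cst 1)) (liftq e N (Cst 1))); last first.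
    by rewrite PWone; ring.
  rewrite -PW_scale -PW_add; apply: PW_ext => x y.
    by rewrite /f /liftp /liftq; move: (jump _ _ _ _) (powT _ _) thT thcT => J X t t' /=; ring.
  by rewrite /f /liftp /liftq; move: (jump _ _ _ _) (powT _ _) thT thcT => J X t t' /=; ring.
(* Once the lifts of both full jumps are removed, the pair satisfies every boundary condition and is
   orthogonal to [w]. Separating the constants from the jumps leaves their squares on the left. *)
have eqn n N : PW w1 w2 (phi n) (OppT (psi n)) + c true ^+ 2 + c false ^+ 2 =
   PW w1 w2 (liftp true N (f true n)) (liftq true N (f true n)) +
   PW w1 w2 (liftp false N (f false n)) (liftq false N (f false n)).
  pose J e := jump phi psi e n.
  have := ortho (SubT (phi n) (AddT (liftp true N (J true)) (liftp false N (J false))))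
    (SubT (OppT (psi n)) (AddT (liftq true N (J true)) (liftq false N (J false)))).
  rewrite PW_add PW_scale PW_add !PWlift => H0.
  suff : PW w1 w2 (phi n) (OppT (psi n)) + -1 * (PW w1 w2 (liftp true N (f true n)) (liftq true N (f true n)) - c true ^+ 2 +
     (PW w1 w2 (liftp false N (f false n)) (liftq false N (f false n)) - c false ^+ 2)) = 0 by lra.
  apply: H0; split=> [x|x|y|y]; rewrite !ev_sub ?ev_opp.
  - by rewrite phiT !ev_add !liftp_T; ring.
  - by rewrite psiB !ev_add !liftq_B; ring.
  - rewrite !ev_add (liftp_side true) (liftq_side true) (liftp_opp false) (liftq_opp false).
    by rewrite /J /jump /= /eb /xb; ring.
  - rewrite !ev_add (liftp_side false) (liftq_side false) (liftp_opp true) (liftq_opp true).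
    by rewrite /J /jump /= /eb /xb; ring.
pose om1 e := w1 - eb e *: w2; pose om2 e := (-1) *: w2 + eb e *: (- w1).
have omx e : cvg_ip ipH (fun n => te (dx (f e n))) (om1 e).
  rewrite (_ : (fun n => _) = fun n => te (dx (phi n)) - eb e *: te (dx (psi n))).
    by apply: cvg_ipB => //; exact: cvg_ipZ.
  by apply/funext => n; rewrite -te_scale -te_sub; apply: te_ext => x y /=; ring.
have omy e : cvg_ip ipH (fun n => te (dy (f e n))) (om2 e).
  rewrite (_ : (fun n => _) = fun n => (-1) *: te (OppT (dy (phi n))) + eb e *: te (OppT (dy (psi n)))).
    by apply: cvg_ipD => //; exact: cvg_ipZ.
  by apply/funext => n; rewrite -!te_scale -te_add; apply: te_ext => x y /=; ring.
pose K : R := 2 + 2 * (a / b) ^+ 2.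
pose T e N := JN e N (om1 e) + JN e N (om2 e).
have K0 : 0 <= K by rewrite /K addr_ge0// mulr_ge0// sqr_ge0.
(* Each of the two lifts contributes at most [W / 2] plus its energy, so [W] of the [2 W] remains.
   The squares of the constants stand on the smaller side and are dropped. *)
have main N : W <= 4 * (4 * K + 2) * (T true N + T false N).
  pose C := K * (2 * N.+1%:R / a).
  pose S e n := Sy (sqT (f e n)) (xb e).
  pose dX e n := ipH (te (dx (f e n)) - om1 e) (te (dx (f e n)) - om1 e).
  pose dY e n := ipH (te (dy (f e n)) - om2 e) (te (dy (f e n)) - om2 e).
  pose Rm e n := C * S e n + (4 * K + 2) * (2 * dX e n + 2 * dY e n).
  have le e n : 2 * PW w1 w2 (liftp e N (f e n)) (liftq e N (f e n)) <=
      W + 4 * (Rm e n + (4 * K + 2) * (2 * T e N)).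
    apply: (le_trans (PW_le _ _ _ _)); rewrite lerD2l.
    apply: (le_trans (lift_energy _ _ _)); rewrite ler_pM2l// -/K -/C /Rm -/(S e n) -addrA lerD2l.
    rewrite -mulrDr ler_wpM2l//; first by lra.
    have := JN_le e N (te (dx (f e n))) (om1 e); have := JN_le e N (te (dy (f e n))) (om2 e).
    by rewrite -/(dX e n) -/(dY e n) /T; lra.
  have Rm0 e : Rm e @ \oo --> C * 0 + (4 * K + 2) * (2 * 0 + 2 * 0).
    apply: cvgD; (apply: cvgM; first exact: cvg_cst); first exact: Hc.
    by apply: cvgD; (apply: cvgM; first exact: cvg_cst); [exact: omx|exact: omy].
  rewrite !(mulr0, addr0) in Rm0.
  have L1 : (fun n => PW w1 w2 (phi n) (OppT (psi n)) + c true ^+ 2 + c false ^+ 2) @ \oo -->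
    2 * W + c true ^+ 2 + c false ^+ 2.
    by apply: cvgD; [apply: cvgD|]; [|exact: cvg_cst|exact: cvg_cst].
  pose B := W + 4 * (4 * K + 2) * (T true N + T false N).
  have L2 : (fun n => B + 2 * (Rm true n + Rm false n)) @ \oo --> B + 2 * (0 + 0).
    by apply: cvgD; [exact: cvg_cst|apply: cvgM; [exact: cvg_cst|exact: cvgD]].
  have : 2 * W + c true ^+ 2 + c false ^+ 2 <= B + 2 * (0 + 0).
    apply: (ler_cvg_to L1 L2); apply: nearW => n /=; have := eqn n N.
    move: (le true n) (le false n); rewrite /B.
    move: (PW w1 w2 (phi n) _) (PW w1 w2 (liftp true _ _) _) (PW w1 w2 (liftp false _ _) _).
    move: (Rm true n) (Rm false n) (T true N) (T false N) => r1 r2 t1 t2 p0 p1 p2.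
    by clear; move: W K (c true ^+ 2) (c false ^+ 2) => W' K' c1 c2 *; lra.
  rewrite /B; have := sqr_ge0 (c true); have := sqr_ge0 (c false).
  move: (c true ^+ 2) (c false ^+ 2) (T true N) (T false N) => c1 c2 t1 t2.
  by clear; move: W K => W' K' *; lra.
have T0 : (fun N => 4 * (4 * K + 2) * (T true N + T false N)) @ \oo --> 4 * (4 * K + 2) * ((0 + 0) + (0 + 0)).
  by apply: cvgM; [exact: cvg_cst|apply: cvgD; apply: cvgD; exact: JN_cvg0].
rewrite !addr0 mulr0 in T0.
apply/eqP; rewrite eq_le W0 andbT.
by apply: (ler_cvg_to (cvg_cst W) T0); exact: nearW.
Qed.

End CokernelTrivial.

(** * Orthogonal expansions and compactness *)

Section Orthogonal.
Context (R : realType) (V : lmodType R) (ip : V -> V -> R) (I : inner ip).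
Context (J : eqType) (e : J -> V).
Local Notation nsq u := (ip u u).
Hypothesis orth : forall i j, i != j -> ip (e i) (e j) = 0.

Definition coef p i := ip p (e i) / nsq (e i).
Definition proj_on (s : seq J) p := \sum_(i <- s) coef p i *: e i.

(** For a null [e i] the division by zero returns 0, consistently with [ip p (e i) = 0], which holds
    by Cauchy-Schwarz. *)
Lemma coefK p i : coef p i * nsq (e i) = ip p (e i).
Proof.
rewrite /coef; have [e0|e0] := eqVneq (nsq (e i)) 0; last by rewrite divfK.
by rewrite e0 mulr0 (ip_sym I) (nsq0_ip I).
Qed.

Lemma ip_proj_on s p j : uniq s -> j \in s -> ip (proj_on s p) (e j) = ip p (e j).
Proof.
move=> us js; rewrite (ip_sym I) /proj_on (ip_sumr I) (bigD1_seq j)//=.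
rewrite (ipZr I) coefK big1 ?addr0// => i ij.
by rewrite (ipZr I) orth ?mulr0// eq_sym.
Qed.

Lemma proj_rest_orth s p j : uniq s -> j \in s -> ip (p - proj_on s p) (e j) = 0.
Proof. by move=> us js; rewrite (ipBl I) ip_proj_on// subrr. Qed.

Lemma proj_rest_orth_sum s p (K : eqType) (t : seq K) (c : K -> R) (g : K -> J) :
  uniq s -> {in t, forall k, g k \in s} ->
  ip (p - proj_on s p) (\sum_(k <- t) c k *: e (g k)) = 0.
Proof.
move=> us ts; rewrite (ip_sumr I) big_seq big1// => k kt.
by rewrite (ipZr I) proj_rest_orth ?mulr0// ts.
Qed.

Lemma pythagoras s p : uniq s ->
  nsq p = \sum_(i <- s) ip p (e i) ^+ 2 / nsq (e i) + nsq (p - proj_on s p).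
Proof.
move=> us; have H0 : ip (p - proj_on s p) (proj_on s p) = 0.
  by apply: (@proj_rest_orth_sum s p _ s (coef p) id).
have H1 : ip p (proj_on s p) = \sum_(i <- s) ip p (e i) ^+ 2 / nsq (e i).
  rewrite /proj_on (ip_sumr I); apply: eq_bigr => i _.
  by rewrite (ipZr I) /coef mulrAC expr2.
rewrite -H1; move: H0; rewrite (ipBl I) (nsqB I); lra.
Qed.

Lemma bessel s p : uniq s -> \sum_(i <- s) ip p (e i) ^+ 2 / nsq (e i) <= nsq p.
Proof. by move=> us; rewrite (pythagoras p us) lerDl ip_ge0. Qed.

Hypothesis cV : complete_ip ip.
Hypothesis tot : forall f, (forall i, ip f (e i) = 0) -> nsq f = 0.

(** Totality makes finite combinations come close to [p], and the orthogonal projection onto any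
    larger set of modes is at least as good. *)
Lemma approx_proj p d : 0 < d -> exists s0 : seq J, forall s, uniq s ->
  {subset s0 <= s} -> nsq (p - proj_on s p) <= d.
Proof.
move=> d0; pose U v := exists t : seq (R * J), v = \sum_(x <- t) x.1 *: e x.2.
have HU : subspace U.
  split; first by exists [::]; rewrite big_nil.
  move=> k _ _ [t ->] [t' ->]; exists ([seq (k * x.1, x.2) | x <- t] ++ t').
  rewrite big_cat big_map /= scaler_sumr; congr (_ + _).
  by apply: eq_bigr => x _; rewrite scalerA.
have [u [f0 [Uu uf0 H0]]] := projection I p cV HU.
have p0 : nsq (p - f0) = 0.
  apply: tot => i; apply: H0; exists [:: (1, i)].
  by rewrite big_seq1 scale1r.
have d2 : 0 < d / 2 by rewrite divr_gt0.
have /cvgrPdist_le/(_ _ d2)[N _ HN] := uf0.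
have := HN N (leqnn N); rewrite /= sub0r normrN ger0_norm ?(ip_ge0 I)// => HuN.
have [t tE] := Uu N; exists [seq x.2 | x <- t] => s us ts.
have H1 : nsq (p - u N) <= d.
  have -> : p - u N = (p - f0) - (u N - f0) by rewrite subrBB.
  by have := nsqB_le I (p - f0) (u N - f0); rewrite p0; lra.
apply: le_trans H1.
have -> : p - u N = (p - proj_on s p) + (proj_on s p - u N) by rewrite addr_subK.
rewrite (nsqD I (p - proj_on s p)); have -> : ip (p - proj_on s p) (proj_on s p - u N) = 0.
  rewrite (ipBr I) (@proj_rest_orth_sum s p _ s (coef p) id)// tE.
  rewrite (@proj_rest_orth_sum s p _ t (fun x => x.1) (fun x => x.2)) ?subrr//.
  by move=> x xt; apply: ts; apply: map_f.
by have := ip_ge0 I (proj_on s p - u N); lra.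
Qed.

End Orthogonal.

Section SpectralTail.
Context (R : realType) (V : lmodType R) (ip : V -> V -> R) (I : inner ip).
Context (J : eqType) (e : J -> V).
Local Notation nsq u := (ip u u).
Hypothesis orth : forall i j, i != j -> ip (e i) (e j) = 0.
Hypothesis cV : complete_ip ip.
Hypothesis tot : forall f, (forall i, ip f (e i) = 0) -> nsq f = 0.
Context (W : lmodType R) (ipW : W -> W -> R) (IW : inner ipW).
Variables (g : J -> W) (lam : J -> R).
Hypothesis gg : forall i j, ipW (g i) (g j) = lam i * ip (e i) (e j).

(* Spectral form of Rellich's inequality: the tail of the expansion of [p] is
   controlled by the energy. *)
Lemma spectral_tail p dp s0 L : 0 < L -> uniq s0 ->
  (forall i, ipW dp (g i) = lam i * ip p (e i)) ->
  (forall i, i \notin s0 -> L <= lam i) ->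
  nsq p <= \sum_(i <- s0) ip p (e i) ^+ 2 / nsq (e i) + L^-1 * ipW dp dp.
Proof.
move=> L0 us0 dpE Llam; apply/ler_addgt0Pr => d d0.
have [s1 Hs1] := approx_proj I orth cV tot p d0.
(* All modes of [s2] satisfy [L <= lam i], so their contribution is bounded by [L^-1] times a Bessel
   sum for [dp] in [W]. *)
pose s2 := [seq i <- undup s1 | i \notin s0]; pose s := s0 ++ s2.
have us : uniq s.
  rewrite cat_uniq us0 filter_uniq ?undup_uniq// andbT /=.
  by apply/hasPn => i; rewrite mem_filter => /andP[].
have s1s : {subset s1 <= s}.
  by move=> i is1; rewrite mem_cat mem_filter mem_undup is1 andbT; case: (i \in s0).
rewrite (pythagoras I orth p us); apply: lerD; last exact: Hs1.
rewrite big_cat/= lerD2l.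
have gorth i j : i != j -> ipW (g i) (g j) = 0 by move=> ij; rewrite gg orth ?mulr0.
have us2 : uniq s2 by rewrite filter_uniq ?undup_uniq.
rewrite mulrC ler_pdivlMr// mulrC; apply: le_trans (bessel IW gorth dp us2).
rewrite mulr_sumr big_seq [leRHS]big_seq; apply: ler_sum => i.
rewrite mem_filter => /andP[/Llam Li _]; rewrite gg dpE.
have l0 : lam i != 0 by rewrite gt_eqF// (lt_le_trans L0).
have -> : (lam i * ip p (e i)) ^+ 2 / (lam i * nsq (e i)) =
    lam i * (ip p (e i) ^+ 2 / nsq (e i)).
  by rewrite invfM; move: (nsq (e i))^-1 (ip p (e i)) (lam i) l0 => n c l l0; field.
by rewrite ler_wpM2r// divr_ge0 ?sqr_ge0// ip_ge0.
Qed.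

End SpectralTail.

Section Compactness.
Context (R : realType) (J : eqType).

(** Tychonoff's theorem replaces diagonal extraction: bounded coefficient sequences have a cluster
    point in a compact product, and [phi k] is an index whose coefficients are close to it for all
    the finite sets of the stages up to [k]. *)
Lemma subsequence_cauchy (x : nat -> J -> R) (d : nat -> nat -> R) :
  (forall i, exists M, forall n, `|x n i| <= M) ->
  (forall e, 0 < e -> exists (s : seq J) C, 0 <= C /\
     forall n m, d n m <= C * \sum_(i <- s) (x n i - x m i) ^+ 2 + e) ->
  exists phi : nat -> nat, (forall k, (k <= phi k)%N) /\
    forall e, 0 < e -> exists N, forall i j, (N <= i)%N -> (N <= j)%N ->
      d (phi i) (phi j) <= e.
Proof.
move=> /choice[M HM] Hd.
pose T (_ : J) : topologicalType := R.
pose A : set (prod_topology T) := [set f | forall i, (`[- M i, M i]%classic : set R) (f i)].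
have cA : compact A.
  exact: (@tychonoff J T (fun i => (`[- M i, M i]%classic : set R)) (fun i => @segment_compact R _ _)).
have xA : (x @ \oo) A.
  by exists 0%N => // n _ i; rewrite /= in_itv/= -ler_norml.
have [l [_ cl]] := cA (x @ \oo) _ xA.
have nb (s : seq J) (eta : R) : 0 < eta ->
    nbhs l [set f : prod_topology T | forall i, i \in s -> `|(f i : R) - l i| <= eta].
  move=> eta0; elim: s => [|i s IH]; first exact: filterS filterT.
  have Hn : nbhs (l i : R) (fun t : R => `|(l i : R) - t| <= eta).
    by have /cvgrPdist_le/(_ _ eta0) := @cvg_id R (nbhs (l i : R)).
  have Hi : nbhs l (fun f : prod_topology T => `|(l i : R) - f i| <= eta).
    exact: (@proj_continuous J T i l _ Hn).
  apply: filterS (filterI Hi IH) => f [H1 H2] j.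
  by rewrite inE => /orP[/eqP ->|/H2//]; rewrite distrC.
pose eps k : R := k.+1%:R^-1.
have eps0 k : 0 < eps k by rewrite /eps invr_gt0.
have eps1 k : eps k <= 1 by rewrite /eps invf_le1 ?ler1n.
have /choice[sC HsC] : forall k, exists sC : seq J * R, 0 <= sC.2 /\
   forall n m, d n m <= sC.2 * \sum_(i <- sC.1) (x n i - x m i) ^+ 2 + eps k.
  by move=> k; have [s [C [C0 H]]] := Hd _ (eps0 k); exists (s, C).
(* Chosen so that [C * size s * (4 * eta) <= eps]. The summands 1 also give [den >= 4], hence
   [eta <= 1], which lets [(2 * eta) ^+ 2] be bounded by [4 * eta]. *)
pose den k : R := 4 * ((sC k).2 + 1) * (size (sC k).1).+1%:R.
have den4 k : 4 <= den k.
  rewrite /den -[leLHS]mulr1 -[X in X * 1]mulr1 ler_pM ?ler1n// ler_wpM2l//.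
  by rewrite lerDr; case: (HsC k).
pose eta k := eps k / den k.
have eta0 k : 0 < eta k by rewrite /eta divr_gt0// (lt_le_trans _ (den4 k)).
have eta1 k : eta k <= 1.
  rewrite /eta ler_pdivrMr ?(lt_le_trans _ (den4 k))// mul1r.
  by apply: (le_trans (eps1 k)); apply: le_trans (den4 k); rewrite ler1n.
pose B k := [set f : prod_topology T | forall i, i \in (sC k).1 -> `|(f i : R) - l i| <= eta k].
have nB k : nbhs l [set f | forall j, (j <= k)%N -> B j f].
  elim: k => [|k IH].
    by apply: filterS (nb (sC 0%N).1 _ (eta0 0%N)) => f Hf j; rewrite leqn0 => /eqP ->.
  apply: filterS (filterI IH (nb (sC k.+1).1 _ (eta0 k.+1))) => f [H1 H2] j.
  by rewrite leq_eqVlt => /orP[/eqP ->//|]; exact: H1.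
have /choice[phi Hphi] : forall k, exists n, (k <= n)%N /\ forall j, (j <= k)%N -> B j (x n).
  move=> k.
  have xk : (x @ \oo) [set f | exists2 n, (k <= n)%N & f = x n].
    by exists k => // n /= kn; exists n.
  by have [f [[n kn ->] Hf]] := cl _ _ xk (nB k); exists n.
exists phi; split; first by move=> k; case: (Hphi k).
move=> e e0; have e2 : 0 < e / 2 by rewrite divr_gt0.
have /cvgrPdist_le/(_ _ e2)[N _ /(_ N (leqnn N))] := @cvg_harmonic R.
rewrite /= sub0r normrN ger0_norm ?invr_ge0// => HN.
exists N => i j Ni Nj; have [C0 H] := HsC N.
apply: (le_trans (H _ _)).
have [_ /(_ N Ni) Bi] := Hphi i; have [_ /(_ N Nj) Bj] := Hphi j.
have Hsum : \sum_(m <- (sC N).1) (x (phi i) m - x (phi j) m) ^+ 2 <=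
    \sum_(m <- (sC N).1) 4 * eta N.
  rewrite big_seq [leRHS]big_seq; apply: ler_sum => m ms.
  have := Bi m ms; have := Bj m ms; rewrite !ler_norml => /andP[b1 b2] /andP[b3 b4].
  have t0 : `|x (phi i) m - x (phi j) m| <= 2 * eta N.
    by rewrite ler_norml; apply/andP; split; lra.
  rewrite -(real_normK (num_real _)); apply: (@le_trans _ _ ((2 * eta N) ^+ 2)).
    by rewrite lerXn2r// nnegrE mulr_ge0// ltW.
  rewrite exprMn -natrX ler_wpM2l// expr2 ler_piMl// ltW//.
have Hs : (sC N).2 * \sum_(m <- (sC N).1) (x (phi i) m - x (phi j) m) ^+ 2 <= eps N.
  apply: (le_trans (ler_wpM2l C0 Hsum)).
  rewrite big_const_seq count_predT iter_addr_0 -[_ *+ size _]mulr_natr.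
  have dn : den N != 0 by rewrite gt_eqF// (lt_le_trans _ (den4 N)).
  rewrite /eta [leLHS](_ : _ = eps N * (4 * (sC N).2 * (size (sC N).1)%:R / den N)); last by ring.
  rewrite ler_piMr ?(ltW (eps0 N))// ler_pdivrMr ?(lt_le_trans _ (den4 N))// mul1r.
  rewrite /den ler_pM ?mulr_ge0// ?ler_nat// ler_wpM2l// lerDl//.
move: HN; rewrite -/(eps N); lra.
Qed.

End Compactness.

(** * Self-adjointness of the massless operator *)

Section Spectral.
Context (R : realType) (a b : R) (ha : 0 < a) (hb : 0 < b).
Local Notation nn := (nn a b).
Local Notation H := (H2 a b).
Local Notation ipH := (@ipH R a b).
Local Notation te := (te ha hb).
Local Notation bc := (bc a b).
Implicit Types (f g p q : tf R).

Let I := ipH_inner a b.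
Let I2 := inner_ip2 I I.
Let cH := @ipH_complete R a b.
Let cHH := complete_ip2 I I cH cH.

Lemma bc_lin r p q p' q' : bc p q -> bc p' q' ->
  bc (AddT (MulT (Cst r) p) p') (AddT (MulT (Cst r) q) q').
Proof.
move=> [A1 A2 A3 A4] [B1 B2 B3 B4]; split=> t /=.
- by rewrite A1 B1 mulr0 addr0.
- by rewrite A2 B2 mulr0 addr0.
- by rewrite A3 B3; ring.
- by rewrite A4 B4.
Qed.

Lemma bc_sub p q p' q' : bc p q -> bc p' q' -> bc (SubT p p') (SubT q q').
Proof.
move=> [A1 A2 A3 A4] [B1 B2 B3 B4]; split=> t; rewrite !ev_sub.
- by rewrite A1 B1 subr0.
- by rewrite A2 B2 subr0.
- by rewrite A3 B3; ring.
- by rewrite A4 B4.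
Qed.

(** The remainder of the projection of [(g1, g2)] onto the closed range is orthogonal to the range,
    hence null. *)
Lemma K0_surjective (g1 g2 : H) : exists p q : nat -> tf R,
  [/\ forall n, bc (p n) (q n), cvg_ip ipH (fun n => te (k1 (p n) (q n))) g1 &
      cvg_ip ipH (fun n => te (k2 (p n) (q n))) g2].
Proof.
pose U (v : H * H) := exists p q, bc p q /\ v = (te (k1 p q), te (k2 p q)).
have HU : subspace U.
  split.
    exists (Cst 0), (Cst 0); split; first by split=> t /=; rewrite ?oppr0.
    transitivity ((0 *: te (Cst 0), 0 *: te (Cst 0)) : H * H); first by rewrite scale0r.
    by congr pair; rewrite -te_scale; apply: te_ext => x y /=; ring.
  move=> r _ _ [p [q [pq ->]]] [p' [q' [pq' ->]]].
  exists (AddT (MulT (Cst r) p) p'), (AddT (MulT (Cst r) q) q').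
  split; first exact: bc_lin.
  transitivity ((r *: te (k1 p q) + te (k1 p' q'), r *: te (k2 p q) + te (k2 p' q')) : H * H) => //.
  by congr pair; rewrite -te_scale -te_add; apply: te_ext => x y /=; ring.
have [u [[m1 m2] [Uu um mo]]] := projection I2 (g1, g2) cHH HU.
have /choice[pq Hpq] : forall n, exists pq : tf R * tf R,
    bc pq.1 pq.2 /\ u n = (te (k1 pq.1 pq.2), te (k2 pq.1 pq.2)).
  by move=> n; have [p [q [? ?]]] := Uu n; exists (p, q).
have [c1 c2] := (cvg_ip2 u (m1, m2) I I).1 um.
have d0 : ipH (g1 - m1) (g1 - m1) + ipH (g2 - m2) (g2 - m2) = 0.
  apply: (cokernel_trivial (ha := ha) (hb := hb)) => p q pq'.
  by apply: (mo (te (k1 p q), te (k2 p q))); exists p, q.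
have n1 := ip_ge0 I (g1 - m1); have n2 := ip_ge0 I (g2 - m2).
have z1 : ipH (g1 - m1) (g1 - m1) = 0 by lra.
have z2 : ipH (g2 - m2) (g2 - m2) = 0 by lra.
exists (fun n => (pq n).1), (fun n => (pq n).2); split.
- by move=> n; case: (Hpq n).
- apply: (cvg_ip_shift I _ z1).
  rewrite (_ : (fun n => _) = fun n => (u n).1); first exact: c1.
  by apply/funext => n; rewrite (Hpq n).2.
- apply: (cvg_ip_shift I _ z2).
  rewrite (_ : (fun n => _) = fun n => (u n).2); first exact: c2.
  by apply/funext => n; rewrite (Hpq n).2.
Qed.

Lemma bc_poincare p q : bc p q ->
  nn p + nn q <= 4 * b ^+ 2 * (nn (dy p) + nn (dy q)).
Proof.
move=> [pT qB _ _]; rewrite mulrDr.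
by apply: lerD; [exact: (poincare ha hb (or_introl erefl) pT)
  |exact: (poincare ha hb (or_intror erefl) qB)].
Qed.

Definition grad p q := nn (dx p) + nn (dy p) + nn (dx q) + nn (dy q).

Lemma bc_bounds p q : bc p q ->
  let E := nn (k1 p q) + nn (k2 p q) in
  [/\ nn p <= 4 * b ^+ 2 * E, nn q <= 4 * b ^+ 2 * E, nn (dx p) <= E,
      nn (dy p) <= E & nn (dx q) <= E /\ nn (dy q) <= E].
Proof.
move=> pq E; have := energy_identity ha hb pq; rewrite -/E => EE.
have := bc_poincare pq.
have := nn_ge0 a b (dx p); have := nn_ge0 a b (dy p).
have := nn_ge0 a b (dx q); have := nn_ge0 a b (dy q).
have := nn_ge0 a b p; have := nn_ge0 a b q.
move=> h1 h2 h3 h4 h5 h6 h7.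
have b0 : 0 <= 4 * b ^+ 2 by rewrite mulr_ge0// sqr_ge0.
have : 4 * b ^+ 2 * (nn (dy p) + nn (dy q)) <= 4 * b ^+ 2 * E.
  by apply: ler_wpM2l => //; lra.
by move=> h8; split; [| | | |split]; lra.
Qed.

Lemma cauchy_le (u v w : nat -> H) C : 0 < C ->
  cauchy_ip ipH v -> cauchy_ip ipH w ->
  (forall i j, ipH (u i - u j) (u i - u j) <=
     C * (ipH (v i - v j) (v i - v j) + ipH (w i - w j) (w i - w j))) ->
  cauchy_ip ipH u.
Proof.
move=> C0 cv cw uvw e e0.
have e2 : 0 < e / (2 * C) by rewrite divr_gt0// mulr_gt0.
have [N1 H1] := cv _ e2; have [N2 H2] := cw _ e2.
exists (maxn N1 N2) => i j; rewrite !geq_max => /andP[i1 i2] /andP[j1 j2].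
apply: (le_trans (uvw i j)).
have -> : e = C * (e / (2 * C) + e / (2 * C)) by field; rewrite gt_eqF.
by rewrite ler_pM2l//; apply: lerD; [exact: H1|exact: H2].
Qed.

Lemma K0_cauchy (p q : nat -> tf R) (g1 g2 : H) : (forall n, bc (p n) (q n)) ->
  cvg_ip ipH (fun n => te (k1 (p n) (q n))) g1 ->
  cvg_ip ipH (fun n => te (k2 (p n) (q n))) g2 ->
  [/\ cauchy_ip ipH (fun n => te (p n)), cauchy_ip ipH (fun n => te (q n)),
      cauchy_ip ipH (fun n => te (dx (p n))), cauchy_ip ipH (fun n => te (dy (p n))) &
      cauchy_ip ipH (fun n => te (dx (q n))) /\ cauchy_ip ipH (fun n => te (dy (q n)))].
Proof.
move=> pq /(cvg_ip_cauchy I) c1 /(cvg_ip_cauchy I) c2.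
have Ek i j : ipH (te (k1 (p i) (q i)) - te (k1 (p j) (q j))) (te (k1 (p i) (q i)) - te (k1 (p j) (q j))) +
    ipH (te (k2 (p i) (q i)) - te (k2 (p j) (q j))) (te (k2 (p i) (q i)) - te (k2 (p j) (q j))) =
    nn (k1 (SubT (p i) (p j)) (SubT (q i) (q j))) + nn (k2 (SubT (p i) (p j)) (SubT (q i) (q j))).
  by rewrite !nsq_te_sub; congr (_ + _); apply: eq_II => x y /=; ring.
have b0 : 0 < 4 * b ^+ 2 by rewrite mulr_gt0// exprn_gt0.
have B i j := bc_bounds (bc_sub (pq i) (pq j)).
split; [| | | |split].
- by apply: (cauchy_le b0 c1 c2) => i j; rewrite Ek nsq_te_sub; case: (B i j).
- by apply: (cauchy_le b0 c1 c2) => i j; rewrite Ek nsq_te_sub; case: (B i j).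
- apply: (cauchy_le ltr01 c1 c2) => i j; rewrite Ek nsq_te_sub mul1r; case: (B i j) => _ _ B1 _ _.
  by apply: le_trans B1; rewrite le_eqVlt; apply/orP; left; apply/eqP; apply: eq_II => x y /=; ring.
- apply: (cauchy_le ltr01 c1 c2) => i j; rewrite Ek nsq_te_sub mul1r; case: (B i j) => _ _ _ B1 _.
  by apply: le_trans B1; rewrite le_eqVlt; apply/orP; left; apply/eqP; apply: eq_II => x y /=; ring.
- apply: (cauchy_le ltr01 c1 c2) => i j; rewrite Ek nsq_te_sub mul1r; case: (B i j) => _ _ _ _ [B1 _].
  by apply: le_trans B1; rewrite le_eqVlt; apply/orP; left; apply/eqP; apply: eq_II => x y /=; ring.
- apply: (cauchy_le ltr01 c1 c2) => i j; rewrite Ek nsq_te_sub mul1r; case: (B i j) => _ _ _ _ [_ B1].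
  by apply: le_trans B1; rewrite le_eqVlt; apply/orP; left; apply/eqP; apply: eq_II => x y /=; ring.
Qed.

(** Solve the equation strongly for the same data. By [skew_identity] the strong solution is also a
    weak one, so its difference from [w] is orthogonal to the range and null. *)
Lemma weak_strong (w1 w2 g1 g2 : H) :
  (forall p q, bc p q -> ipH w1 (te (k1 p q)) + ipH w2 (te (k2 p q)) =
     - (ipH g1 (te p) + ipH g2 (te q))) ->
  exists p q : nat -> tf R, [/\ forall n, bc (p n) (q n),
    cvg_ip ipH (fun n => te (p n)) w1, cvg_ip ipH (fun n => te (q n)) w2,
    cvg_ip ipH (fun n => te (k1 (p n) (q n))) g1 &
    cvg_ip ipH (fun n => te (k2 (p n) (q n))) g2].
Proof.
move=> wg; have [p [q [pq c1 c2]]] := K0_surjective g1 g2.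
have [cp cq _ _ _] := K0_cauchy pq c1 c2.
have [v1 pv] := cH cp; have [v2 qv] := cH cq.
have vg p' q' : bc p' q' -> ipH v1 (te (k1 p' q')) + ipH v2 (te (k2 p' q')) =
     - (ipH g1 (te p') + ipH g2 (te q')).
  move=> pq'.
  have L1 : (fun n => ipH (te (p n)) (te (k1 p' q')) + ipH (te (q n)) (te (k2 p' q'))) @ \oo -->
     ipH v1 (te (k1 p' q')) + ipH v2 (te (k2 p' q')) by apply: cvgD; exact: cvg_ip_ip.
  have L2 : (fun n => - (ipH (te (k1 (p n) (q n))) (te p') + ipH (te (k2 (p n) (q n))) (te q'))) @ \oo -->
     - (ipH g1 (te p') + ipH g2 (te q')) by apply: cvgN; apply: cvgD; exact: cvg_ip_ip.
  have E n : ipH (te (p n)) (te (k1 p' q')) + ipH (te (q n)) (te (k2 p' q')) =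
     - (ipH (te (k1 (p n) (q n))) (te p') + ipH (te (k2 (p n) (q n))) (te q')).
    by rewrite !ip_te -!(II_add ha hb); exact: (skew_identity ha hb (pq n) pq').
  by rewrite -(funext E) in L2; exact: (cvg_uniq L1 L2).
have d0 : ipH (w1 - v1) (w1 - v1) + ipH (w2 - v2) (w2 - v2) = 0.
  apply: (cokernel_trivial (ha := ha) (hb := hb)) => p' q' pq'.
  by rewrite /PW !(ipBl I); have := wg _ _ pq'; have := vg _ _ pq'; lra.
have n1 := ip_ge0 I (w1 - v1); have n2 := ip_ge0 I (w2 - v2).
have z1 : ipH (w1 - v1) (w1 - v1) = 0 by lra.
have z2 : ipH (w2 - v2) (w2 - v2) = 0 by lra.
exists p, q; split => //.
- exact: (cvg_ip_shift I pv z1).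
- exact: (cvg_ip_shift I qv z2).
Qed.

End Spectral.

(** * The first eigenvalue of the real operator *)

Section Minimiser.
Context (R : realType) (a b : R) (ha : 0 < a) (hb : 0 < b).
Local Notation II := (II a b).
Local Notation nn := (nn a b).
Local Notation ipH := (@ipH R a b).
Local Notation te := (te ha hb).
Local Notation ipHH := (ip2 ipH ipH).
Implicit Types (f g p q : tf R).

Let I := ipH_inner a b.
Let I2 := inner_ip2 I I.
Let cH := @ipH_complete R a b.
Let cHH := complete_ip2 I I cH cH.

Section Rellich.
Variables (u v : nat -> tf R) (be : nat -> R) (w : R).
Hypothesis hp : half_pair ha hb u v be w.

(** Eigenfunctions of the Laplacian, Dirichlet on [y = w] and Neumann on the other sides. Neumann
    conditions being natural, [p] has to vanish on [y = w] only. *)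
Definition bas (i : nat * nat) := MulT (ckT a i.1) (u i.2).
Definition eigv (i : nat * nat) : R := kap a i.1 ^+ 2 + alp b i.2 ^+ 2.

Lemma bas_w i x : ev (bas i) (x, w) = 0.
Proof. by rewrite /bas ev_mul (hp_u0 hp) mulr0. Qed.

Lemma ev_dx_bas i z : ev (dx (bas i)) z = - kap a i.1 * (ev (skT a i.1) z * ev (u i.2) z).
Proof. by rewrite /bas ev_dx_mul dx_ckT (hp_dxu hp); ring. Qed.

Lemma ev_dy_bas i z : ev (dy (bas i)) z = - be i.2 * (ev (ckT a i.1) z * ev (v i.2) z).
Proof. by rewrite /bas ev_dy_mul dy_ckT (hp_dyu hp); ring. Qed.

Lemma II_dx_bas p i : II (MulT (dx p) (dx (bas i))) = kap a i.1 ^+ 2 * II (MulT p (bas i)).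
Proof.
pose s := MulT (skT a i.1) (u i.2).
have : II (dx (MulT p s)) = 0.
  rewrite (II_dx ha hb) (Sy0 hb) => [|y]; last by rewrite 2!ev_mul skT_R// mul0r mulr0.
  by rewrite (Sy0 hb) ?subrr// => y; rewrite 2!ev_mul skT_L mul0r mulr0.
rewrite (@eq_II _ a b _ (AddT (MulT (dx p) s) (MulT (Cst (kap a i.1)) (MulT p (bas i))))); last first.
  move=> x y; rewrite ev_dx_mul [ev (dx s) _]ev_dx_mul dx_skT (hp_dxu hp).
  by rewrite ev_add !ev_mul ev_cst; ring.
rewrite (II_add ha hb) (II_scale ha hb) => /eqP; rewrite addr_eq0 => /eqP E.
rewrite (@eq_II _ a b _ (MulT (Cst (- kap a i.1)) (MulT (dx p) s))); last first.
  by move=> x y; rewrite ev_mul ev_dx_bas !ev_mul ev_cst; ring.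
by rewrite (II_scale ha hb) E; ring.
Qed.

Lemma II_dy_bas p i : (forall x, ev p (x, w) = 0) ->
  II (MulT (dy p) (dy (bas i))) = alp b i.2 ^+ 2 * II (MulT p (bas i)).
Proof.
move=> p0; pose s := MulT (ckT a i.1) (v i.2).
have Z (x : R) : ev (MulT p s) (x, w) = 0 by rewrite ev_mul p0 mul0r.
have Z' (x : R) : ev (MulT p s) (x, - w) = 0.
  by rewrite ev_mul [ev s _]ev_mul (hp_v0 hp) !mulr0.
have : II (dy (MulT p s)) = 0.
  rewrite (II_dy ha hb); case: (hp_w hp) => wE; rewrite wE in Z Z'.
    by rewrite (Sx0 ha Z) (Sx0 ha) ?subrr// => x; rewrite mulNr.
  by rewrite (Sx0 ha Z) (Sx0 ha) ?subrr// => x; have := Z' x; rewrite mulNr opprK.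
rewrite (@eq_II _ a b _ (AddT (MulT (dy p) s) (MulT (Cst (be i.2)) (MulT p (bas i))))); last first.
  move=> x y; rewrite ev_dy_mul [ev (dy s) _]ev_dy_mul dy_ckT (hp_dyv hp).
  by rewrite ev_add !ev_mul ev_cst; ring.
rewrite (II_add ha hb) (II_scale ha hb) => /eqP; rewrite addr_eq0 => /eqP E.
rewrite (@eq_II _ a b _ (MulT (Cst (- be i.2)) (MulT (dy p) s))); last first.
  by move=> x y; rewrite ev_mul ev_dy_bas !ev_mul ev_cst; ring.
by rewrite (II_scale ha hb) E -(hp_be2 hp); ring.
Qed.

Lemma kap_ge0 k : 0 <= kap a k.
Proof. by rewrite /kap mulr_ge0 ?ler0n// divr_ge0 ?pi_ge0// ltW. Qed.

Lemma kap_inj k l : kap a k ^+ 2 = kap a l ^+ 2 -> k = l.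
Proof.
have pa : 0 < pi / a by rewrite divr_gt0 ?pi_gt0.
move=> /eqP; rewrite eqrXn2 ?kap_ge0// => /eqP /(mulIf (lt0r_neq0 pa)) /eqP.
by rewrite eqr_nat => /eqP.
Qed.

Lemma alp_inj k l : alp b k ^+ 2 = alp b l ^+ 2 -> k = l.
Proof.
have pb : 0 < pi / b by rewrite divr_gt0 ?pi_gt0.
move=> /eqP; rewrite eqrXn2// ?ltW ?alp_gt0// => /eqP /(mulIf (lt0r_neq0 pb)) /addIr /eqP.
by rewrite eqr_nat => /eqP.
Qed.

Lemma II_mulC f g : II (MulT f g) = II (MulT g f).
Proof. by apply: eq_II => x y /=; rewrite mulrC. Qed.

(** The Dirichlet form is symmetric in each direction separately, so two modes with non-zero product
    share both frequencies. *)
Lemma bas_orth i j : i != j -> ipH (te (bas i)) (te (bas j)) = 0.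
Proof.
move=> ij; rewrite ip_te.
have Ex : kap a j.1 ^+ 2 * II (MulT (bas i) (bas j)) = kap a i.1 ^+ 2 * II (MulT (bas i) (bas j)).
  by rewrite -II_dx_bas II_mulC II_dx_bas II_mulC.
have Ey : alp b j.2 ^+ 2 * II (MulT (bas i) (bas j)) = alp b i.2 ^+ 2 * II (MulT (bas i) (bas j)).
  by rewrite -II_dy_bas 1?II_mulC ?II_dy_bas 1?II_mulC//; exact: bas_w.
apply/eqP/negPn/negP => n0; move/negP: ij; apply.
have /kap_inj e1 := mulIf n0 Ex; have /alp_inj e2 := mulIf n0 Ey.
by apply/eqP; case: (i) (j) e1 e2 => i1 i2 [j1 j2] /= -> ->.
Qed.

Lemma grad_bas p i : (forall x, ev p (x, w) = 0) ->
  ipHH (te (dx p), te (dy p)) (te (dx (bas i)), te (dy (bas i))) =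
  eigv i * ipH (te p) (te (bas i)).
Proof.
by move=> p0; rewrite /ip2 !ip_te II_dx_bas II_dy_bas// /eigv mulrDl.
Qed.

(** Only finitely many modes have an eigenvalue below [e^-1]; the tail is bounded by [e] times the
    energy. *)
Lemma rellich e : 0 < e -> exists (s : seq (nat * nat)) C, 0 <= C /\
  forall p, (forall x, ev p (x, w) = 0) ->
  nn p <= C * \sum_(i <- s) ipH (te p) (te (bas i)) ^+ 2 + e * (nn (dx p) + nn (dy p)).
Proof.
move=> e0.
pose c0 : R := Num.min ((pi / a) ^+ 2) ((pi / b) ^+ 2).
have c00 : 0 < c0 by rewrite lt_min !exprn_gt0 ?divr_gt0 ?pi_gt0.
(* Outside the [N] by [N] square one index is at least [N], so the eigenvalue is at least
   [N ^+ 2 * c0], hence at least [e^-1]. *)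
pose N := (Num.truncn (e^-1 / c0)).+1.
have HN : e^-1 <= N%:R ^+ 2 * c0.
  rewrite -ler_pdivrMr//; apply: (@le_trans _ _ N%:R).
    by apply: ltW; exact: truncnS_gt.
  by rewrite expr2 ler_peMr ?ler0n// ler1n.
pose s := [seq (k, l) | k <- iota 0 N, l <- iota 0 N].
have us : uniq s.
  by apply: allpairs_uniq; [exact: iota_uniq|exact: iota_uniq|move=> [? ?] [? ?]].
exists s, (\sum_(i <- s) (ipH (te (bas i)) (te (bas i)))^-1); split.
  by apply: sumr_ge0 => i _; rewrite invr_ge0 ip_ge0.
move=> p p0.
have L0 : 0 < e^-1 by rewrite invr_gt0.
have sl i : i \notin s -> e^-1 <= eigv i.
  move=> is_; apply: (le_trans HN).
  have : (N <= i.1)%N || (N <= i.2)%N.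
    rewrite -[_ || _]negbK negb_or -!ltnNge; apply: contra is_ => /andP[i1 i2].
    by apply/allpairsP; exists i; rewrite !mem_iota /= !add0n; split => //; case: (i).
  case/orP => Ni.
    apply: (@le_trans _ _ (kap a i.1 ^+ 2)); last by rewrite /eigv lerDl sqr_ge0.
    rewrite /kap exprMn; apply: ler_pM; rewrite ?sqr_ge0 ?(ltW c00)//.
      by rewrite lerXn2r// ?nnegrE ?ler0n// ler_nat.
    by rewrite ge_min lexx.
  apply: (@le_trans _ _ (alp b i.2 ^+ 2)); last by rewrite /eigv lerDr sqr_ge0.
  rewrite /alp exprMn; apply: ler_pM; rewrite ?sqr_ge0 ?(ltW c00)//.
    rewrite lerXn2r// ?nnegrE ?ler0n ?addr_ge0//.
    by apply: (@le_trans _ _ i.2%:R); rewrite ?ler_nat ?lerDl.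
  by rewrite ge_min lexx orbT.
have := @spectral_tail _ _ _ I _ (fun i => te (bas i)) bas_orth cH _ _ _ I2
  (fun i => (te (dx (bas i)), te (dy (bas i)))) eigv _ (te p) (te (dx p), te (dy p)) s e^-1 L0 us _ sl.
rewrite invrK nsq_te => H1.
apply: (le_trans (H1 _ _ _)).
- by move=> f f0; apply: (hp_cu hp) => k l; exact: (f0 (k, l)).
- by move=> i j; rewrite (ip_sym I2) grad_bas ?(ip_sym I (te (bas j)))//; exact: bas_w.
- by move=> i; exact: grad_bas.
apply: lerD; last by [].
rewrite mulr_sumr big_seq [leRHS]big_seq; apply: ler_sum => i is_.
rewrite mulrC ler_wpM2r ?sqr_ge0// (bigD1_seq i)//= lerDl.
by apply: sumr_ge0 => j _; rewrite invr_ge0 ip_ge0.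
Qed.

End Rellich.
End Minimiser.

(** * Minimisation of a Rayleigh quotient over a graph *)

Section RayleighQuotient.
Context (R : realType) (V W : lmodType R) (ipV : V -> V -> R) (ipW : W -> W -> R).
Hypotheses (IV : inner ipV) (IW : inner ipW).
Hypotheses (cV : complete_ip ipV) (cW : complete_ip ipW).
Variable (U : V * W -> Prop).
Hypothesis HU : subspace U.

Lemma quadratic_ge0_lin (s t : R) : (forall x : R, 0 <= 2 * x * s + x ^+ 2 * t) -> s = 0.
Proof.
move=> H; have t0 : 0 <= t by have := H 1; have := H (-1); lra.
apply/eqP/negPn/negP => s0; have t1 : 0 < t + 1 by lra.
have := H (- (s / (t + 1))).
rewrite [X in 0 <= X](_ : _ = - (s ^+ 2 * (t + 2) / (t + 1) ^+ 2)); last by field; rewrite gt_eqF.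
rewrite oppr_ge0 leNgt => /negP; apply.
by rewrite divr_gt0 ?exprn_gt0// mulr_gt0 ?exprn_even_gt0//; lra.
Qed.

(* A minimising sequence of the Rayleigh quotient [|z.2|^2 / |z.1|^2] over a
   graph [U], convergent by compactness and the parallelogram law. *)
Lemma rayleigh_minimiser (c : R) : 0 < c ->
  (forall z, U z -> ipV z.1 z.1 <= c * ipW z.2 z.2) ->
  (exists2 z, U z & 0 < ipV z.1 z.1) ->
  (forall z : nat -> V * W, (forall n, U (z n)) ->
     (exists M, forall n, ipW (z n).2 (z n).2 <= M) ->
     exists phi : nat -> nat, (forall k, (k <= phi k)%N) /\
       cauchy_ip ipV (fun k => (z (phi k)).1)) ->
  exists mu (x : V) (y : W) (z : nat -> V * W),
   [/\ 0 < mu, ipV x x = 1,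
       forall n, U (z n), cvg_ip ipV (fun n => (z n).1) x /\ cvg_ip ipW (fun n => (z n).2) y &
       (forall z, U z -> mu * ipV z.1 z.1 <= ipW z.2 z.2) /\
       (forall z, U z -> ipW y z.2 = mu * ipV x z.1)].
Proof.
move=> c0 Uc [zt Uzt zt0] Ucomp.
pose D := [set ipW z.2 z.2 / ipV z.1 z.1 | z in [set z | U z /\ 0 < ipV z.1 z.1]].
have D0 : D !=set0 by exists (ipW zt.2 zt.2 / ipV zt.1 zt.1); exists zt.
have lbD : lbound D c^-1.
  move=> _ [z [Uz z0] <-]; rewrite ler_pdivlMr// mulrC ler_pdivrMr//.
  by rewrite mulrC; exact: Uc.
have hD : has_inf D by split => //; exists c^-1.
pose mu := inf D.
have mu0 : 0 < mu.
  by apply: (@lt_le_trans _ _ c^-1); rewrite ?invr_gt0//; exact: lb_le_inf.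
have mule z : U z -> mu * ipV z.1 z.1 <= ipW z.2 z.2.
  move=> Uz; have [z0|z0] := ltrP 0 (ipV z.1 z.1).
    rewrite -ler_pdivlMr//; apply: ge_inf; [by exists c^-1|by exists z].
  have -> : ipV z.1 z.1 = 0 by apply/eqP; rewrite eq_le z0 (ip_ge0 IV).
  by rewrite mulr0 (ip_ge0 IW).
have /choice[z0 Hz0] : forall n : nat, exists z,
    [/\ U z, ipV z.1 z.1 = 1 & ipW z.2 z.2 <= mu + n.+1%:R^-1].
  move=> n; have n0 : 0 < n.+1%:R^-1 :> R by rewrite invr_gt0.
  have [_ [z [Uz z0] <-] H] := inf_adherent n0 hD.
  have s0 : Num.sqrt (ipV z.1 z.1) != 0 by rewrite gt_eqF// sqrtr_gt0.
  pose s := (Num.sqrt (ipV z.1 z.1))^-1.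
  have s2 : s ^+ 2 = (ipV z.1 z.1)^-1 by rewrite exprVn sqr_sqrtr// ltW.
  exists (s *: z); split; first exact: subspaceZ.
    by rewrite (nsqZ IV) s2 mulVf// gt_eqF.
  by rewrite (nsqZ IW) s2 mulrC ltW.
have h1 (n : nat) : n.+1%:R^-1 <= 1 :> R by rewrite invf_le1 ?ler1n.
have [phi [phik cphi]] : exists phi : nat -> nat, (forall k, (k <= phi k)%N) /\
       cauchy_ip ipV (fun k => (z0 (phi k)).1).
  apply: Ucomp; first by move=> n; case: (Hz0 n).
  by exists (mu + 1) => n; have [_ _ H] := Hz0 n; apply: (le_trans H); rewrite lerD2l.
pose z n := z0 (phi n).
have Hz n : [/\ U (z n), ipV (z n).1 (z n).1 = 1 & ipW (z n).2 (z n).2 <= mu + n.+1%:R^-1].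
  have [U1 U2 U3] := Hz0 (phi n); split => //; apply: (le_trans U3).
  by rewrite lerD2l lef_pV2 ?posrE// ler_nat; exact: phik.
(* Parallelogram law: the lower bound [mule] for [z i + z j] turns almost minimality of both into
   closeness of the images, up to the distance of the first components. *)
have par i j : ipW ((z i).2 - (z j).2) ((z i).2 - (z j).2) <=
    mu * ipV ((z i).1 - (z j).1) ((z i).1 - (z j).1) + 2 * (i.+1%:R^-1 + j.+1%:R^-1).
  have [Ui Ni Wi] := Hz i; have [Uj Nj Wj] := Hz j.
  have := mule _ (subspaceD HU Ui Uj); rewrite /= (nsqD IV) (nsqD IW) (nsqB IV) (nsqB IW) Ni Nj.
  by move: (i.+1%:R^-1) (j.+1%:R^-1) Wi Wj => p q; lra.
have cW2 : cauchy_ip ipW (fun n => (z n).2).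
  move=> e e0.
  have e8 : 0 < e / 8 by rewrite divr_gt0.
  have em : 0 < e / (2 * mu) by rewrite divr_gt0// mulr_gt0.
  have /cvgrPdist_le/(_ _ e8)[N _ HN] := @cvg_harmonic R.
  have [N2 HN2] := cphi _ em.
  exists (maxn N N2) => i j; rewrite !geq_max => /andP[i1 i2] /andP[j1 j2].
  have := HN i i1; have := HN j j1; rewrite /= /harmonic !sub0r !normrN !ger0_norm ?invr_ge0//.
  have := HN2 i j i2 j2; rewrite -(ler_pM2l mu0) (_ : mu * (e / _) = e / 2); last by field; rewrite gt_eqF.
  by have := par i j; rewrite /z; move: (i.+1%:R^-1) (j.+1%:R^-1) => p q; lra.
have [x zx] := cV cphi; have [y zy] := cW cW2.
have nx : ipV x x = 1.
  have := cvg_ip_nsq IV zx.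
  rewrite (_ : (fun n => _) = fun=> 1); first by move=> /cvg_cst_eq.
  by apply/funext => n; case: (Hz n).
have ny : ipW y y <= mu.
  have L2 : (fun n => mu + n.+1%:R^-1) @ \oo --> mu + 0.
    by apply: cvgD; [exact: cvg_cst|exact: cvg_harmonic].
  rewrite addr0 in L2; apply: (ler_cvg_to (cvg_ip_nsq IW zy) L2).
  by apply: nearW => n; case: (Hz n).
exists mu, x, y, z; split => //; first by move=> n; case: (Hz n).
split => // v Uv; apply/eqP; rewrite -subr_eq0; apply/eqP.
(* First variation: [mu * |x + t v.1|^2 <= |y + t v.2|^2] for all [t], and [ny] with [nx] makes the
   constant term of the difference non-positive, so its linear coefficient vanishes. *)
apply: (@quadratic_ge0_lin _ (ipW v.2 v.2 - mu * ipV v.1 v.1)) => t.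
have : mu * ipV (x + t *: v.1) (x + t *: v.1) <= ipW (y + t *: v.2) (y + t *: v.2).
  have L1 : (fun n => mu * ipV ((z n).1 + t *: v.1) ((z n).1 + t *: v.1)) @ \oo -->
     mu * ipV (x + t *: v.1) (x + t *: v.1).
    apply: cvgM; first exact: cvg_cst.
    apply: (cvg_ip_nsq IV (u := fun n => (z n).1 + t *: v.1)); apply: (cvg_ipD IV) => //.
    by rewrite /cvg_ip; under eq_fun do rewrite subrr (ip0l IV); exact: cvg_cst.
  have L2 : (fun n => ipW ((z n).2 + t *: v.2) ((z n).2 + t *: v.2)) @ \oo -->
     ipW (y + t *: v.2) (y + t *: v.2).
    apply: (cvg_ip_nsq IW (u := fun n => (z n).2 + t *: v.2)); apply: (cvg_ipD IW) => //.
    by rewrite /cvg_ip; under eq_fun do rewrite subrr (ip0l IW); exact: cvg_cst.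
  apply: (ler_cvg_to L1 L2); apply: nearW => n.
  apply: (mule ((z n) + t *: v)); apply: subspaceD => //; first by case: (Hz n).
  exact: subspaceZ.
rewrite (nsqD IV) (nsqD IW) (ipZr IV) (ipZr IW) (nsqZ IV) (nsqZ IW) nx; lra.
Qed.

End RayleighQuotient.

Section Minimiser.
Context (R : realType) (a b : R) (ha : 0 < a) (hb : 0 < b).
Local Notation II := (II a b).
Local Notation nn := (nn a b).
Local Notation H := (H2 a b).
Local Notation ipH := (@ipH R a b).
Local Notation te := (te ha hb).
Local Notation ipHH := (ip2 ipH ipH).
Local Notation bc := (bc a b).
Implicit Types (f g p q : tf R).

Let I := ipH_inner a b.
Let I2 := inner_ip2 I I.
Let cH := @ipH_complete R a b.
Let cHH := complete_ip2 I I cH cH.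

Variables (m : R) (hm : 0 <= m).

(** By continuity [p] is non-zero on a small square, which has positive measure. *)
Lemma nn_gt0 (x y : R) p : rectangle a b (x, y) -> ev p (x, y) != 0 -> 0 < nn p.
Proof.
move=> Oz pz; rewrite lt_neqAle nn_ge0 andbT eq_sym; apply/negP => /eqP p0.
have : {ae leb2 R, forall z, rectangle a b z -> te p z = 0} by exact: nsq0_ae.
move=> [N [mN N0 NH]].
have [d d0 Hd] : exists2 d : R, 0 < d & forall u v, `|x - u| < d -> `|y - v| < d ->
    rectangle a b (u, v) /\ ev p (u, v) != 0.
  have : nbhs (x, y) [set z | rectangle a b z /\ ev p z != 0].
    apply: filterI.
      case: Oz => Ox Oy; exists (`]- a / 2, a / 2[%classic, `]- b / 2, b / 2[%classic) => //=.
      by split; apply: open_nbhs_nbhs; split => //; exact: interval_open.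
    exact: (cvgr_neq0 _ (@continuous_ev _ p (x, y)) pz).
  by move=> /nbhs_ballP[d d0 Hd]; exists d => // u v xu yv; apply: (Hd (u, v)).
pose B := `]x - d, x + d[%classic `*` `]y - d, y + d[%classic : set (R * R).
have mB : measurable (B : set (measurableTypeR R * measurableTypeR R)) by exact: measurableX.
have : (leb2 R) B = 0%E.
  apply: (subset_measure0 mB mN _ N0) => -[u v] [/=]; rewrite !in_itv/= => xu yv.
  have [Ouv puv] : rectangle a b (u, v) /\ ev p (u, v) != 0.
    by apply: Hd; rewrite ltr_norml; apply/andP; split; lra.
  by apply: NH => /= /(_ Ouv) /eqP; rewrite (negbTE puv).
rewrite product_measure1E; try exact: measurable_itv.
have L (t : R) : (leb R) `]t - d, t + d[%classic = (2 * d)%:E.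
  rewrite lebesgue_measure_itv/= lte_fin ifT; last by lra.
  by rewrite -EFinD; congr EFin; ring.
move=> H; have {H} : ((2 * d)%:E * (2 * d)%:E = 0)%E by rewrite -{1}(L x) -(L y).
by rewrite -EFinM => /eqP; rewrite eqe mulf_eq0 => /orP[] /eqP; lra.
Qed.

Definition kk1 p q := SubT (k1 p q) (MulT (Cst m) q).
Definition kk2 p q := AddT (k2 p q) (MulT (Cst m) p).

Lemma energy_ge p q : bc p q ->
  nn (k1 p q) + nn (k2 p q) + m ^+ 2 * (nn p + nn q) <= nn (kk1 p q) + nn (kk2 p q).
Proof.
move=> pq; have M0 := mass_term_ge0 ha hb pq.
have -> : nn (kk1 p q) + nn (kk2 p q) = nn (k1 p q) + nn (k2 p q) + m ^+ 2 * (nn p + nn q) +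
    2 * m * II (AddT (MulT (k1 p q) (OppT q)) (MulT (k2 p q) p)).
  rewrite /nn mulrDr -!(II_scale ha hb) -!(II_add ha hb); apply: eq_II => x y.
  by rewrite /=; ring.
by rewrite lerDl mulr_ge0// mulr_ge0.
Qed.

Lemma energy_ge0 p q : bc p q ->
  nn (k1 p q) + nn (k2 p q) <= nn (kk1 p q) + nn (kk2 p q).
Proof.
move=> pq; apply: le_trans (energy_ge pq); rewrite lerDl mulr_ge0 ?sqr_ge0//.
by rewrite addr_ge0 ?nn_ge0.
Qed.

Definition dgraph (z : (H * H) * (H * H)) := exists p q, bc p q /\
  z = ((te p, te q), (te (kk1 p q), te (kk2 p q))).

Lemma subspace_dgraph : subspace dgraph.
Proof.
split.
  exists (Cst 0), (Cst 0); split; first by split=> t /=; rewrite ?oppr0.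
  transitivity (((0 *: te (Cst 0), 0 *: te (Cst 0)), (0 *: te (Cst 0), 0 *: te (Cst 0))) : (H * H) * (H * H)).
    by rewrite !scale0r.
  by do 2![congr pair]; rewrite -te_scale; apply: te_ext => x y /=; ring.
move=> r _ _ [p [q [pq ->]]] [p' [q' [pq' ->]]].
exists (AddT (MulT (Cst r) p) p'), (AddT (MulT (Cst r) q) q').
split; first exact: bc_lin.
transitivity (((r *: te p + te p', r *: te q + te q'), (r *: te (kk1 p q) + te (kk1 p' q'),
   r *: te (kk2 p q) + te (kk2 p' q'))) : (H * H) * (H * H)) => //.
by do 2![congr pair]; rewrite -te_scale -te_add; apply: te_ext => x y /=; ring.
Qed.

Lemma norm_le_sqr (x : R) : `|x| <= 1 + x ^+ 2.
Proof.
rewrite -[x ^+ 2]real_normK ?num_real//; have := sqr_ge0 (`|x| - 1).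
by have := normr_ge0 x; nra.
Qed.

(** Rellich's inequality is applied with two bases, one vanishing on the top for [p] and one
    vanishing on the bottom for [q]; the tracked coefficients are bounded because the energy bounds
    the norms. *)
Lemma dgraph_compact (z : nat -> (H * H) * (H * H)) : (forall n, dgraph (z n)) ->
  (exists M, forall n, ipHH (z n).2 (z n).2 <= M) ->
  exists phi : nat -> nat, (forall k, (k <= phi k)%N) /\
    cauchy_ip ipHH (fun k => (z (phi k)).1).
Proof.
move=> /choice[p /choice[q Hz]] [M0 HM0].
pose M := `|M0| + 1.
have M1 : 0 < M by rewrite /M ltr_wpDl.
have HM n : ipHH (z n).2 (z n).2 <= M.
  by apply: (le_trans (HM0 n)); rewrite /M; have := ler_norm M0; lra.
pose hc := half_pair_cs ha hb; pose hs := half_pair_sc ha hb.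
pose e1 i := te (bas a (@cT R b) i); pose e2 i := te (bas a (@sT R b) i).
pose x n (i : bool * (nat * nat)) : R :=
  if i.1 then ipH (te (p n)) (e1 i.2) else ipH (te (q n)) (e2 i.2).
pose d n k := nn (SubT (p n) (p k)) + nn (SubT (q n) (q k)).
have b0 : 0 <= 4 * b ^+ 2 by rewrite mulr_ge0// sqr_ge0.
have bnd n : nn (p n) <= 4 * b ^+ 2 * M /\ nn (q n) <= 4 * b ^+ 2 * M.
  have [pq zE] := Hz n; have [B1 B2 _ _ _] := bc_bounds ha hb pq.
  have := HM n; rewrite zE /ip2/= !nsq_te => H1.
  have := le_trans (energy_ge0 pq) H1 => /(ler_wpM2l b0) H2.
  by split; [exact: le_trans B1 H2|exact: le_trans B2 H2].
have gr n k : grad a b (SubT (p n) (p k)) (SubT (q n) (q k)) <= 4 * M.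
  have [pqn zn] := Hz n; have [pqk zk] := Hz k.
  rewrite /grad -(energy_identity ha hb (bc_sub pqn pqk)).
  apply: (le_trans (energy_ge0 (bc_sub pqn pqk))).
  have -> : nn (kk1 (SubT (p n) (p k)) (SubT (q n) (q k))) +
      nn (kk2 (SubT (p n) (p k)) (SubT (q n) (q k))) = ipHH ((z n).2 - (z k).2) ((z n).2 - (z k).2).
    by rewrite zn zk /ip2/= !nsq_te_sub; congr (_ + _); apply: eq_II => ? ? /=; ring.
  by have := nsqB_le I2 (z n).2 (z k).2; have := HM n; have := HM k; lra.
have [||phi [phik Hphi]] := @subsequence_cauchy R _ x d.
- move=> [[] i].
    exists (1 + 4 * b ^+ 2 * M * ipH (e1 i) (e1 i)) => n.
    apply: (le_trans (norm_le_sqr _)); rewrite lerD2l.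
    apply: (le_trans (cauchy_schwarz I _ _)); rewrite ler_wpM2r ?(ip_ge0 I)//.
    by case: (bnd n).
  exists (1 + 4 * b ^+ 2 * M * ipH (e2 i) (e2 i)) => n.
  apply: (le_trans (norm_le_sqr _)); rewrite lerD2l.
  apply: (le_trans (cauchy_schwarz I _ _)); rewrite ler_wpM2r ?(ip_ge0 I)//.
  by case: (bnd n).
(* The gradient energy of a difference of two members of the sequence is at most [4 * M]. *)
- move=> e e0; have e8 : 0 < e / (4 * M) by rewrite divr_gt0// mulr_gt0.
  have [s1 [C1 [C10 R1]]] := rellich hc e8; have [s2 [C2 [C20 R2]]] := rellich hs e8.
  exists ([seq (true, i) | i <- s1] ++ [seq (false, i) | i <- s2]), (C1 + C2).
  split; first exact: addr_ge0.
  move=> n k; have [[pT1 qB1 _ _] _] := Hz n; have [[pT2 qB2 _ _] _] := Hz k.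
  have D1 t : ev (SubT (p n) (p k)) (t, b / 2) = 0 by rewrite ev_sub pT1 pT2 subrr.
  have D2 t : ev (SubT (q n) (q k)) (t, - b / 2) = 0 by rewrite ev_sub qB1 qB2 subrr.
  have H1 := R1 _ D1; have H2 := R2 _ D2.
  rewrite big_cat !big_map /=.
  rewrite [X in C1 * X](eq_bigr (fun i => (x n (true, i) - x k (true, i)) ^+ 2)) in H1; last first.
    by move=> i _; rewrite te_sub (ipBl I).
  rewrite [X in C2 * X](eq_bigr (fun i => (x n (false, i) - x k (false, i)) ^+ 2)) in H2; last first.
    by move=> i _; rewrite te_sub (ipBl I).
  have H3 : e / (4 * M) * grad a b (SubT (p n) (p k)) (SubT (q n) (q k)) <= e.
    by rewrite mulrAC ler_pdivrMr ?mulr_gt0// ler_pM2l// gr.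
  move: H3; rewrite /grad => H3.
  move: H1 H2; set X1 := \sum_(i <- s1) _; set X2 := \sum_(i <- s2) _ => H1 H2.
  have X10 : 0 <= X1 by apply: sumr_ge0 => i _; rewrite sqr_ge0.
  have X20 : 0 <= X2 by apply: sumr_ge0 => i _; rewrite sqr_ge0.
  have H4 := mulr_ge0 C10 X20; have H5 := mulr_ge0 C20 X10.
  rewrite /d; move: H1 H2 H3 H4 H5.
  move: (nn (SubT (p n) (p k))) (nn (SubT (q n) (q k))) (nn (dx (SubT (p n) (p k)))) => A1 A2 A3.
  move: (nn (dy (SubT (p n) (p k)))) (nn (dx (SubT (q n) (q k)))) (nn (dy (SubT (q n) (q k)))) => A4 A5 A6.
  by move: (e / (4 * M)) => E; lra.
exists phi; split => // e /Hphi[N HN]; exists N => i j Ni Nj.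
have [_ zi] := Hz (phi i); have [_ zj] := Hz (phi j).
by rewrite zi zj /ip2/= !nsq_te_sub; exact: HN.
Qed.

Lemma oppB_sub (Z : zmodType) (x y : Z) : - (x - y) - y = - x.
Proof. by rewrite opprB addrAC subrr sub0r. Qed.

Lemma oppD_add (Z : zmodType) (x y : Z) : - (x + y) + y = - x.
Proof. by rewrite opprD subrK. Qed.

(* The first eigenvalue [lam ^+ 2] of the square of [K] and an eigenvector [P]
   of it give, with [Q = - K P / lam], the eigenpair [K P = - lam Q], [K Q = lam P]. *)
Lemma first_eigenpair : exists (lam : R) (P1 P2 Q1 Q2 : H) (p q r s : nat -> tf R),
  [/\ 0 < lam, ipH P1 P1 + ipH P2 P2 = 1,
      forall p q, bc p q -> lam ^+ 2 * (nn p + nn q) <= nn (kk1 p q) + nn (kk2 p q),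
      [/\ forall n, bc (p n) (q n), cvg_ip ipH (fun n => te (p n)) P1,
          cvg_ip ipH (fun n => te (q n)) P2,
          cvg_ip ipH (fun n => te (kk1 (p n) (q n))) (- lam *: Q1) &
          cvg_ip ipH (fun n => te (kk2 (p n) (q n))) (- lam *: Q2)] &
      [/\ forall n, bc (r n) (s n), cvg_ip ipH (fun n => te (r n)) Q1,
          cvg_ip ipH (fun n => te (s n)) Q2,
          cvg_ip ipH (fun n => te (kk1 (r n) (s n))) (lam *: P1) &
          cvg_ip ipH (fun n => te (kk2 (r n) (s n))) (lam *: P2)]].
Proof.
have b0 : 0 < 8 * b ^+ 2 by rewrite mulr_gt0// exprn_gt0.
have [mu [[P1 P2] [[Z1 Z2] [z [mu0 nP zU [zP zZ] [mule EL]]]]]] :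
  exists mu (x : H * H) (y : H * H) (z : nat -> (H * H) * (H * H)),
   [/\ 0 < mu, ipHH x x = 1,
       forall n, dgraph (z n), cvg_ip ipHH (fun n => (z n).1) x /\ cvg_ip ipHH (fun n => (z n).2) y &
       (forall z, dgraph z -> mu * ipHH z.1 z.1 <= ipHH z.2 z.2) /\
       (forall z, dgraph z -> ipHH y z.2 = mu * ipHH x z.1)].
  apply: (rayleigh_minimiser I2 I2 cHH cHH subspace_dgraph b0); last exact: dgraph_compact.
    move=> _ [p [q [pq ->]]]; rewrite /ip2/= !nsq_te.
    have [B1 B2 _ _ _] := bc_bounds ha hb pq.
    have b00 : 0 <= 4 * b ^+ 2 by rewrite mulr_ge0// sqr_ge0.
    have := ler_wpM2l b00 (energy_ge0 pq); lra.
  (* Vanishes on the top and on both vertical sides, so [(f, 0)] satisfies the boundary conditions;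
     it shows that the graph contains a vector of positive norm. *)
  pose f := MulT (SubT (Cst (a ^+ 2 / 4)) (sqT VX)) (SubT (Cst (b / 2)) VY) : tf R.
  exists ((te f, te (Cst 0)), (te (kk1 f (Cst 0)), te (kk2 f (Cst 0)))).
    exists f, (Cst 0); split => //; split => t; rewrite /f ?ev_mul ?ev_sub /=.
    - by rewrite subrr mulr0.
    - by [].
    - by field.
    - by field.
  rewrite /ip2/= !nsq_te ltr_wpDr ?nn_ge0//; apply: (@nn_gt0 0 0).
  - by move: ha hb => a0 b0'; split; rewrite /= in_itv/=; apply/andP; split; lra.
  - rewrite /f ev_mul !ev_sub /= mulr0 !subr0 mulf_neq0//.
      by rewrite mulf_neq0// expf_neq0// gt_eqF.
    by rewrite mulf_neq0// gt_eqF.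
have /choice[p /choice[q Hz]] := zU.
have [/= p1 q2] := (cvg_ip2 _ _ I I).1 zP.
have [/= y1 y2] := (cvg_ip2 _ _ I I).1 zZ.
(* The Euler-Lagrange equation says that [Z = K P] solves [K^* Z = mu P] weakly. With the mass terms
   moved into the data it becomes a weak massless equation. *)
have [|r' [s' [rs rZ sZ k1g k2g]]] := @weak_strong _ _ _ ha hb Z1 Z2
    (- (mu *: P1 - m *: Z2)) (- (mu *: P2 + m *: Z1)).
  move=> p' q' pq'.
  have D1 : dgraph ((te p', te q'), (te (kk1 p' q'), te (kk2 p' q'))) by exists p', q'.
  have := EL _ D1; rewrite /ip2/=.
  have -> : te (kk1 p' q') = te (k1 p' q') - m *: te q' by rewrite -te_scale -te_sub.
  have -> : te (kk2 p' q') = te (k2 p' q') + m *: te p' by rewrite -te_scale -te_add.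
  rewrite !(ipNl I) !(ipBl I, ipBr I, ipDl I, ipDr I) !(ipZl I, ipZr I).
  by move: (te p') (te q') (te (k1 p' q')) (te (k2 p' q')) => *; lra.
pose lam := Num.sqrt mu.
have lam0 : 0 < lam by rewrite sqrtr_gt0.
have lam2 : lam ^+ 2 = mu by rewrite sqr_sqrtr// ltW.
have lamn : lam != 0 by rewrite gt_eqF.
pose Q1 := - lam^-1 *: Z1; pose Q2 := - lam^-1 *: Z2.
have ZQ (Z : H) : - lam *: (- lam^-1 *: Z) = Z by rewrite scalerA mulrNN mulfV// scale1r.
have lamP (P : H) : - lam^-1 *: (- (mu *: P)) = lam *: P.
  by rewrite scalerN scaleNr opprK scalerA -lam2 expr2 mulrA mulVf// mul1r.
exists lam, P1, P2, Q1, Q2, p, q, (fun n => MulT (Cst (- lam^-1)) (r' n)), (fun n => MulT (Cst (- lam^-1)) (s' n)).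
split; [exact: lam0|exact: nP| | |].
- move=> p' q' pq'; rewrite lam2 -!nsq_te.
  by apply: (mule ((te p', te q'), (te (kk1 p' q'), te (kk2 p' q')))); exists p', q'.
- split; first by move=> n; case: (Hz n).
  + rewrite (_ : (fun n => _) = fun n => (z n).1.1); first exact: p1.
    by apply/funext => n; rewrite (Hz n).2.
  + rewrite (_ : (fun n => _) = fun n => (z n).1.2); first exact: q2.
    by apply/funext => n; rewrite (Hz n).2.
  + rewrite ZQ (_ : (fun n => _) = fun n => (z n).2.1); first exact: y1.
    by apply/funext => n; rewrite (Hz n).2.
  + rewrite ZQ (_ : (fun n => _) = fun n => (z n).2.2); first exact: y2.
    by apply/funext => n; rewrite (Hz n).2.
split.
- move=> n; have [A1 A2 A3 A4] := rs n; split=> t; rewrite !ev_mul !ev_cst.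
  + by rewrite A1 mulr0.
  + by rewrite A2 mulr0.
  + by rewrite A3 mulrN.
  + by rewrite A4.
- rewrite (_ : (fun n => _) = fun n => - lam^-1 *: te (r' n)); first exact: (cvg_ipZ I).
  by apply/funext => n; rewrite te_scale.
- rewrite (_ : (fun n => _) = fun n => - lam^-1 *: te (s' n)); first exact: (cvg_ipZ I).
  by apply/funext => n; rewrite te_scale.
- rewrite -lamP -(oppB_sub (mu *: P1) (m *: Z2)).
  rewrite (_ : (fun n => _) = fun n => - lam^-1 *: (te (k1 (r' n) (s' n)) - m *: te (s' n))).
    by apply: (cvg_ipZ I); apply: (cvg_ipB I) => //; exact: (cvg_ipZ I).
  by apply/funext => n; rewrite -(te_scale _ _ m) -te_sub -te_scale; apply: te_ext => x y /=; ring.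
- rewrite -lamP -(oppD_add (mu *: P2) (m *: Z1)).
  rewrite (_ : (fun n => _) = fun n => - lam^-1 *: (te (k2 (r' n) (s' n)) + m *: te (r' n))).
    by apply: (cvg_ipZ I); apply: (cvg_ipD I) => //; exact: (cvg_ipZ I).
  by apply/funext => n; rewrite -(te_scale _ _ m) -te_add -te_scale; apply: te_ext => x y /=; ring.
Qed.

End Minimiser.

(** * Sobolev functions and traces *)

Section PlaneBorel.
Context (R : realType).
Local Notation R1 := (measurableTypeR R).

(** An open set is a countable union of rational squares. Test functions are merely smooth functions
    and not expressions, so their measurability comes from continuity. *)
Lemma open_measurable2 (U : set (R * R)) : open U -> measurable (U : set (R1 * R1)).
Proof.
move=> oU.
pose B (p q : rat) (n : nat) : set (R1 * R1) :=
  `]ratr p - n.+1%:R^-1, ratr p + n.+1%:R^-1[%classic `*`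
  `]ratr q - n.+1%:R^-1, ratr q + n.+1%:R^-1[%classic.
pose C p q n := if `[< B p q n `<=` U >] then B p q n else set0.
have -> : U = \bigcup_p \bigcup_q \bigcup_n C p q n.
  apply/seteqP; split; last first.
    by move=> z [p _ [q _ [n _]]]; rewrite /C; case: asboolP => // BU; exact: BU.
  move=> [x y] Uz; have /nbhs_ballP[e /= e0 He] := open_nbhs_nbhs (conj oU Uz).
  (* Half of [e], because a point of the square is within [1 / (n + 1)] of its centre, and so is
     [(x, y)]. *)
  have [n Hn] : exists n : nat, n.+1%:R^-1 < e / 2.
    exists (Num.truncn (e / 2)^-1); rewrite -[ltRHS]invrK ltf_pV2 ?posrE ?invr_gt0 ?divr_gt0//.
    exact: truncnS_gt.
  have n0 : 0 < n.+1%:R^-1 :> R by rewrite invr_gt0.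
  have [x1 [px [p _ pE]]] := @dense_rat R (ball x n.+1%:R^-1) (ex_intro _ x (ballxx x n0)) (ball_open x _).
  have [y1 [qy [q _ qE]]] := @dense_rat R (ball y n.+1%:R^-1) (ex_intro _ y (ballxx y n0)) (ball_open y _).
  subst x1 y1; exists p => //; exists q => //; exists n => //.
  move: px qy; rewrite /ball/= !ltr_distl => /andP[p1 p2] /andP[q1 q2].
  have BU : B p q n `<=` U.
    move=> [u v] [/=]; rewrite !in_itv/= => /andP[u1 u2] /andP[v1 v2].
    apply: He; split; rewrite /ball/= ltr_distl; apply/andP; split; move: (n.+1%:R^-1) Hn p1 p2 q1 q2 u1 u2 v1 v2 => d *; lra.
  rewrite /C asboolT//; split; rewrite /= in_itv/=; apply/andP; split;
    move: (n.+1%:R^-1) Hn p1 p2 q1 q2 => d *; lra.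
apply: bigcupT_measurable_rat => p; apply: bigcupT_measurable_rat => q.
apply: bigcupT_measurable => n; rewrite /C; case: ifP => // _.
by apply: measurableX; exact: measurable_itv.
Qed.

Lemma continuous_measurable2 (f : R * R -> R) : continuous f ->
  measurable_fun setT (f : R1 * R1 -> R).
Proof.
move=> /continuousP cf; apply: (measurability (@RGenOInfty.G R)).
  exact: RGenOInfty.measurableE.
move=> /= _ [_ [x ->] <-]; rewrite setTI.
by apply: open_measurable2; apply: cf; exact: interval_open.
Qed.

Lemma is_derive_fst (f : R * R -> R) (x y : R) : derivable f (x, y) (e1 R) ->
  is_derive (x : R) (1 : R) (fun t : R => f (t, y)) ('D_(e1 R) f (x, y)).
Proof.
have E : (fun h : R => h^-1 *: (f (h *: e1 R + (x, y)) - f (x, y))) =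
   (fun h : R => h^-1 *: ((fun t => f (t, y)) (h *: (1 : R) + x) - f (x, y))).
  apply/funext => h; congr (_ *: (f _ - _)).
  by rewrite /e1; congr (_, _); rewrite /= ?scaler0 ?add0r.
rewrite /derivable E => H; split; first exact: H.
by rewrite /derive E.
Qed.

Lemma is_derive_snd (f : R * R -> R) (x y : R) : derivable f (x, y) (e2 R) ->
  is_derive (y : R) (1 : R) (fun t : R => f (x, t)) ('D_(e2 R) f (x, y)).
Proof.
have E : (fun h : R => h^-1 *: (f (h *: e2 R + (x, y)) - f (x, y))) =
   (fun h : R => h^-1 *: ((fun t => f (x, t)) (h *: (1 : R) + y) - f (x, y))).
  apply/funext => h; congr (_ *: (f _ - _)).
  by rewrite /e2; congr (_, _); rewrite /= ?scaler0 ?add0r.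
rewrite /derivable E => H; split; first exact: H.
by rewrite /derive E.
Qed.

End PlaneBorel.

Section SobolevApprox.
Context (R : realType) (a b : R) (ha : 0 < a) (hb : 0 < b).
Local Notation leb := (@lebesgue_measure R).
Local Notation Om := (rectangle a b).
Local Notation Ia := (`]- a / 2, a / 2[%classic : set R).
Local Notation Ib := (`]- b / 2, b / 2[%classic : set R).
Local Notation lb2 := (leb \x leb)%E.
Local Notation H := (H2 a b).
Local Notation ipH := (@ipH R a b).
Local Notation te := (te ha hb).
Implicit Types (f : R * R -> R) (e : tf R).
Let I := ipH_inner a b.

Lemma integrable_continuous f : continuous f -> lb2.-integrable Om (EFin \o f).
Proof.
move=> cf; pose K : set (R * R) := `[- a / 2, a / 2]%classic `*` `[- b / 2, b / 2]%classic.
have cK : compact K by apply: compact_setX; exact: segment_compact.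
have [M [_ HM]] := compact_bounded (continuous_compact (continuous_subspaceT cf) cK).
apply: (@le_integrable _ _ _ lb2 Om (measurable_rect a b) _ (cst (M + 1)%:E)).
- apply/measurable_EFinP; apply: measurable_funTS; exact: continuous_measurable2.
- move=> z [z1 z2]; rewrite /= lee_fin (le_trans _ (ler_norm _))//.
  apply: (HM (M + 1)); first by rewrite ltrDl.
  exists z => //; split; exact: subset_itv_oo_cc.
- apply/integrableP; split; first exact: measurable_cst.
  rewrite (_ : (fun x => _) = cst `|M + 1|%:E)// integral_cst//; last exact: measurable_rect.
  by rewrite [X in (_ * X)%E](lebesgue_rect ha hb) -EFinM ltry.
Qed.

Lemma sqint_continuous f : continuous f -> sqint lb2 Om f.
Proof.
move=> cf; split; [exact: measurable_rect|exact: continuous_measurable2|].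
by apply: integrable_continuous => z; apply: cvgM; exact: cf.
Qed.

Definition ce f (cf : continuous f) : H := toL2 (measurable_rect a b) (sqint_continuous cf).

Lemma continuous_row f (y : R) : continuous f -> continuous (fun x : R => f (x, y)).
Proof.
move=> cf x; apply: continuous_comp; last exact: cf.
by apply: (@cvg_pair _ _ _ _ (nbhs x) (nbhs y) _ _ _ id (cst y)); [exact: cvg_id|exact: cvg_cst].
Qed.

Lemma continuous_col f (x : R) : continuous f -> continuous (fun y : R => f (x, y)).
Proof.
move=> cf y; apply: continuous_comp; last exact: cf.
by apply: (@cvg_pair _ _ _ _ (nbhs x) (nbhs y) _ _ _ (cst x) id); [exact: cvg_cst|exact: cvg_id].
Qed.

Lemma integrable_row (c : R) (f : R -> R) : continuous f ->
  leb.-integrable `]- c / 2, c / 2[ (EFin \o f).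
Proof.
move=> cf; apply: (@integrableS _ _ _ leb `[- c / 2, c / 2]%classic) => //.
- exact: subset_itv_oo_cc.
- apply: continuous_compact_integrable; first exact: segment_compact.
  exact: continuous_subspaceT.
Qed.

Lemma integral_dx_eq0 f g : continuous g ->
  (forall x y : R, is_derive (x : R) (1 : R) (fun t : R => f (t, y)) (g (x, y))) ->
  (forall y, f (a / 2, y) = 0) -> (forall y, f (- a / 2, y) = 0) ->
  \int[lb2]_(z in Om) g z = 0.
Proof.
move=> cg df fR fL; have Ig := integrable_continuous cg.
rewrite /Rintegral (fubini_rect2 Ig) (_ : integral _ _ _ = 0%E)//.
rewrite -[RHS](integral0 leb Ib); apply: eq_integral => y _.
have := FTC_sym ha (@continuous_row g y cg) (df^~ y); rewrite fR fL subrr => E.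
rewrite -[RHS]/((0 : R)%:E) -E /Rintegral fineK//; apply: integrable_fin_num; first exact: measurable_itv.
exact: (integrable_row _ (@continuous_row g y cg)).
Qed.

Lemma integral_dy_eq0 f g : continuous g ->
  (forall x y : R, is_derive (y : R) (1 : R) (fun t : R => f (x, t)) (g (x, y))) ->
  (forall x, f (x, b / 2) = 0) -> (forall x, f (x, - b / 2) = 0) ->
  \int[lb2]_(z in Om) g z = 0.
Proof.
move=> cg df fR fL; have Ig := integrable_continuous cg.
rewrite /Rintegral (fubini_rect1 Ig) (_ : integral _ _ _ = 0%E)//.
rewrite -[RHS](integral0 leb Ia); apply: eq_integral => x _.
have := FTC_sym hb (@continuous_col g x cg) (df x); rewrite fR fL subrr => E.
rewrite -[RHS]/((0 : R)%:E) -E /Rintegral fineK//; apply: integrable_fin_num; first exact: measurable_itv.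
exact: (integrable_row _ (@continuous_col g x cg)).
Qed.

Lemma ip_te_ce e f (cf : continuous f) : ipH (te e) (ce cf) = \int[lb2]_(z in Om) (ev e z * f z).
Proof. by []. Qed.

Lemma ip_add_Rintegral e e' f f' (cf : continuous f) (cf' : continuous f') :
  ipH (te e) (ce cf) + ipH (te e') (ce cf') =
  \int[lb2]_(z in Om) (ev e z * f z + ev e' z * f' z).
Proof.
rewrite !ip_te_ce -RintegralD//; first exact: measurable_rect.
- exact: (integrable_ip (te e) (ce cf)).
- exact: (integrable_ip (te e') (ce cf')).
Qed.

Lemma parts_dx e f (cf : continuous f) (cd : continuous (fun z => 'D_(e1 R) f z)) :
  (forall z, derivable f z (e1 R)) -> (forall z, ~ Om z -> f z = 0) ->
  ipH (te e) (ce cd) + ipH (te (dx e)) (ce cf) = 0.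
Proof.
move=> df f0; rewrite ip_add_Rintegral.
apply: (@integral_dx_eq0 (fun z => ev e z * f z)).
- move=> z; apply: cvgD; apply: cvgM; try exact: continuous_ev; [exact: cd|exact: cf].
- move=> x y; have D1 := is_derive_dx e x y; have D2 := is_derive_fst (df (x, y)).
  have := is_deriveM D1 D2.
  by move=> D; apply: (is_derive_eq D); rewrite /GRing.scale/=; ring.
- by move=> y; rewrite f0 ?mulr0// => -[]; rewrite /= in_itv/= ltxx andbF.
- by move=> y; rewrite f0 ?mulr0// => -[]; rewrite /= in_itv/= ltxx.
Qed.

Lemma parts_dy e f (cf : continuous f) (cd : continuous (fun z => 'D_(e2 R) f z)) :
  (forall z, derivable f z (e2 R)) -> (forall z, ~ Om z -> f z = 0) ->
  ipH (te e) (ce cd) + ipH (te (dy e)) (ce cf) = 0.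
Proof.
move=> df f0; rewrite ip_add_Rintegral.
apply: (@integral_dy_eq0 (fun z => ev e z * f z)).
- move=> z; apply: cvgD; apply: cvgM; try exact: continuous_ev; [exact: cd|exact: cf].
- move=> x y; have D1 := is_derive_dy e x y; have D2 := is_derive_snd (df (x, y)).
  have := is_deriveM D1 D2.
  by move=> D; apply: (is_derive_eq D); rewrite /GRing.scale/=; ring.
- by move=> y; rewrite f0 ?mulr0// => -[_]; rewrite /= in_itv/= ltxx andbF.
- by move=> y; rewrite f0 ?mulr0// => -[_]; rewrite /= in_itv/= ltxx.
Qed.

Lemma ip_EFin (f g : H) : (ipH f g)%:E = (\int[lb2]_(z in Om) (f z * g z)%:E)%E.
Proof.
rewrite /ipH /ip /Rintegral fineK//; apply: integrable_fin_num; first exact: measurable_rect.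
exact: integrable_ip.
Qed.

(** Integration by parts against a test function is exact for expressions, and both pairings are
    continuous in L^2. The pair [(v, D)] treats the two directions at once. *)
Lemma weak_deriv_lim (v : R * R) (D : tf R -> tf R) (F : nat -> tf R) (f d : H) :
  (v = e1 R /\ D = @dx R \/ v = e2 R /\ D = @dy R) ->
  cvg_ip ipH (fun n => te (F n)) f -> cvg_ip ipH (fun n => te (D (F n))) d ->
  weak_deriv Om v f d.
Proof.
move=> vD Ff Fd phi [sphi [K [_ KO phi0]]].
have [cphi dphi D1 D2] := sphi 2%N.
have cD : continuous (fun z => 'D_v phi z).
  by case: vD => -[-> _]; [case: D1|case: D2].
have f0 z : ~ Om z -> phi z = 0 by move=> Oz; apply: phi0 => /KO.
have parts e : ipH (te e) (ce cD) + ipH (te (D e)) (ce cphi) = 0.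
  case: vD => -[vE DE]; subst v D.
    by apply: parts_dx => // z; case: (dphi z).
  by apply: parts_dy => // z; case: (dphi z).
have L : ipH f (ce cD) + ipH d (ce cphi) = 0.
  have : (fun n => ipH (te (F n)) (ce cD) + ipH (te (D (F n))) (ce cphi)) @ \oo -->
      ipH f (ce cD) + ipH d (ce cphi) by apply: cvgD; exact: cvg_ip_ip.
  by rewrite (_ : (fun n => _) = fun=> 0); [move/cvg_cst_eq|exact/funext].
transitivity (ipH f (ce cD))%:E; first by rewrite ip_EFin.
transitivity (- (ipH d (ce cphi))%:E)%E; last by rewrite ip_EFin.
by rewrite -EFinN; congr EFin; apply/eqP; rewrite -addr_eq0 L.
Qed.

Lemma square_integrable_L2 d (T : measurableType d) (mu : {measure set T -> \bar R})
  (D : set T) (mD : measurable D) (f : L2 mu mD) : square_integrable mu D f.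
Proof.
have [_ mf If] := L2P f; split => //.
exact: measurable_funTS.
Qed.

Lemma H1_limit (F : nat -> tf R) (f d1 d2 : H) :
  cvg_ip ipH (fun n => te (F n)) f ->
  cvg_ip ipH (fun n => te (dx (F n))) d1 -> cvg_ip ipH (fun n => te (dy (F n))) d2 ->
  H1_with Om f d1 d2.
Proof.
move=> Ff F1 F2; split; try exact: square_integrable_L2.
- by apply: (weak_deriv_lim (D := @dx R) _ Ff F1); left.
- by apply: (weak_deriv_lim (D := @dy R) _ Ff F2); right.
Qed.

Lemma trace_limit (F : nat -> tf R) (f d1 d2 : H) (g : forall s, G1 a b s) :
  cvg_ip ipH (fun n => te (F n)) f ->
  cvg_ip ipH (fun n => te (dx (F n))) d1 -> cvg_ip ipH (fun n => te (dy (F n))) d2 ->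
  (forall s, cvg_ip (@ipG R a b s) (fun n => trs ha hb s (F n)) (g s)) ->
  is_trace a b f d1 d2 (fun s => g s).
Proof.
move=> Ff F1 F2 Fg; split; first by move=> s; exact: square_integrable_L2.
exists (fun n => ev (F n)); split.
- by move=> n; exact: smooth_ev.
- exact: (cvg_sqdist Ff).
- have := cvg_sqdist F1; rewrite (_ : (fun k => _) = fun k => sqdist lb2 Om (ev (dx (F k))) d1) //.
  by move=> L; under eq_fun do rewrite derive_ev1.
- have := cvg_sqdist F2; rewrite (_ : (fun k => _) = fun k => sqdist lb2 Om (ev (dy (F k))) d2) //.
  by move=> L; under eq_fun do rewrite derive_ev2.
- by move=> s; exact: (cvg_sqdist (Fg s)).
Qed.

End SobolevApprox.

(** * Trace inequalities and limits of approximating sequences *)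

Section SpinorLimit.
Context (R : realType) (a b : R) (ha : 0 < a) (hb : 0 < b).
Local Notation II := (II a b).
Local Notation Sx := (Sx a).
Local Notation nn := (nn a b).
Local Notation H := (H2 a b).
Local Notation ipH := (@ipH R a b).
Local Notation te := (te ha hb).
Local Notation trs := (trs ha hb).
Local Notation ipG := (@ipG R a b).
Implicit Types (p q : tf R) (s : side).
Let I := ipH_inner a b.
Let IG s := @ipG_inner R a b s.
Let cH := @ipH_complete R a b.

(** The argument of [side_le] turned by a right angle: the weight is affine in [y], 1 on the row [w]
    and 0 on the opposite row, and [k] is the sign of [w]. *)
Lemma row_le (f : tf R) (w : R) : w = b / 2 \/ w = - b / 2 ->
  Sx (sqT f) w <= (b^-1 + 1) * nn f + nn (dy f).
Proof.
move=> wE; have bn : b != 0 by rewrite gt_eqF.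
pose k := 2 * w / b.
have k2 : k ^+ 2 = 1 by rewrite /k; case: wE => ->; field.
pose v := AddT (Cst 2^-1) (MulT (Cst (k / b)) VY).
have E : Sx (sqT f) w = k * II (dy (MulT v (sqT f))).
  rewrite (II_dy ha hb) /k; case: wE => wE.
    rewrite (@eq_Sx _ a (MulT v _) (sqT f) (b / 2)) => [|x]; last first.
      by rewrite ev_mul /v /k wE /=; field.
    rewrite (@Sx0 _ a ha (MulT v _)) => [|x]; last by rewrite ev_mul /v /k wE /=; field.
    by rewrite wE; field.
  rewrite (@eq_Sx _ a (MulT v _) (sqT f) (- b / 2)) => [|x]; last first.
    by rewrite ev_mul /v /k wE /=; field.
  rewrite (@Sx0 _ a ha (MulT v _)) => [|x]; last by rewrite ev_mul /v /k wE /=; field.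
  by rewrite wE; field.
rewrite E /nn -!(II_scale ha hb) -(II_add ha hb); apply: (le_II ha hb) => x y [_].
rewrite /= in_itv/= => /andP[y1 y2].
set F := ev f _; set D := ev (dy f) _.
have V0 : 0 <= 2^-1 + k / b * y <= 1.
  have -> : 2^-1 + k / b * y = (b / 2 + k * y) / b by field.
  have k1 : k = 1 \/ k = -1 by rewrite /k; case: wE => ->; [left|right]; field.
  rewrite divr_ge0 ?(ltW hb)//=; last by case: k1 => ->; lra.
  by rewrite ler_pdivrMr// mul1r; case: k1 => ->; lra.
move: V0; set V := 2^-1 + _ => /andP[V0 V1].
have H1 := sqr_ge0 (k * V * F - D).
have H2 : (k * V * F) ^+ 2 <= F ^+ 2.
  have -> : (k * V * F) ^+ 2 = k ^+ 2 * (V ^+ 2 * F ^+ 2) by ring.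
  by rewrite k2 mul1r ler_piMl ?sqr_ge0// expr_le1.
have H3 : 2 * (k * V * F) * D <= F ^+ 2 + D ^+ 2 by rewrite sqrrB in H1; lra.
rewrite [leLHS](_ : _ = k ^+ 2 / b * F ^+ 2 + 2 * (k * V * F) * D); last by field.
by rewrite k2; move: H3; rewrite !expr2; lra.
Qed.

Lemma nsq_trs_le s (f : tf R) :
  ipG (trs s f) (trs s f) <= (a^-1 + b^-1 + 1) * (nn f + nn (dx f) + nn (dy f)).
Proof.
have a0 : 0 < a^-1 by rewrite invr_gt0.
have b0 : 0 < b^-1 by rewrite invr_gt0.
have h0 := nn_ge0 a b f; have h1 := nn_ge0 a b (dx f); have h2 := nn_ge0 a b (dy f).
have H1 (u v : R) : u <= (a^-1 + 1) * nn f + nn (dx f) -> u <= (a^-1 + b^-1 + 1) * (nn f + nn (dx f) + nn (dy f)).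
  by have := mulr_ge0 (ltW a0) h0; nra.
have H2 (u v : R) : u <= (b^-1 + 1) * nn f + nn (dy f) -> u <= (a^-1 + b^-1 + 1) * (nn f + nn (dx f) + nn (dy f)).
  by nra.
rewrite ip_trs; case: s.
- apply: H1 => //; have := side_le ha hb (or_introl erefl) f.
  by rewrite /sgn_side mul1r.
- apply: H1 => //; have := side_le ha hb (or_intror erefl) f.
  by rewrite /sgn_side mulN1r.
- by apply: H2 => //; apply: row_le; left.
- by apply: H2 => //; apply: row_le; right.
Qed.

Definition approx (F : nat -> tf R) (f d1 d2 : H) (g : forall s, G1 a b s) :=
  [/\ cvg_ip ipH (fun n => te (F n)) f, cvg_ip ipH (fun n => te (dx (F n))) d1,
      cvg_ip ipH (fun n => te (dy (F n))) d2 &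
      forall s, cvg_ip (@ipG s) (fun n => trs s (F n)) (g s)].

Lemma approx_lin (k l : R) F (f d1 d2 : H) g F' (f' d1' d2' : H) g' :
  approx F f d1 d2 g -> approx F' f' d1' d2' g' ->
  approx (fun n => AddT (MulT (Cst k) (F n)) (MulT (Cst l) (F' n)))
    (k *: f + l *: f') (k *: d1 + l *: d1') (k *: d2 + l *: d2')
    (fun s => k *: g s + l *: g' s).
Proof.
move=> [A1 A2 A3 A4] [B1 B2 B3 B4].
have L (D : tf R -> tf R) (u v : H) :
    (forall n x y, ev (D (AddT (MulT (Cst k) (F n)) (MulT (Cst l) (F' n)))) (x, y) =
       k * ev (D (F n)) (x, y) + l * ev (D (F' n)) (x, y)) ->
    cvg_ip ipH (fun n => te (D (F n))) u -> cvg_ip ipH (fun n => te (D (F' n))) v ->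
    cvg_ip ipH (fun n => te (D (AddT (MulT (Cst k) (F n)) (MulT (Cst l) (F' n))))) (k *: u + l *: v).
  move=> DE cu cv.
  rewrite (_ : (fun n => _) = fun n => k *: te (D (F n)) + l *: te (D (F' n))).
    by apply: (cvg_ipD I); exact: (cvg_ipZ I).
  by apply/funext => n; rewrite -!te_scale -te_add; apply: te_ext => x y; exact: DE.
split.
- exact: (L id).
- by apply: (L (@dx R)) => // n x y /=; ring.
- by apply: (L (@dy R)) => // n x y /=; ring.
- move=> s; rewrite (_ : (fun n => _) = fun n => k *: trs s (F n) + l *: trs s (F' n)).
    by apply: (cvg_ipD (IG s)); exact: (cvg_ipZ (IG s)).
  by apply/funext => n; rewrite -!trs_scale; exact/val_inj/funext.
Qed.

(** The trace inequality makes the boundary values Cauchy on each side, so the limits of function,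
    gradient and traces all come from one sequence. *)
Lemma approx_exists F (f : H) : cvg_ip ipH (fun n => te (F n)) f ->
  cauchy_ip ipH (fun n => te (dx (F n))) -> cauchy_ip ipH (fun n => te (dy (F n))) ->
  exists d1 d2 g, approx F f d1 d2 g.
Proof.
move=> Ff c1 c2; have [d1 F1] := cH c1; have [d2 F2] := cH c2.
have Fg s : exists g, cvg_ip (@ipG s) (fun n => trs s (F n)) g.
  apply: ipG_complete => e e0.
  pose C := a^-1 + b^-1 + 1.
  have C0 : 0 < C by rewrite /C !addr_gt0 ?invr_gt0.
  have e3 : 0 < e / (3 * C) by rewrite divr_gt0// mulr_gt0.
  have [N0 HN0] := cvg_ip_cauchy I Ff e3.
  have [N1 HN1] := c1 _ e3; have [N2 HN2] := c2 _ e3.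
  exists (maxn N0 (maxn N1 N2)) => i j; rewrite !geq_max => /and3P[i0 i1 i2] /and3P[j0 j1 j2].
  rewrite -trs_sub; apply: (le_trans (nsq_trs_le _ _)).
  have := HN0 i j i0 j0; have := HN1 i j i1 j1; have := HN2 i j i2 j2.
  rewrite !nsq_te_sub -/C.
  have eE : e = C * (e / (3 * C) + e / (3 * C) + e / (3 * C)) by field; rewrite gt_eqF.
  move=> h2 h1 h0; rewrite [leRHS]eE ler_pM2l//; apply: lerD; first apply: lerD => //.
    by rewrite /nn (@eq_II _ a b _ (sqT (SubT (dx (F i)) (dx (F j))))) => [|x y /=]; [exact: h1|ring].
  by rewrite /nn (@eq_II _ a b _ (sqT (SubT (dy (F i)) (dy (F j))))) => [|x y /=]; [exact: h2|ring].
exists d1, d2, (fun s => sval (cid (Fg s))); split => // s; exact: svalP.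
Qed.

End SpinorLimit.

(** * The Dirac eigenvalue *)

Section Eigenvalue.
Context (R : realType) (a b : R) (ha : 0 < a) (hb : 0 < b).
Local Notation leb := (@lebesgue_measure R).
Local Notation Om := (rectangle a b).
Local Notation lb2 := (leb \x leb)%E.
Local Notation nn := (nn a b).
Local Notation H := (H2 a b).
Local Notation ipH := (@ipH R a b).
Local Notation te := (te ha hb).
Local Notation trs := (trs ha hb).
Local Notation ipG := (@ipG R a b).
Local Notation bc := (bc a b).
Local Notation G := (G1 a b).
Implicit Types (s : side).
Let I := ipH_inner a b.
Let IG s := @ipG_inner R a b s.

Variables (m : R) (hm : 0 <= m).
Local Notation kk1 := (kk1 m).
Local Notation kk2 := (kk2 m).

Lemma cvg_ip_cst (V : lmodType R) (ip : V -> V -> R) (J : inner ip) (v : V) :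
  cvg_ip ip (fun=> v) v.
Proof. by rewrite /cvg_ip; under eq_fun do rewrite subrr (ip0l J); exact: cvg_cst. Qed.

Lemma trs_ext0 s (f : tf R) : (forall t, ev f (side_pt a b s t) = 0) -> trs s f = 0.
Proof. by move=> f0; apply/val_inj/funext => t; exact: f0. Qed.

Lemma trs_add s (f g : tf R) : trs s (AddT f g) = trs s f + trs s g.
Proof. exact/val_inj/funext. Qed.

Definition bc_rel s (x y : R) :=
  match s with
  | Right => y = - x
  | Left => y = x
  | Top => x = 0
  | Bottom => y = 0
  end.

Lemma nsq_sub_ae (X Y : H) : ipH (X - Y) (X - Y) = 0 ->
  {ae lb2, forall z, Om z -> X z = Y z}.
Proof.
move=> /nsq0_ae; apply: (@filterS _ _ (ae_filter_ringOfSetsType lb2)) => z XY Oz.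
by apply/eqP; rewrite -subr_eq0; apply/eqP; exact: XY.
Qed.

(** Closedness of [K]: convergence of the images forces convergence of the full gradient and of the
    traces, so the equations and the boundary relations pass to the limit almost everywhere. *)
Lemma graph_limit (p q : nat -> tf R) (P1 P2 X1 X2 : H) : (forall n, bc (p n) (q n)) ->
  cvg_ip ipH (fun n => te (p n)) P1 -> cvg_ip ipH (fun n => te (q n)) P2 ->
  cvg_ip ipH (fun n => te (kk1 (p n) (q n))) X1 ->
  cvg_ip ipH (fun n => te (kk2 (p n) (q n))) X2 ->
  exists p1 p2 q1 q2 (gp gq : forall s, G s),
  [/\ approx ha hb p P1 p1 p2 gp, approx ha hb q P2 q1 q2 gq,
      {ae lb2, forall z, Om z -> X1 z = p1 z - q2 z - m * P2 z},
      {ae lb2, forall z, Om z -> X2 z = - (q1 z + p2 z) + m * P1 z} &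
      forall s, {ae leb, forall t, side_dom a b s t -> bc_rel s (gp s t) (gq s t)}].
Proof.
move=> pq cp cq ck1 ck2.
have l1 : cvg_ip ipH (fun n => te (k1 (p n) (q n))) (X1 + m *: P2).
  rewrite (_ : (fun n => _) = fun n => te (kk1 (p n) (q n)) + m *: te (q n)).
    by apply: (cvg_ipD I) => //; exact: (cvg_ipZ I).
  by apply/funext => n; rewrite -te_scale -te_add; apply: te_ext => x y /=; ring.
have l2 : cvg_ip ipH (fun n => te (k2 (p n) (q n))) (X2 - m *: P1).
  rewrite (_ : (fun n => _) = fun n => te (kk2 (p n) (q n)) - m *: te (p n)).
    by apply: (cvg_ipB I) => //; exact: (cvg_ipZ I).
  by apply/funext => n; rewrite -te_scale -te_sub; apply: te_ext => x y /=; ring.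
have [_ _ c1 c2 [c3 c4]] := K0_cauchy pq l1 l2.
have [p1 [p2 [gp Ap]]] := approx_exists cp c1 c2.
have [q1 [q2 [gq Aq]]] := approx_exists cq c3 c4.
exists p1, p2, q1, q2, gp, gq; split => //.
- have [_ dp1 _ _] := Ap; have [_ _ dq2 _] := Aq.
  apply: (@nsq_sub_ae X1 (p1 - q2 - m *: P2)); apply: (cvg_ip_unique I ck1).
  rewrite (_ : (fun n => _) = fun n => te (dx (p n)) - te (dy (q n)) - m *: te (q n)).
    by apply: (cvg_ipB I); [exact: (cvg_ipB I)|exact: (cvg_ipZ I)].
  by apply/funext => n; rewrite -te_scale -!te_sub.
- have [_ _ dp2 _] := Ap; have [_ dq1 _ _] := Aq.
  apply: (@nsq_sub_ae X2 (- (q1 + p2) + m *: P1)); apply: (cvg_ip_unique I ck2).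
  rewrite (_ : (fun n => _) = fun n => -1 *: (te (dx (q n)) + te (dy (p n))) + m *: te (p n)).
    rewrite -[X in X + m *: P1]scaleN1r; apply: (cvg_ipD I); last exact: (cvg_ipZ I).
    by apply: (cvg_ipZ I); exact: (cvg_ipD I).
  by apply/funext => n; rewrite -te_add -!te_scale -te_add.
- have [_ _ _ tp] := Ap; have [_ _ _ tq] := Aq.
  have key s (g : G s) (F : nat -> tf R) : cvg_ip (@ipG s) (fun n => trs s (F n)) g ->
      (forall n t, ev (F n) (side_pt a b s t) = 0) ->
      {ae leb, forall t, side_dom a b s t -> g t = 0}.
    move=> Fg F0; apply: nsq0_ae; rewrite -[g]subr0.
    apply: (cvg_ip_unique (IG s) Fg).
    by rewrite (_ : (fun n => _) = fun=> 0); [exact: (cvg_ip_cst (IG s))|apply/funext => n; exact: trs_ext0].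
  move=> [].
  + have L : cvg_ip (@ipG Right) (fun n => trs Right (AddT (q n) (p n))) (gq Right + gp Right).
      rewrite (_ : (fun n => _) = fun n => trs Right (q n) + trs Right (p n)).
        exact: (cvg_ipD (IG Right)).
      by apply/funext => n; rewrite trs_add.
    have K0 n t : ev (AddT (q n) (p n)) (side_pt a b Right t) = 0.
      by have [_ _ qR _] := pq n; rewrite ev_add /= qR addNr.
    have := key Right _ _ L K0; apply: (@filterS _ _ (ae_filter_ringOfSetsType leb)) => t E0 Dt.
    by apply/eqP; rewrite -addr_eq0; apply/eqP; exact: E0.
  + have L : cvg_ip (@ipG Left) (fun n => trs Left (SubT (q n) (p n))) (gq Left - gp Left).
      rewrite (_ : (fun n => _) = fun n => trs Left (q n) - trs Left (p n)).
        exact: (cvg_ipB (IG Left)).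
      by apply/funext => n; rewrite trs_sub.
    have K0 n t : ev (SubT (q n) (p n)) (side_pt a b Left t) = 0.
      by have [_ _ _ qL] := pq n; rewrite ev_sub /= qL subrr.
    have := key Left _ _ L K0; apply: (@filterS _ _ (ae_filter_ringOfSetsType leb)) => t E0 Dt.
    by apply/eqP; rewrite -subr_eq0; apply/eqP; exact: E0.
  + by apply: (key Top _ _ (tp Top)) => n t; have [pT _ _ _] := pq n; exact: pT.
  + by apply: (key Bottom _ _ (tq Bottom)) => n t; have [_ qB _ _] := pq n; exact: qB.
Qed.

Local Open Scope complex_scope.

Definition cplx (f g : H) : R * R -> R[i] := fun z => f z +i* g z.

Lemma H1C_limit F G' (f d1 d2 f' d1' d2' : H) g g' :
  approx ha hb F f d1 d2 g -> approx ha hb G' f' d1' d2' g' ->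
  H1C_with Om (cplx f f') (cplx d1 d1') (cplx d2 d2').
Proof.
move=> [A1 A2 A3 _] [B1 B2 B3 _]; split; [exact: (H1_limit A1 A2 A3)|exact: (H1_limit B1 B2 B3)].
Qed.

Lemma traceC_limit F G' (f d1 d2 f' d1' d2' : H) g g' :
  approx ha hb F f d1 d2 g -> approx ha hb G' f' d1' d2' g' ->
  is_traceC a b (cplx f f') (cplx d1 d1') (cplx d2 d2') (fun s t => g s t +i* g' s t).
Proof.
move=> [A1 A2 A3 A4] [B1 B2 B3 B4].
by split; [exact: (trace_limit A1 A2 A3 A4)|exact: (trace_limit B1 B2 B3 B4)].
Qed.

Lemma ae_eq0_nsq (f : H) : {ae lb2, forall z, Om z -> f z = 0} -> ipH f f = 0.
Proof.
move=> f0; apply: EFin_inj; rewrite nsqE.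
rewrite (_ : 0%:E = (\int[lb2]_(x in Om) (cst 0%E x))%E); last by rewrite integral0.
apply: ae_eq_integral => //; first exact: measurable_rect.
  exact: (measurable_int lb2 (integrable_nsq f)).
by move: f0; apply: (@filterS _ _ (ae_filter_ringOfSetsType lb2)) => z f0 Oz; rewrite f0// expr0n.
Qed.

(** Here [x + i z] stands for [u1 + u2] and [- w + i y] for [u1 - u2], so the relations for the two
    real pairs combine into the complex condition on each side. *)
Lemma bc_rel_spinor s (x y z w : R) : bc_rel s x y -> bc_rel s z w ->
  (2^-1 * x + 2^-1 * w) +i* (2^-1 * z + - 2^-1 * y) =
  'i * ((normal R s).1%:C + 'i * (normal R s).2%:C) *
    ((2^-1 * x + - 2^-1 * w) +i* (2^-1 * y + 2^-1 * z)).
Proof.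
by case: s => /= H1 H2; subst; apply/eqP; rewrite eq_complex /=; apply/andP; split; apply/eqP; ring.
Qed.

Lemma dirac_spinor (lam p1 p2 q1 q2 r1 r2 s1 s2 x y z w : R) :
  (- lam) * z = p1 - q2 - m * y -> (- lam) * w = - (q1 + p2) + m * x ->
  lam * x = r1 - s2 - m * w -> lam * y = - (s1 + r2) + m * z ->
  let u1 := (2^-1 * x + - 2^-1 * w) +i* (2^-1 * y + 2^-1 * z) in
  let u2 := (2^-1 * x + 2^-1 * w) +i* (2^-1 * z + - 2^-1 * y) in
  let d1u1 := (2^-1 * p1 + - 2^-1 * s1) +i* (2^-1 * q1 + 2^-1 * r1) in
  let d1u2 := (2^-1 * p1 + 2^-1 * s1) +i* (2^-1 * r1 + - 2^-1 * q1) in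
  let d2u1 := (2^-1 * p2 + - 2^-1 * s2) +i* (2^-1 * q2 + 2^-1 * r2) in
  let d2u2 := (2^-1 * p2 + 2^-1 * s2) +i* (2^-1 * r2 + - 2^-1 * q2) in
  lam%:C * u1 = m%:C * u1 - 'i * (d1u2 - 'i * d2u2) /\
  lam%:C * u2 = - 'i * (d1u1 + 'i * d2u1) - m%:C * u2.
Proof.
move=> E1 E2 E3 E4 u1 u2 d1u1 d1u2 d2u1 d2u2.
by split; apply/eqP; rewrite eq_complex /=; apply/andP; split; apply/eqP; lra.
Qed.

(* Chosen so that [K P = - lam Q] and [K Q = lam P] give [H u = lam u]. *)
Definition spinor_of (f1 f2 g1 g2 : H) := Spinor
  (cplx (2^-1 *: f1 + - 2^-1 *: g2) (2^-1 *: f2 + 2^-1 *: g1))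
  (cplx (2^-1 *: f1 + 2^-1 *: g2) (2^-1 *: g1 + - 2^-1 *: f2)).

Lemma spin1_spinor_of f1 f2 g1 g2 z : spin1 (spinor_of f1 f2 g1 g2) z =
  (2^-1 * f1 z + - 2^-1 * g2 z) +i* (2^-1 * f2 z + 2^-1 * g1 z).
Proof. by []. Qed.

Lemma spin2_spinor_of f1 f2 g1 g2 z : spin2 (spinor_of f1 f2 g1 g2) z =
  (2^-1 * f1 z + 2^-1 * g2 z) +i* (2^-1 * g1 z + - 2^-1 * f2 z).
Proof. by []. Qed.

Lemma l2_scaleE (k : R) (f : H) z : (k *: f) z = k * f z. Proof. by []. Qed.

Lemma first_eigenvalue : exists lam : R, [/\ 0 < lam, dirac_eigenvalue a b m lam &
  forall p q, bc p q -> lam ^+ 2 * (nn p + nn q) <= nn (kk1 p q) + nn (kk2 p q)].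
Proof.
have [lam [P1 [P2 [Q1 [Q2 [p [q [r [s]]]]]]]]] := first_eigenpair ha hb hm.
move=> [lam0 nP lamE [pq cp cq ck1 ck2] [rs cr cs cl1 cl2]].
exists lam; split => //.
have [p1 [p2 [q1 [q2 [gp [gq [Ap Aq E1 E2 Bpq]]]]]]] := graph_limit pq cp cq ck1 ck2.
have [r1 [r2 [s1 [s2 [gr [gs [Ar As E3 E4 Brs]]]]]]] := graph_limit rs cr cs cl1 cl2.
have A1 := approx_lin 2^-1 (- 2^-1) Ap As.
have A2 := approx_lin 2^-1 2^-1 Aq Ar.
have A3 := approx_lin 2^-1 2^-1 Ap As.
have A4 := approx_lin 2^-1 (- 2^-1) Ar Aq.
exists (spinor_of P1 P2 Q1 Q2); split.
  move=> u0.
  (* Sums and differences of the components of a null spinor recover [P1] and [P2], contradicting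
     the normalisation of [P]. *)
  have z1 : ipH P1 P1 = 0.
    apply: ae_eq0_nsq; move: u0; apply: (@filterS _ _ (ae_filter_ringOfSetsType lb2)) => z u0 Oz.
    have [u1 u2] := u0 Oz.
    have H1 : 2^-1 * P1 z + - 2^-1 * Q2 z = 0 := congr1 (@complex.Re R) u1.
    have H2 : 2^-1 * P1 z + 2^-1 * Q2 z = 0 := congr1 (@complex.Re R) u2.
    by move: H1 H2; move: (P1 z) (Q2 z) => x y; lra.
  have z2 : ipH P2 P2 = 0.
    apply: ae_eq0_nsq; move: u0; apply: (@filterS _ _ (ae_filter_ringOfSetsType lb2)) => z u0 Oz.
    have [u1 u2] := u0 Oz.
    have H1 : 2^-1 * P2 z + 2^-1 * Q1 z = 0 := congr1 (@complex.Im R) u1.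
    have H2 : 2^-1 * Q1 z + - 2^-1 * P2 z = 0 := congr1 (@complex.Im R) u2.
    by move: H1 H2; move: (P2 z) (Q1 z) => x y; lra.
  by move: nP; rewrite z1 z2; lra.
exists (spinor_of p1 q1 r1 s1), (spinor_of p2 q2 r2 s2); split.
- by split; [exact: (H1C_limit A1 A2)|exact: (H1C_limit A3 A4)].
- have T1 := traceC_limit A1 A2; have T2 := traceC_limit A3 A4.
  eexists; eexists; split; [exact: T1|exact: T2|].
  move=> sd; have := @filterI _ _ (ae_filter_ringOfSetsType leb) _ _ (Bpq sd) (Brs sd).
  apply: (@filterS _ _ (ae_filter_ringOfSetsType leb)) => t [B1 B2] Dt.
  exact: (bc_rel_spinor (B1 Dt) (B2 Dt)).
- have := @filterI _ _ (ae_filter_ringOfSetsType lb2) _ _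
    (@filterI _ _ (ae_filter_ringOfSetsType lb2) _ _ E1 E2) (@filterI _ _ (ae_filter_ringOfSetsType lb2) _ _ E3 E4).
  apply: (@filterS _ _ (ae_filter_ringOfSetsType lb2)) => z [[e1 e2] [e3 e4]] Oz.
  have {}e1 := e1 Oz; have {}e2 := e2 Oz; have {}e3 := e3 Oz; have {}e4 := e4 Oz.
  rewrite l2_scaleE in e1; rewrite l2_scaleE in e2; rewrite l2_scaleE in e3; rewrite l2_scaleE in e4.
  have [D1 D2] := dirac_spinor e1 e2 e3 e4.
  split.
    rewrite -[LHS]/(lam%:C * spin1 (spinor_of P1 P2 Q1 Q2) z) spin1_spinor_of D1.
    rewrite -[RHS]/(m%:C * spin1 (spinor_of P1 P2 Q1 Q2) z -
      'i * (spin2 (spinor_of p1 q1 r1 s1) z - 'i * spin2 (spinor_of p2 q2 r2 s2) z)).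
    by rewrite spin1_spinor_of !spin2_spinor_of.
  rewrite -[LHS]/(lam%:C * spin2 (spinor_of P1 P2 Q1 Q2) z) spin2_spinor_of D2.
  rewrite -[RHS]/(- 'i * (spin1 (spinor_of p1 q1 r1 s1) z + 'i * spin1 (spinor_of p2 q2 r2 s2) z) -
    m%:C * spin2 (spinor_of P1 P2 Q1 Q2) z).
  by rewrite !spin1_spinor_of spin2_spinor_of.
Qed.

End Eigenvalue.

(** * Trial functions *)

Section NuOne.
Context (R : realType).

(** Cleared of denominators, the equation reads [t cos t + mu sin t = 0]. The left side is [mu > 0]
    at [pi / 2] and [- pi] at [pi]. *)
Lemma nu_root (mu : R) : 0 < mu -> exists nu : R,
  [/\ pi / 2 <= nu, nu < pi & tan nu / nu = - mu^-1].
Proof.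
move=> mu0; have p0 := pi_gt0 R.
pose f (t : R) := t * cos t + mu * sin t.
have cf : continuous f.
  move=> t; apply: cvgD; apply: cvgM; [exact: cvg_id|exact: continuous_cos|exact: cvg_cst|exact: continuous_sin].
have f1 : f (pi / 2) = mu by rewrite /f cos_pihalf sin_pihalf mulr0 add0r mulr1.
have f2 : f pi = - pi by rewrite /f cospi sinpi; ring.
have [c] : exists2 c, c \in `[pi / 2, pi] & f c = 0.
  apply: IVT; first by lra.
    exact: continuous_subspaceT.
  by rewrite f1 f2 ge_min le_max; apply/andP; split; apply/orP; [right|left]; lra.
rewrite in_itv/= => /andP[c1 c2] fc.
have c3 : c < pi by rewrite lt_neqAle c2 andbT; apply/eqP => cE; move: fc; rewrite cE f2; lra.
have c0 : 0 < c by lra.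
have s0 : 0 < sin c by apply: sin_gt0_pi; rewrite c0.
have cc : cos c != 0.
  apply/eqP => E; move: fc; rewrite /f E mulr0 add0r => /eqP.
  by rewrite mulf_eq0 !gt_eqF.
exists c; split => //; rewrite /tan.
have cn : c != 0 by rewrite gt_eqF.
have mn : mu != 0 by rewrite gt_eqF.
have E : mu * sin c = - (c * cos c) by move: fc; rewrite /f; lra.
have -> : sin c = - (c * cos c) / mu by rewrite -E mulrAC mulfV// mul1r.
by field; rewrite ?cn ?mn ?cc.
Qed.

(** The form without denominators also covers [mu = 0], where the value is [pi / 2]; it is the Robin
    condition met by the trial functions. *)
Lemma nu1P (mu : R) : 0 <= mu ->
  [/\ pi / 2 <= nu1 mu, nu1 mu < pi & nu1 mu * cos (nu1 mu) + mu * sin (nu1 mu) = 0].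
Proof.
have p0 := pi_gt0 R.
rewrite /nu1; case: eqVneq => [-> _|mun].
  by rewrite cos_pihalf; split; [|lra|ring].
rewrite le_eqVlt eq_sym (negbTE mun)/= => mu0.
set S := [set _ | _].
have [nu0 [n1 n2 n3]] := nu_root mu0.
have : S (xget 0 S) by apply: xgetPex; exists nu0; rewrite /S/= n1.
move: (xget 0 S) => nu [/andP[h1 h2] h3]; split => //.
have nun : nu != 0 by rewrite gt_eqF//; lra.
have cn : cos nu != 0.
  (* If the cosine were 0, its inverse and hence [tan nu] would take the default value 0, whereas
     [- mu^-1] is non-zero. *)
  apply/eqP => E; move: h3; rewrite /tan E invr0 mulr0 mul0r => /esym/eqP.
  by rewrite oppr_eq0 invr_eq0 (negbTE mun).
have -> : mu * sin nu = mu * (tan nu / nu) * (nu * cos nu).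
  by rewrite /tan; field; rewrite nun cn.
by rewrite h3; field.
Qed.

End NuOne.

Section Trial.
Context (R : realType) (a b : R) (ha : 0 < a) (hb : 0 < b).
Variables (m : R) (hm : 0 <= m).
Local Notation II := (II a b).
Local Notation nn := (nn a b).

(* The divergences of [w1] and [w2] absorb the cross terms [2 m p p_x] or
   [2 m p p_y] of the energy. *)
Lemma helmholtz_energy (c : R) (p w1 w2 : tf R) :
  (forall x y, ev (dx (dx p)) (x, y) + ev (dy (dy p)) (x, y) = - c * ev p (x, y)) ->
  (forall y, ev (SubT (MulT p (dx p)) w1) (a / 2, y) = 0) ->
  (forall y, ev (SubT (MulT p (dx p)) w1) (- a / 2, y) = 0) ->
  (forall x, ev (SubT (MulT p (dy p)) w2) (x, b / 2) = 0) ->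
  (forall x, ev (SubT (MulT p (dy p)) w2) (x, - b / 2) = 0) ->
  II (SubT (SubT (AddT (sqT (dx p)) (sqT (dy p))) (dx w1)) (dy w2)) = c * nn p.
Proof.
move=> Dp h1 h2 h3 h4.
have E1 : II (dx (SubT (MulT p (dx p)) w1)) = 0 by rewrite (II_dx ha hb) !(Sy0 hb)// subrr.
have E2 : II (dy (SubT (MulT p (dy p)) w2)) = 0 by rewrite (II_dy ha hb) !(Sx0 ha)// subrr.
rewrite -[RHS]add0r -{1}E1 -[X in X + _]addr0 -{1}E2 /nn -(II_scale ha hb) -!(II_add ha hb).
apply: eq_II => x y; have := Dp x y; rewrite /=.
move: (ev (dx (dx p)) _) (ev (dy (dy p)) _) => u v H.
have -> : c * (ev p (x, y) * ev p (x, y)) = - (u + v) * ev p (x, y) by rewrite H; ring.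
by ring.
Qed.

Lemma energy_diag p : nn (kk1 m p p) + nn (kk2 m p p) =
  2 * (II (SubT (SubT (AddT (sqT (dx p)) (sqT (dy p))) (dx (MulT (Cst m) (sqT p)))) (dy (Cst 0))) +
    m ^+ 2 * nn p).
Proof.
rewrite /nn -(II_scale ha hb (m ^+ 2)) -!(II_add ha hb) -(II_scale ha hb 2).
by apply: eq_II => x y /=; ring.
Qed.

Lemma energy_zero p : nn (kk1 m p (Cst 0)) + nn (kk2 m p (Cst 0)) =
  II (SubT (SubT (AddT (sqT (dx p)) (sqT (dy p))) (dx (Cst 0))) (dy (MulT (Cst m) (sqT p)))) +
    m ^+ 2 * nn p.
Proof.
rewrite /nn -(II_scale ha hb (m ^+ 2)) -!(II_add ha hb).
by apply: eq_II => x y /=; ring.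
Qed.

Variable lam : R.
Hypothesis lamE : forall p q, bc a b p q ->
  lam ^+ 2 * (nn p + nn q) <= nn (kk1 m p q) + nn (kk2 m p q).

Lemma half_angle_gt0 (nu : R) : pi / 2 <= nu -> nu < pi -> 0 < sin (nu / 2).
Proof.
by have := pi_gt0 R => p0 n1 n2; apply: sin_gt0_pi; apply/andP; split; lra.
Qed.

Lemma rect00 : rectangle a b (0, 0).
Proof. by move: ha hb => a0 b0; split; rewrite /= in_itv/=; apply/andP; split; lra. Qed.

Lemma trial_x : lam ^+ 2 <= (nu1 (m * a) / a) ^+ 2 + (pi / b) ^+ 2 + m ^+ 2.
Proof.
have [n1 n2 n3] := nu1P (mulr_ge0 hm (ltW ha)); move: (nu1 _) n1 n2 n3 => nu n1 n2 n3.
have an : a != 0 by rewrite gt_eqF.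
have bn : b != 0 by rewrite gt_eqF.
pose S := SinT (MulT (Cst (nu / a)) (SubT (Cst (a / 2)) VX)).
pose C := CosT (MulT (Cst (pi / b)) VY).
pose p := MulT S C.
have C0 x : ev C (x, b / 2) = 0.
  by rewrite /= (_ : _ * _ = pi / 2) ?cos_pihalf//; field.
have C1 x : ev C (x, - b / 2) = 0.
  by rewrite /= (_ : pi / _ * _ = - (pi / 2)) ?cosN ?cos_pihalf//; field.
have S0 y : ev S (a / 2, y) = 0.
  by rewrite /= (_ : _ * _ = 0) ?sin0//; field.
(* [C] vanishes on top and bottom and [S] on the right; on the left the condition [q = p] holds as
   both components coincide. *)
have pq : bc a b p p.
  split=> t; rewrite /p !ev_mul ?C0 ?C1 ?S0 ?mulr0 ?mul0r ?oppr0//.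
have g0 : 0 < nn p.
  apply: (nn_gt0 ha hb rect00); rewrite /p ev_mul mulf_neq0// /=.
    rewrite (_ : _ * _ = nu / 2); last by field.
    by rewrite gt_eqF// half_angle_gt0.
  by rewrite mulr0 cos0 oner_neq0.
have := lamE pq.
rewrite energy_diag (@helmholtz_energy ((nu / a) ^+ 2 + (pi / b) ^+ 2)).
- rewrite -mulrDl -mulr2n -[nn p *+ 2]mulr_natl mulrCA ler_pM2l//.
  by rewrite ler_pM2r.
- by move=> x y; rewrite /p /=; ring.
- by move=> y; rewrite ev_sub !ev_mul /p ?ev_mul S0; ring.
- move=> y; rewrite ev_sub !ev_mul /p ev_dx_mul.
  have -> : ev (dx C) (- a / 2, y) = 0 by rewrite /=; ring.
  have -> : ev (dx S) (- a / 2, y) = - (nu / a) * cos nu.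
    rewrite /= (_ : nu / a * (a / 2 + _) = nu); last by field.
    by ring.
  have -> : ev S (- a / 2, y) = sin nu by rewrite /= (_ : nu / a * (a / 2 + _) = nu)//; field.
  move: (ev C _) => c; rewrite ev_cst.
  (* On the left side the flux vanishes by the Robin condition [p_x = m p], which is the equation
     for [nu] with [mu = m a]. *)
  rewrite [LHS](_ : _ = - (sin nu * c ^+ 2 / a) * (nu * cos nu + m * a * sin nu)); last by field.
  by rewrite n3 mulr0.
- by move=> x; rewrite ev_sub !ev_mul /p ?ev_mul C0 /=; ring.
- by move=> x; rewrite ev_sub !ev_mul /p ?ev_mul C1 /=; ring.
Qed.

Lemma trial_y : lam ^+ 2 <= (pi / a) ^+ 2 + (nu1 (m * b) / b) ^+ 2 + m ^+ 2.
Proof.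
have [n1 n2 n3] := nu1P (mulr_ge0 hm (ltW hb)); move: (nu1 _) n1 n2 n3 => nu n1 n2 n3.
have an : a != 0 by rewrite gt_eqF.
have bn : b != 0 by rewrite gt_eqF.
pose S := SinT (MulT (Cst (nu / b)) (SubT (Cst (b / 2)) VY)).
pose C := CosT (MulT (Cst (pi / a)) VX).
pose p := MulT S C.
have C0 y : ev C (a / 2, y) = 0.
  by rewrite /= (_ : _ * _ = pi / 2) ?cos_pihalf//; field.
have C1 y : ev C (- a / 2, y) = 0.
  by rewrite /= (_ : pi / _ * _ = - (pi / 2)) ?cosN ?cos_pihalf//; field.
have S0 x : ev S (x, b / 2) = 0.
  by rewrite /= (_ : _ * _ = 0) ?sin0//; field.
(* [C] kills the vertical sides and [S] the top. The bottom constrains only the second component, so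
   [p] is free there and meets the Robin condition [p_y = m p]. *)
have pq : bc a b p (Cst 0).
  by split=> t; rewrite /p ?ev_mul ?C0 ?C1 ?S0 ?mulr0 ?mul0r ?oppr0.
have g0 : 0 < nn p.
  apply: (nn_gt0 ha hb rect00); rewrite /p ev_mul mulf_neq0// /=.
    rewrite (_ : _ * _ = nu / 2); last by field.
    by rewrite gt_eqF// half_angle_gt0.
  by rewrite mulr0 cos0 oner_neq0.
have := lamE pq.
have -> : nn (Cst 0) = 0.
  by rewrite /nn (@eq_II _ a b _ (MulT (Cst 0) p)) ?(II_scale ha hb) ?mul0r// => x y /=; ring.
rewrite energy_zero (@helmholtz_energy ((pi / a) ^+ 2 + (nu / b) ^+ 2)).
- by rewrite -mulrDl addr0 ler_pM2r.
- by move=> x y; rewrite /p /=; ring.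
- by move=> y; rewrite ev_sub !ev_mul /p ?ev_mul C0 /=; ring.
- by move=> y; rewrite ev_sub !ev_mul /p ?ev_mul C1 /=; ring.
- by move=> x; rewrite ev_sub !ev_mul /p ?ev_mul S0; ring.
- move=> x; rewrite ev_sub !ev_mul /p ev_dy_mul.
  have -> : ev (dy C) (x, - b / 2) = 0 by rewrite /=; ring.
  have -> : ev (dy S) (x, - b / 2) = - (nu / b) * cos nu.
    rewrite /= (_ : nu / b * (b / 2 + _) = nu); last by field.
    by ring.
  have -> : ev S (x, - b / 2) = sin nu by rewrite /= (_ : nu / b * (b / 2 + _) = nu)//; field.
  move: (ev C _) => c; rewrite ev_cst.
  rewrite [LHS](_ : _ = - (sin nu * c ^+ 2 / b) * (nu * cos nu + m * b * sin nu)); last by field.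
  by rewrite n3 mulr0.
Qed.

End Trial.

Theorem theorem3p5 (R : realType) (a b m lambda1 : R)
  (ha : 0 < a) (hb : 0 < b) (hm : 0 <= m)
  (hlambda1 : lowest_positive_eigenvalue a b m lambda1) :
  lambda1 ^+ 2 - m ^+ 2 <=
    Num.min ((nu1 (m * a) / a) ^+ 2 + (pi / b) ^+ 2)
            ((pi / a) ^+ 2 + (nu1 (m * b) / b) ^+ 2).
Proof.
have [l10 _ l1min] := hlambda1.
have [lam [lam0 Elam lamE]] := first_eigenvalue ha hb hm.
have l12 : lambda1 ^+ 2 <= lam ^+ 2.
  by rewrite lerXn2r ?nnegrE ?(ltW l10) ?(ltW lam0)//; exact: l1min.
rewrite le_min !lerBlDr; apply/andP; split; apply: (le_trans l12).
- exact: trial_x.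
- exact: trial_y.
Qed.
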